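(* Let $\lambda\in\mathbb{C}\setminus\{0\}$, and let $L=R_\lambda\phi(D)$ be an extended $\lambda$-eigenoperator of the differentiation operator $D$ on $\mathcal{H}(\mathbb{C})$, where $\phi$ is an entire function of exponential type (not identically zero, since $L\neq 0$). Then the following conditions are equivalent: (1) $L$ is supercyclic and not hypercyclic. (2) $|\lambda|<1$ and $\phi(0)=0$.
   Context: $\mathcal{H}(\mathbb{C})$ is the Fréchet space of entire functions on $\mathbb{C}$ with the compact-open topology; ''operator'' means continuous linear operator; $Df=f'$. An operator $L\neq 0$ on $\mathcal{H}(\mathbb{C})$ is an extended $\lambda$-eigenoperator of $D$ if $DL=\lambda LD$. The dilation operator is $R_\lambda f(z)=f(\lambda z)$. An entire function $\phi(z)=\sum_k \phi_k z^k$ is of exponential type if there are constants $A,B$ with $|\phi(z)|\leq Ae^{B|z|}$ for all $z\in\mathbb{C}$; then $\phi(D)f=\sum_k\phi_k f^{(k)}$ is an operator on $\mathcal{H}(\mathbb{C})$. An operator $T$ is hypercyclic if there is a vector $f$ with $\{T^nf: n\geq 1\}$ dense, and supercyclic if there is a vector $f$ with $\{\mu T^nf: n\in\mathbb{N},\ \mu\in\mathbb{C}\}$ dense. *)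

(* Defs.v *)
From HB Require Import structures.
From mathcomp Require Import all_boot all_order all_algebra.
From mathcomp Require Import all_classical all_reals all_analysis.
From mathcomp Require Import complex.
Import Order.TTheory GRing.Theory Num.Theory numFieldNormedType.Exports.

Set Implicit Arguments.
Unset Strict Implicit.
Unset Printing Implicit Defensive.

Local Open Scope ring_scope.
Local Open Scope classical_set_scope.

(* Packing [R[i]] as a [numClosedFieldType] is what gives it its topology and
   its structure of normed module over itself. *)
Definition Cplx (R : realType) : numClosedFieldType := R[i].

(* All functions from the complex plane to itself, with the compact-open
   topology. The space of entire functions is the subset [entire] below with
   the induced topology, and an operator on it is represented by a map on
   [fctC R] whose values outside [entire] are irrelevant. *)
Notation fctC R := {compact-open, Cplx R -> Cplx R}.

Section EntireFunctions.
Variable R : realType.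
Local Notation C := (Cplx R).

(* [derivable f z 1] is complex differentiability at [z]: the increments in
   its difference quotient range over [C]. *)
Definition entire : set (fctC R) :=
  [set f | forall z : C, derivable (f : C -> C) z 1].

Definition exponential_type (f : fctC R) : Prop :=
  exists A B : R, forall z : C,
    ComplexField.Normc.normc (f z) <=
      A * expR (B * ComplexField.Normc.normc z).

Definition diffop (f : fctC R) : fctC R := derive1 (f : C -> C).

Definition dilation (lambda : C) (f : fctC R) : fctC R :=
  fun z : C => f (lambda * z).

Definition taylor_coef (phi : fctC R) (k : nat) : C :=
  derive1n k (phi : C -> C) 0 / k`!%:R.

(* [phi(D)]; for [phi] entire of exponential type and [f] entire, the series
   converges at every point. *)
Definition fun_of_D (phi f : fctC R) : fctC R :=
  fun z : C =>
    limn (series (fun k : nat => taylor_coef phi k * derive1n k (f : C -> C) z)).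

Definition is_operator (T : fctC R -> fctC R) : Prop :=
  [/\ forall f, entire f -> entire (T f),
      forall (a : C) (f g : fctC R), entire f -> entire g ->
        T (a *: f + g) = a *: T f + T g
    & {within entire, continuous T}].

Definition ext_eigenoperator_D (lambda : C) (L : fctC R -> fctC R) : Prop :=
  [/\ is_operator L,
      exists2 f, entire f & L f <> 0
    & forall f, entire f -> diffop (L f) = lambda *: L (diffop f)].

Definition dense_in_entire (S : set (fctC R)) : Prop := entire `<=` closure S.

Definition hypercyclic (T : fctC R -> fctC R) : Prop :=
  exists2 f, entire f &
    dense_in_entire [set iter n T f | n in [set n | (1 <= n)%N]].

Definition supercyclic (T : fctC R -> fctC R) : Prop :=
  exists2 f, entire f &
    dense_in_entire [set mu *: iter n T f | mu in [set: C] & n in [set: nat]].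

End EntireFunctions.

(* Main.v *)
Require Import Defs.
From mathcomp Require Import all_boot all_order all_algebra.
From mathcomp Require Import all_classical all_reals all_analysis.
From mathcomp Require Import complex.
From mathcomp Require Import ring lra zify.
Import Order.TTheory GRing.Theory Num.Theory numFieldNormedType.Exports.

(** Write e_b for the exponential z |-> e^(b z). The whole proof rests on two
    computations: L e_b = phi(b) e_(lambda b), and L is triangular on the
    monomials, lowering degrees by the order m of the zero of phi at 0. Every
    other assertion on L follows from them by linearity and continuity, once
    polynomials and exponentials are known to be dense among entire functions.

    Entire functions are only assumed to have a complex derivative at each
    point, so power series expansions come first: Goursat's argument
    ([goursat], [primitive]), then a discrete form of Cauchy's formula in which
    circle integrals are replaced by means over roots of unity of order 2^m
    ([cauchy_poly], [entire_pval]). Completeness of the space of entire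
    functions ([pval_closed]) gives a Baire-type principle ([universality]),
    which produces both hypercyclic and supercyclic vectors.

    If |lambda| < 1, the transpose of L on functionals f |-> sum d_k f_k (f_k the
    Taylor coefficients of f) contracts the coordinates of large index. When
    phi(0) <> 0 this yields a functional u with u(L f) = phi(0) u(f); then
    v(f) = u(f') satisfies v(L f) = lambda phi(0) v(f), so the ratio v / u is
    multiplied by lambda at each step of an orbit, and L is not supercyclic
    ([not_supercyclic_eigen], [small_nonzero_not_supercyclic]). When phi(0) = 0
    it bounds (L^n f)(0) uniformly in n, so L is not hypercyclic
    ([small_not_hypercyclic]); but L^n kills the polynomials of degree < m n and
    maps polynomials onto polynomials, which is enough for supercyclicity
    ([small_supercyclic]).

    If |lambda| >= 1, a supercyclic L is hypercyclic, according to the zeros of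
    phi. If phi(0) = 0, polynomials are eventually killed and e_b is the image
    under L^n of a multiple of the tail of an exponential
    ([big_zero_hypercyclic]). If phi(0) <> 0 and phi(w) = 0, the exponentials of
    exponents lambda^-j w are eventually killed, and adding a combination of them
    to a multiple of an exponential makes it a small preimage of e_b
    ([generic_zero_hypercyclic]); when lambda is a root of unity, a power of L is
    diagonal on exponentials and Liouville's theorem provides eigenvalues inside
    and outside the unit circle ([root_of_unity_zero_hypercyclic]). If phi has no
    zero, it is phi(0) e_beta ([zero_free_exponential]), so that
    L f(z) = phi(0) f(lambda z + beta). This is a multiple of a nontrivial
    translation, which is hypercyclic, or else z |-> lambda z + beta has a fixed
    point z0 and evaluation at z0 is a functional u as above
    ([zero_free_dichotomy]). *)

Set Implicit Arguments.
Unset Strict Implicit.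
Unset Printing Implicit Defensive.

Local Open Scope ring_scope.
Local Open Scope classical_set_scope.

(** * Complex numbers with a real-valued modulus *)

Section Basics.
Variable R : realType.
Local Notation C := (Cplx R).

Definition nm (z : C) : R := ComplexField.Normc.normc z.
Definition ofR (x : R) : C := (x%:C)%C.
Definition re (z : C) : R := complex.Re z.
Definition im (z : C) : R := complex.Im z.

Lemma normE (z : C) : `|z| = ofR (nm z).
Proof. by []. Qed.

Lemma ofR_le (x y : R) : (ofR x <= ofR y) = (x <= y).
Proof. exact: lecR. Qed.

Lemma ofR_lt (x y : R) : (ofR x < ofR y) = (x < y).
Proof. exact: ltcR. Qed.

Lemma ofRD x y : ofR (x + y) = ofR x + ofR y.
Proof. exact: (rmorphD (real_complex R)). Qed.
Lemma ofRM x y : ofR (x * y) = ofR x * ofR y.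
Proof. exact: (rmorphM (real_complex R)). Qed.
Lemma ofR0 : ofR 0 = 0. Proof. by []. Qed.
Lemma ofR1 : ofR 1 = 1. Proof. by []. Qed.
Lemma ofRN x : ofR (- x) = - ofR x.
Proof. exact: (rmorphN (real_complex R)). Qed.
Lemma ofRn n : ofR n%:R = n%:R.
Proof. exact: (rmorph_nat (real_complex R)). Qed.

Lemma nmM x y : nm (x * y) = nm x * nm y.
Proof. exact: ComplexField.Normc.normcM. Qed.
Lemma nm0 : nm 0 = 0. Proof. exact: ComplexField.Normc.normc0. Qed.
Lemma nm1 : nm 1 = 1. Proof. exact: ComplexField.Normc.normc1. Qed.
Lemma nmN x : nm (- x) = nm x. Proof. exact: normcN. Qed.
Lemma nmV x : nm (x^-1) = (nm x)^-1. Proof. exact: ComplexField.Normc.normcV. Qed.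
Lemma nmD x y : nm (x + y) <= nm x + nm y. Proof. exact: le_normcD. Qed.
Lemma nm_eq0 x : nm x = 0 -> x = 0. Proof. exact: ComplexField.Normc.eq0_normc. Qed.
Lemma nm_ge0 x : 0 <= nm x.
Proof. by case: x => a b; exact: sqrtr_ge0. Qed.
Hint Resolve nm_ge0 : core.
Lemma nmB x y : nm (x - y) = nm (y - x).
Proof. by rewrite -nmN opprB. Qed.
Lemma nmX x n : nm (x ^+ n) = nm x ^+ n.
Proof. by elim: n => [|n IH]; rewrite ?expr0 ?nm1 // !exprS nmM IH. Qed.
Lemma nm_gt0 x : x != 0 -> 0 < nm x.
Proof.
by move=> /eqP x0; rewrite lt_neqAle nm_ge0 andbT eq_sym; apply/eqP => /nm_eq0.
Qed.
Lemma nm_ofR x : nm (ofR x) = `|x|.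
Proof. by rewrite /nm /ofR /= expr0n /= addr0 sqrtr_sqr. Qed.
Lemma nmn n : nm n%:R = n%:R.
Proof. by rewrite -ofRn nm_ofR ger0_norm. Qed.
Lemma nm_sum (I : Type) (s : seq I) (P : pred I) (F : I -> C) :
  nm (\sum_(i <- s | P i) F i) <= \sum_(i <- s | P i) nm (F i).
Proof.
elim/big_rec2: _ => [|i x y _ h]; first by rewrite nm0.
by apply: le_trans (nmD _ _) _; rewrite lerD2l.
Qed.
Lemma nm_prod (I : Type) (s : seq I) (P : pred I) (F : I -> C) :
  nm (\prod_(i <- s | P i) F i) = \prod_(i <- s | P i) nm (F i).
Proof. by apply: (big_morph nm nmM nm1). Qed.
Lemma nm_tri x y z : nm (x - z) <= nm (x - y) + nm (y - z).
Proof. by rewrite (_ : x - z = (x - y) + (y - z)) ?nmD //; ring. Qed.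
Lemma nmBD x y : nm (x - y) <= nm x + nm y.
Proof. by rewrite -(nmN y) nmD. Qed.
Lemma nm_le_dist x y : nm x <= nm y + nm (x - y).
Proof. by rewrite {1}(_ : x = y + (x - y)) ?nmD //; ring. Qed.

Definition ci : C := 'i%C.

Lemma ReIm z : z = ofR (re z) + ci * ofR (im z).
Proof. exact: complexE. Qed.
Lemma nm_i : nm ci = 1.
Proof. by rewrite /nm /= expr0n expr1n /= add0r sqrtr1. Qed.
Lemma nm_sqr z : nm z ^+ 2 = re z ^+ 2 + im z ^+ 2.
Proof. by case: z => a b; rewrite /nm /= sqr_sqrtr // addr_ge0 ?sqr_ge0. Qed.
Lemma nm_ge_re z : `|re z| <= nm z.
Proof.
rewrite -(@ler_pXn2r _ 2) ?nnegrE ?nm_ge0 ?normr_ge0 // nm_sqr.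
by rewrite -normrX ger0_norm ?sqr_ge0 // lerDl sqr_ge0.
Qed.
Lemma nm_ge_im z : `|im z| <= nm z.
Proof.
rewrite -(@ler_pXn2r _ 2) ?nnegrE ?nm_ge0 ?normr_ge0 // nm_sqr.
by rewrite -normrX ger0_norm ?sqr_ge0 // lerDr sqr_ge0.
Qed.
Lemma nm_le_reim z : nm z <= `|re z| + `|im z|.
Proof. by rewrite {1}(ReIm z) (le_trans (nmD _ _)) // nmM nm_i mul1r !nm_ofR. Qed.
Lemma reB x y : re (x - y) = re x - re y. Proof. by case: x; case: y. Qed.
Lemma imB x y : im (x - y) = im x - im y. Proof. by case: x; case: y. Qed.
Lemma reD x y : re (x + y) = re x + re y. Proof. by case: x; case: y. Qed.
Lemma imD x y : im (x + y) = im x + im y. Proof. by case: x; case: y. Qed.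

Lemma le_eps (x y : R) : (forall e, 0 < e -> x <= y + e) -> x <= y.
Proof. by move=> h; apply/ler_addgt0Pr. Qed.

Definition lim_to (u : nat -> C) (l : C) :=
  forall e : R, 0 < e -> exists N, forall n, (N <= n)%N -> nm (u n - l) <= e.

Lemma cvg_lim_to u l : (u @ \oo --> l) <-> lim_to u l.
Proof.
split.
  move/cvgrPdist_le => h e e0.
  have := h (ofR e); rewrite (ofR_lt 0) => /(_ e0) [N _ hN].
  by exists N => n /hN /=; rewrite distrC normE ofR_le.
move=> h; apply/cvgrPdist_le => e e0.
have eE : e = ofR (complex.Re e).
  by case: e e0 => a b; rewrite ltcE /= => /andP[/eqP -> _].
rewrite eE (ofR_lt 0) in e0 *.
have [N hN] := h _ e0; exists N => // n /hN.
by rewrite distrC normE ofR_le.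
Qed.

Lemma lim_to_le u l c e : lim_to u l -> (exists N, forall n, (N <= n)%N -> nm (u n - c) <= e) ->
  nm (l - c) <= e.
Proof.
move=> hu [N hN]; apply: le_eps => d d0.
have [N' hN'] := hu _ d0; pose n := maxn N N'.
rewrite (le_trans (nm_tri l (u n) c)) // addrC lerD ?hN ?leq_maxl //.
by rewrite nmB hN' ?leq_maxr.
Qed.

Lemma lim_to_uniq u l l' : lim_to u l -> lim_to u l' -> l = l'.
Proof.
move=> h h'; apply/eqP; rewrite -subr_eq0; apply/eqP/nm_eq0/le_anti.
rewrite nm_ge0 andbT; apply: le_eps => e e0; rewrite add0r.
by apply: (lim_to_le h); exact: h'.
Qed.

Lemma lim_to_cst l : lim_to (fun=> l) l.
Proof. by move=> e e0; exists 0%N => n _; rewrite subrr nm0 ltW. Qed.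

Lemma lim_toD u v l m : lim_to u l -> lim_to v m -> lim_to (fun n => u n + v n) (l + m).
Proof.
move=> hu hv e e0; have e2 : 0 < e / 2 by rewrite divr_gt0.
have [N hN] := hu _ e2; have [M hM] := hv _ e2.
exists (maxn N M) => n; rewrite geq_max => /andP[/hN h1 /hM h2].
rewrite (_ : _ - _ = (u n - l) + (v n - m)); last by ring.
by rewrite (le_trans (nmD _ _)) //; lra.
Qed.

Lemma lim_toM u v l m : lim_to u l -> lim_to v m -> lim_to (fun n => u n * v n) (l * m).
Proof.
move=> hu hv e e0.
have m1 : 0 < nm m + 1 by rewrite ltr_wpDl.
have l1 : 0 < nm l + 1 by rewrite ltr_wpDl.
have e2 : 0 < e / 2 / (nm m + 1) by rewrite !divr_gt0.
have e3 : 0 < Num.min 1 (e / 2 / (nm l + 1)) by rewrite lt_min ltr01 !divr_gt0.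
have [N hN] := hu _ e2; have [M hM] := hv _ e3.
exists (maxn N M) => n; rewrite geq_max => /andP[/hN h1 /hM].
rewrite le_min => /andP[h2 h3].
rewrite (_ : _ - _ = (u n - l) * v n + l * (v n - m)); last by ring.
rewrite (le_trans (nmD _ _)) // !nmM.
have hv1 : nm (v n) <= nm m + 1 by rewrite (le_trans (nm_le_dist _ m)) // lerD2l.
have -> : e = e / 2 / (nm m + 1) * (nm m + 1) + (nm l + 1) * (e / 2 / (nm l + 1)).
  by field; rewrite !gt_eqF.
by rewrite lerD // ler_pM // lerDl.
Qed.

Lemma lim_toN u l : lim_to u l -> lim_to (fun n => - u n) (- l).
Proof.
move=> hu e /hu [N hN]; exists N => n /hN.
by rewrite -opprD nmN.
Qed.

Lemma lim_toB u v l m : lim_to u l -> lim_to v m -> lim_to (fun n => u n - v n) (l - m).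
Proof. by move=> hu hv; apply: lim_toD => //; apply: lim_toN. Qed.

Lemma lim_toS u l : lim_to u l -> lim_to (fun n => u n.+1) l.
Proof. by move=> h e /h [N hN]; exists N => n Nn; apply: hN; apply: leqW. Qed.

Lemma lim_to_ext u v l : (forall n, u n = v n) -> lim_to u l -> lim_to v l.
Proof. by move=> /funext ->. Qed.

Lemma limn_lim_to u l : lim_to u l -> limn u = l.
Proof. by move=> /cvg_lim_to h; exact: cvg_lim. Qed.

Lemma cauchy_lim_to (u : nat -> C) :
  (forall e : R, 0 < e -> exists N, forall n, (N <= n)%N -> nm (u n - u N) <= e) ->
  exists l, lim_to u l.
Proof.
move=> hu.
have real_cauchy (w : nat -> R) : (forall m n, `|w m - w n| <= nm (u m - u n)) ->
    exists l, forall e : R, 0 < e -> exists N, forall n, (N <= n)%N -> `|w n - l| <= e.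
  move=> hw; have cw : cvgn w.
    apply/cauchy_cvgP/cauchy_exP => e e0.
    have e2 : 0 < e / 2 by rewrite divr_gt0.
    have [N hN] := hu _ e2; exists (w N), N => // n /= /hN h.
    by rewrite /ball /= distrC (le_lt_trans (hw _ _)) // (le_lt_trans h) //; lra.
  exists (limn w) => e e0.
  have /cvgrPdist_le/(_ _ e0) [N _ hN] := cw.
  by exists N => n /hN; rewrite distrC.
have [a ha] : exists l, forall e : R, 0 < e -> exists N, forall n, (N <= n)%N -> `|re (u n) - l| <= e.
  by apply: real_cauchy => m n; rewrite -reB nm_ge_re.
have [b hb] : exists l, forall e : R, 0 < e -> exists N, forall n, (N <= n)%N -> `|im (u n) - l| <= e.
  by apply: real_cauchy => m n; rewrite -imB nm_ge_im.
exists (ofR a + ci * ofR b) => e e0.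
have e2 : 0 < e / 2 by rewrite divr_gt0.
have [N hN] := ha _ e2; have [M hM] := hb _ e2.
exists (maxn N M) => n; rewrite geq_max => /andP[/hN h1 /hM h2].
rewrite {1}(ReIm (u n)) (_ : _ - _ = ofR (re (u n) - a) + ci * ofR (im (u n) - b)); last first.
  by rewrite !ofRD !ofRN; ring.
rewrite (le_trans (nmD _ _)) // nmM nm_i mul1r !nm_ofR; lra.
Qed.

End Basics.
#[export] Hint Resolve nm_ge0 : core.
Arguments re R z : simpl never.
Arguments im R z : simpl never.
Arguments nm R z : simpl never.
Arguments ofR R x : simpl never.
Arguments ci R : simpl never.

(** * Differentiability, compact discs and the compact-open topology *)

Section Bridge.
Variable R : realType.
Local Notation C := (Cplx R).
Local Notation nm := (@nm R).

(** The increment formula, with real tolerances: it is equivalent to the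
    convergence of difference quotients ([diffquot_P]) and needs no division. *)
Definition cdiff (f : C -> C) (z v : C) :=
  forall e : R, 0 < e -> exists2 d : R, 0 < d &
    forall h, nm h <= d -> nm (f (z + h) - f z - h * v) <= e * nm h.

Lemma posC_ofR (e : C) : 0 < e -> exists2 x : R, 0 < x & e = ofR x.
Proof.
case: e => a b; rewrite ltcE /= => /andP[/eqP -> a0].
by exists a.
Qed.

Lemma nbhsC_P (z : C) (A : set C) :
  nbhs z A <-> exists2 d : R, 0 < d & forall w, nm (w - z) <= d -> A w.
Proof.
split.
  move/nbhs_ballP => [e /= /posC_ofR [x x0 ->] h].
  exists (x / 2); first by rewrite divr_gt0.
  move=> w hw; apply: h; rewrite -ball_normE /= distrC normE ofR_lt.
  by apply: le_lt_trans hw _; lra.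
move=> [d d0 h]; apply/nbhs_ballP; exists (ofR d); first by rewrite /= (ofR_lt 0).
move=> w; rewrite -ball_normE /= distrC normE ofR_lt => /ltW; exact: h.
Qed.

Lemma dnbhs0_P (A : set C) :
  dnbhs (0 : C) A <-> exists2 d : R, 0 < d & forall w, nm w <= d -> w != 0 -> A w.
Proof.
split.
  move=> /nbhsC_P [d d0 h]; exists d => // w wd w0.
  by apply: h => //; rewrite subr0.
move=> [d d0 h]; apply/nbhsC_P; exists d => // w; rewrite subr0; exact: h.
Qed.

Lemma diffquot_P (f : C -> C) (z v : C) :
  ((fun h : C => h^-1 *: (f (h + z) - f z)) @ (0 : C)^' --> v) <-> cdiff f z v.
Proof.
split.
  move/cvgrPdist_le => h e e0.
  have := h (ofR e); rewrite (ofR_lt 0) => /(_ e0) /dnbhs0_P [d d0 hd].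
  exists d => // k kd; have [->|k0] := eqVneq k 0.
    by rewrite addr0 mul0r subrr subr0 nm0 mulr0.
  have := hd k kd k0; rewrite normE ofR_le => hk.
  rewrite (_ : _ - _ = (v - k^-1 *: (f (k + z) - f z)) * - k); last first.
    by rewrite /GRing.scale /= (addrC k); field.
  by rewrite nmM nmN ler_wpM2r ?nm_ge0.
move=> hf; apply/cvgrPdist_le => e /posC_ofR [x x0 ->].
have [d d0 hd] := hf _ x0; apply/dnbhs0_P; exists d => // k kd k0.
rewrite normE ofR_le.
rewrite (_ : _ - _ = (f (z + k) - f z - k * v) * - k^-1); last first.
  by rewrite /GRing.scale /= (addrC k); field.
by rewrite nmM nmN nmV ler_pdivrMr ?nm_gt0 // hd.
Qed.

Lemma cdiff_derive1 (f : C -> C) z v : cdiff f z v -> derive1 f z = v.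
Proof. by move=> /diffquot_P h; apply: cvg_lim h. Qed.

Lemma cdiff_derivable (f : C -> C) z v : cdiff f z v -> derivable f z 1.
Proof.
move=> /diffquot_P h; apply: (cvgP v).
rewrite (_ : (fun _ => _) = (fun h : C => h^-1 *: (f (h + z) - f z))) //.
by apply/funext => k; rewrite /= /GRing.scale /= mulr1.
Qed.

Lemma derivable_cdiff (f : C -> C) z : derivable f z 1 -> cdiff f z (derive1 f z).
Proof.
move=> h; apply/diffquot_P; rewrite derive1E.
move: h; rewrite /derivable /derive => h.
rewrite (_ : (fun h : C => h^-1 *: (f (h + z) - f z)) =
  (fun h : C => h^-1 *: ((f \o shift z) (h *: 1) - f z))) //.
by apply/funext => k; rewrite /= /GRing.scale /= mulr1.
Qed.

Lemma entireP (f : fctC R) : entire f <-> forall z, exists v, cdiff (f : C -> C) z v.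
Proof.
split => h z; first by exists (derive1 (f : C -> C) z); exact: derivable_cdiff.
by have [v /cdiff_derivable] := h z.
Qed.

Definition ccont (f : C -> C) :=
  forall z (e : R), 0 < e -> exists2 d : R, 0 < d &
    forall w, nm (w - z) <= d -> nm (f w - f z) <= e.

Lemma cdiff_ccont (f : C -> C) : (forall z, exists v, cdiff f z v) -> ccont f.
Proof.
move=> hf z e e0; have [v hv] := hf z.
have [d d0 hd] := hv _ (@ltr01 R).
have n1 : 0 < nm v + 1 by rewrite ltr_wpDl ?nm_ge0.
exists (Num.min d (e / (nm v + 1))); first by rewrite lt_min d0 divr_gt0.
move=> w; rewrite le_min => /andP[h1 h2].
have := hd _ h1; rewrite (_ : z + (w - z) = w) ?mul1r; last by ring.
move=> h3; apply: le_trans (nm_le_dist _ ((w - z) * v)) _.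
rewrite nmM; rewrite ler_pdivlMr // in h2; lra.
Qed.

Lemma ccont_continuous (f : C -> C) : ccont f -> continuous f.
Proof.
move=> hf z A /nbhsC_P [e e0 he].
have [d d0 hd] := hf z _ e0.
by apply/nbhsC_P; exists d => // w /hd /he.
Qed.

Lemma reI (a b : R) : re (ofR a + ci R * ofR b) = a.
Proof. by rewrite /re /=; ring. Qed.
Lemma imI (a b : R) : im (ofR a + ci R * ofR b) = b.
Proof. by rewrite /im /=; ring. Qed.

(** A square is the continuous image of a product of two segments. Discs are
    handled by enclosing them in squares. *)
Lemma compact_square (r : R) : compact [set z : C | `|re z| <= r /\ `|im z| <= r].
Proof.
have cI := @segment_compact R (- r) r.
pose mk (p : R * R) : C := ofR p.1 + ci R * ofR p.2.
rewrite (_ : [set z : C | _] = mk @` (`[(- r), r] `*` `[(- r), r])); last first.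
  apply/seteqP; split => [z [h1 h2]|z [[a b] /= [+ +] <-]].
    exists (re z, im z); last by rewrite /mk /= -ReIm.
    by split; rewrite /= in_itv /= -ler_norml.
  rewrite !in_itv /= -!ler_norml /mk /= => h1 h2.
  by rewrite reI imI.
apply: continuous_compact; last exact: compact_setX.
apply: continuous_subspaceT => -[a b] A /nbhsC_P [e e0 he].
have e2 : 0 < e / 2 by rewrite divr_gt0.
exists (ball a (e / 2), ball b (e / 2)).
  by split; exact: nbhsx_ballx.
move=> [x y] /= [hx hy]; apply: he.
rewrite (_ : _ - _ = ofR (x - a) + ci R * ofR (y - b)); last first.
  by rewrite /mk /= !ofRD !ofRN; ring.
rewrite (le_trans (nmD _ _)) // nmM nm_i mul1r !nm_ofR.
by move: hx hy; rewrite /ball /= !(distrC _ x) !(distrC _ y); lra.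
Qed.

Definition square (r : R) : set C := [set z | `|re z| <= r /\ `|im z| <= r].

Lemma nm_square r z : nm z <= r -> square r z.
Proof. by move=> h; split; apply: le_trans h; [exact: nm_ge_re|exact: nm_ge_im]. Qed.

(** Heine's theorem. *)
Lemma ccont_unif (f : C -> C) (r e : R) : ccont f -> 0 < e ->
  exists2 d : R, 0 < d & forall z w, nm z <= r -> nm (w - z) <= d -> nm (f w - f z) <= e.
Proof.
move=> hf e0.
have := @compact_square r; rewrite compact_near_coveringP => hc.
have e2 : 0 < e / 2 by rewrite divr_gt0.
have := hc R (0 : R)^'+ (fun d z => forall w, nm (w - z) <= d -> nm (f w - f z) <= e) _.
case.
  move=> z _; have [d d0 hd] := hf z _ e2.
  exists ([set z' | nm (z' - z) <= d / 2], [set x : R | x <= d / 2]) => /=.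
    split; first by apply/nbhsC_P; exists (d / 2) => //; rewrite divr_gt0.
    by apply: nbhs_right_le; rewrite divr_gt0.
  move=> [z' x] /= [h1 h2] w hw.
  rewrite (le_trans (nm_tri _ (f z) _)) // nmB (_ : e = e / 2 + e / 2); last by lra.
  rewrite lerD //; last by rewrite nmB; apply: hd; lra.
  by rewrite nmB; apply: hd; rewrite (le_trans (nm_tri _ z' _)) //; lra.
move=> x /= x0 hx; exists (x / 2); first by rewrite divr_gt0.
move=> z w zr wz; apply: (hx (x / 2)) => //=.
- by rewrite sub0r normrN gtr0_norm ?divr_gt0 //; lra.
- by rewrite divr_gt0.
- exact: nm_square.
Qed.

Lemma ccont_bounded (f : C -> C) (r : R) : ccont f ->
  exists2 M : R, 0 <= M & forall z, nm z <= r -> nm (f z) <= M.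
Proof.
move=> hf.
have := @compact_square r; rewrite compact_near_coveringP => hc.
have := hc R +oo%R (fun M z => nm (f z) <= M) _.
case.
  move=> z _; have [d d0 hd] := hf z _ ltr01.
  exists ([set z' | nm (z' - z) <= d], [set x : R | nm (f z) + 1 <= x]) => /=.
    split; first by apply/nbhsC_P; exists d.
    by apply: nbhs_pinfty_ge; rewrite num_real.
  move=> [z' x] /= [h1 h2]; have := hd _ h1 => h3.
  by rewrite (le_trans (nm_le_dist _ (f z))) //; lra.
move=> M [_ hM]; exists (Num.max 0 (M + 1)); first by rewrite le_max lexx.
move=> z /nm_square zr; apply: (hM (Num.max 0 (M + 1))) => //.
by rewrite lt_max ltrDl ltr01 orbT.
Qed.

Definition dclose (r e : R) (f g : C -> C) := forall z, nm z <= r -> nm (f z - g z) <= e.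

Lemma close_nbhs (f : fctC R) r e : ccont f -> 0 < e -> nbhs f [set g : fctC R | dclose r e g f].
Proof.
move=> hf e0.
have := @compact_open_fam_compactP C C f (nbhs (f : fctC R)) (ccont_continuous hf) _.
move=> [+ _] => /(_ (fun A => id)) /fam_cvgP /(_ (square r) (@compact_square r)).
apply; apply/uniform_nbhs.
exists [set xy : C * C | ball xy.1 (ofR e) xy.2]; split.
  by rewrite -entourage_ballE; exists (ofR e); rewrite /= ?(ofR_lt 0).
move=> g /= hg z /nm_square /hg.
by rewrite -ball_normE /= distrC normE ofR_lt => /ltW.
Qed.

Lemma compact_nm_bounded (K : set C) : compact K -> exists r : R, forall z, K z -> nm z <= r.
Proof.
rewrite compact_near_coveringP => hc.
have := hc R +oo%R (fun M z => nm z <= M) _.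
case.
  move=> z _.
  exists ([set z' | nm (z' - z) <= 1], [set x : R | nm z + 1 <= x]) => /=.
    split; first by apply/nbhsC_P; exists 1.
    by apply: nbhs_pinfty_ge; rewrite num_real.
  move=> [z' x] /= [h1 h2].
  by rewrite (le_trans (nm_le_dist _ z)) //; lra.
move=> M [_ hM]; exists (M + 1) => z zK.
by apply: (hM (M + 1)) => //; rewrite ltrDl.
Qed.

(** Compact sets are bounded, so around a continuous function the discs are
    enough to describe the compact-open topology. *)
Lemma nbhs_close (f : fctC R) (A : set (fctC R)) : ccont f -> nbhs f A ->
  exists r e, [/\ 0 < r, 0 < e & forall g : fctC R, dclose r e g f -> A g].
Proof.
move=> hf fA.
pose D := [set re : R * R | 0 < re.1 /\ 0 < re.2].
pose B (re : R * R) := [set g : C -> C | dclose re.1 re.2 g f].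
have FF : Filter (filter_from D B).
  apply: filter_from_filter; first by exists (1, 1); split => /=.
  move=> [r e] [r' e'] [/= r0 e0] [/= r'0 e'0].
  exists (Num.max r r', Num.min e e'); first by split; rewrite /= ?lt_max ?lt_min ?r0 ?e0.
  move=> g /= hg; split => z /= zr.
    by have := hg z; rewrite /= !le_max zr le_min => /(_ isT) /andP[].
  by have := hg z; rewrite /= !le_max zr le_min orbT => /(_ isT) /andP[].
have := @compact_open_fam_compactP C C f (filter_from D B) (ccont_continuous hf) _.
move=> [_ h].
have {h} : {compact-open, filter_from D B --> (f : fctC R)}.
  apply: h; apply/fam_cvgP => K /compact_nm_bounded [r hr] P /uniform_nbhs [E [+ hP]].
  rewrite -entourage_ballE => -[e0 /= /posC_ofR [e ep ->] hE].
  exists (Num.max 1 r, e / 2); first by split => /=; rewrite ?lt_max ?ltr01 ?divr_gt0.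
  move=> g hg; apply: hP => z /hr zr; apply: hE; rewrite /= -ball_normE /= distrC normE ofR_lt.
  by have := hg z; rewrite /= le_max zr orbT => /(_ isT) h; lra.
move=> /(_ _ fA) [[r e] [/= r0 e0] h].
by exists r, e; split => // g /h.
Qed.

Lemma dense_in_entireP (S : set (fctC R)) :
  dense_in_entire S <-> forall f r e, entire f -> 0 < r -> 0 < e ->
    exists2 g, S g & dclose r e g f.
Proof.
split.
  move=> hS f r e fE r0 e0; have hc := cdiff_ccont (iffLR (entireP f) fE).
  have [g [gS hg]] := hS _ fE _ (close_nbhs r hc e0).
  by exists g.
move=> hS f fE A fA; have hc := cdiff_ccont (iffLR (entireP f) fE).
have [r [e [r0 e0 h]]] := nbhs_close hc fA.
by have [g gS /h Ag] := hS f r e fE r0 e0; exists g.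
Qed.

Lemma within_cont (T : fctC R -> fctC R) (f : fctC R) (r e : R) :
  (forall f, entire f -> entire (T f)) ->
  {within @entire R, continuous T} -> entire f -> 0 < e ->
  exists r' e', [/\ 0 < r', 0 < e' & forall g, entire g -> dclose r' e' g f -> dclose r e (T g) (T f)].
Proof.
move=> hT hc fE e0.
have cf := cdiff_ccont (iffLR (entireP f) fE).
have cTf := cdiff_ccont (iffLR (entireP _) (hT _ fE)).
move/subspace_continuousP : hc => /(_ _ fE _ (close_nbhs r cTf e0)).
move=> /(nbhs_close cf) [r' [e' [r0 e'0 h]]].
by exists r', e'; split => // g gE /h; apply.
Qed.

End Bridge.

(** * Power series with infinite radius of convergence *)

Section PowerSeries.
Variable R : realType.
Local Notation C := (Cplx R).
Local Notation nm := (@nm R).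
Local Notation lim_to := (@lim_to R).

(** The coefficient sequences of entire functions: by the Cauchy estimates this
    is necessary as well. *)
Definition Ecoef (a : nat -> C) :=
  forall r : R, 0 < r -> exists K : R, forall k, nm (a k) * r ^+ k <= K.

Definition psum (a : nat -> C) n (z : C) : C := \sum_(k < n) a k * z ^+ k.
Definition pval (a : nat -> C) (z : C) : C := limn (fun n => psum a n z).

Lemma psumS a n z : psum a n.+1 z = psum a n z + a n * z ^+ n.
Proof. by rewrite /psum big_ord_recr. Qed.

Lemma pow_small (K q e : R) : 0 <= q < 1 -> 0 < e -> exists N, forall n, (N <= n)%N -> K * q ^+ n <= e.
Proof.
move=> /andP[q0 q1] e0; have K1 : 0 < `|K| + 1 by rewrite ltr_wpDl.
have /cvgrPdist_le /(_ (e / (`|K| + 1))) : (fun n => q ^+ n) @ \oo --> (0 : R).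
  by apply: cvg_expr; rewrite ger0_norm.
move=> /(_ (divr_gt0 e0 K1)) [N _ hN]; exists N => n /hN.
rewrite sub0r normrN ger0_norm ?exprn_ge0 // => h.
apply: (@le_trans _ _ ((`|K| + 1) * q ^+ n)).
  by rewrite ler_wpM2r ?exprn_ge0 // (le_trans (ler_norm _)) // lerDl.
by rewrite mulrC -ler_pdivlMr.
Qed.

Lemma half_pow_small (K e : R) : 0 < e -> exists N, forall n, (N <= n)%N -> K * 2^-1 ^+ n <= e.
Proof. by move=> e0; apply: pow_small => //; rewrite invr_ge0 ler0n invf_lt1 // ltr1n. Qed.

(** A bound on the circle of radius 2r makes the terms on the disc of radius r
    decrease like 2^-k. *)
Lemma psum_tail a (K r : R) n m z : 0 < r -> (forall k, nm (a k) * (2 * r) ^+ k <= K) ->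
  nm z <= r -> (n <= m)%N -> nm (psum a m z - psum a n z) <= 2 * K * 2^-1 ^+ n.
Proof.
move=> r0 hK zr nm_; have K0 : 0 <= K.
  by apply: le_trans (hK 0%N); rewrite mulr_ge0 ?nm_ge0.
rewrite -(subnKC nm_); set p := (m - n)%N.
suff : nm (psum a (n + p) z - psum a n z) <= 2 * K * (2^-1 ^+ n - 2^-1 ^+ (n + p)).
  move=> h; apply: le_trans h _; rewrite ler_wpM2l ?mulr_ge0 //.
  by rewrite gerBl exprn_ge0 ?invr_ge0.
elim: p => [|p IH]; first by rewrite addn0 !subrr nm0 mulr0.
rewrite addnS psumS (_ : _ + _ - _ = psum a (n + p) z - psum a n z + a (n + p)%N * z ^+ (n + p)); last by ring.
apply: le_trans (nmD _ _) _.
have : nm (a (n + p)%N * z ^+ (n + p)) <= K * 2^-1 ^+ (n + p).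
  rewrite nmM nmX; apply: (@le_trans _ _ (nm (a (n + p)%N) * r ^+ (n + p))).
    by rewrite ler_wpM2l ?nm_ge0 // lerXn2r ?nnegrE ?nm_ge0 // ltW.
  have := hK (n + p)%N; rewrite exprMn => h.
  rewrite exprVn ler_pdivlMr ?exprn_gt0 //; apply: le_trans h.
  by rewrite le_eqVlt; apply/orP; left; apply/eqP; ring.
rewrite exprS; move: IH; move: (nm _) (nm _) => x y; nra.
Qed.

Lemma pval_lim a z : Ecoef a -> lim_to (fun n => psum a n z) (pval a z).
Proof.
move=> ha; have r0 : 0 < nm z + 1 by rewrite ltr_wpDl ?nm_ge0.
have [|K hK] := ha (2 * (nm z + 1)); first by rewrite mulr_gt0.
suff [l hl] : exists l, lim_to (fun n => psum a n z) l by rewrite /pval (limn_lim_to hl).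
apply: cauchy_lim_to => e e0.
have [N hN] := half_pow_small (2 * K) e0.
exists N => n Nn; apply: le_trans (hN N (leqnn N)).
by apply: (psum_tail r0 hK) => //; rewrite lerDl.
Qed.

Lemma pval_tail a (K r : R) n z : 0 < r -> (forall k, nm (a k) * (2 * r) ^+ k <= K) -> Ecoef a ->
  nm z <= r -> nm (pval a z - psum a n z) <= 2 * K * 2^-1 ^+ n.
Proof.
move=> r0 hK ha zr; apply: (lim_to_le (pval_lim z ha)).
by exists n => m nm_; apply: (psum_tail r0 hK).
Qed.

Lemma pval_bound a (K r : R) z : 0 < r -> (forall k, nm (a k) * (2 * r) ^+ k <= K) -> Ecoef a ->
  nm z <= r -> nm (pval a z) <= 2 * K.
Proof.
move=> r0 hK ha zr; have := pval_tail 0 r0 hK ha zr.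
by rewrite /psum big_ord0 subr0 expr0 mulr1.
Qed.

Lemma pval_approx a (r e : R) : Ecoef a -> 0 < r -> 0 < e ->
  exists N, forall n z, (N <= n)%N -> nm z <= r -> nm (pval a z - psum a n z) <= e.
Proof.
move=> ha r0 e0; have [|K hK] := ha (2 * r); first by rewrite mulr_gt0.
have [N hN] := half_pow_small (2 * K) e0.
by exists N => n z /hN h zr; apply: le_trans (pval_tail n r0 hK ha zr) h.
Qed.

Lemma Ecoef_dom a b (M s : R) : 0 < s -> 0 <= M -> (forall k, nm (a k) <= M * s ^+ k * nm (b k)) ->
  Ecoef b -> Ecoef a.
Proof.
move=> s0 M0 h hb r r0; have [|K hK] := hb (s * r); first exact: mulr_gt0.
exists (M * K) => k.
apply: (@le_trans _ _ (M * s ^+ k * nm (b k) * r ^+ k)).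
  by rewrite ler_wpM2r // exprn_ge0 // ltW.
by rewrite -!mulrA ler_wpM2l // (le_trans _ (hK k)) // exprMn !mulrA (mulrC (nm _)).
Qed.

Lemma Ecoef_ext a b : (forall k, a k = b k) -> Ecoef a -> Ecoef b.
Proof. by move=> /funext ->. Qed.

Lemma EcoefD a b : Ecoef a -> Ecoef b -> Ecoef (fun k => a k + b k).
Proof.
move=> ha hb r r0; have [K hK] := ha r r0; have [M hM] := hb r r0.
exists (K + M) => k; apply: le_trans (lerD (hK k) (hM k)); rewrite -mulrDl.
by rewrite ler_wpM2r ?nmD // exprn_ge0 // ltW.
Qed.

Lemma EcoefZ c a : Ecoef a -> Ecoef (fun k => c * a k).
Proof. by apply: (@Ecoef_dom _ _ (nm c) 1) => // k; rewrite expr1n mulr1 nmM. Qed.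

Lemma EcoefB a b : Ecoef a -> Ecoef b -> Ecoef (fun k => a k - b k).
Proof.
move=> ha hb; apply: (Ecoef_ext _ (EcoefD ha (EcoefZ (-1) hb))) => k.
by rewrite mulN1r.
Qed.

Lemma Ecoef_poly a N : (forall k, (N <= k)%N -> a k = 0) -> Ecoef a.
Proof.
move=> h r r0; exists (\sum_(k < N) nm (a k) * r ^+ k) => k.
have p0 j : 0 <= nm (a j) * r ^+ j by rewrite mulr_ge0 ?nm_ge0 // exprn_ge0 // ltW.
have [kN|/h ->] := ltnP k N; last by rewrite nm0 mul0r sumr_ge0.
by rewrite (bigD1 (Ordinal kN)) //= lerDl sumr_ge0.
Qed.

Lemma pval_poly a N z : (forall k, (N <= k)%N -> a k = 0) -> pval a z = psum a N z.
Proof.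
move=> h; apply: limn_lim_to => e e0; exists N => n Nn.
rewrite (_ : psum a n z = psum a N z) ?subrr ?nm0 ?ltW //.
rewrite -(subnKC Nn); elim: (n - N)%N => [|p IH]; first by rewrite addn0.
by rewrite addnS psumS IH h ?leq_addr // mul0r addr0.
Qed.

Lemma pvalD a b z : Ecoef a -> Ecoef b -> pval (fun k => a k + b k) z = pval a z + pval b z.
Proof.
move=> ha hb; apply: (lim_to_uniq (pval_lim z (EcoefD ha hb))).
apply: lim_to_ext (lim_toD (pval_lim z ha) (pval_lim z hb)) => n.
by rewrite /psum -big_split /=; apply: eq_bigr => k _; rewrite mulrDl.
Qed.

Lemma pvalZ c a z : Ecoef a -> pval (fun k => c * a k) z = c * pval a z.
Proof.
move=> ha; apply: (lim_to_uniq (pval_lim z (EcoefZ c ha))).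
apply: lim_to_ext (lim_toM (lim_to_cst c) (pval_lim z ha)) => n.
by rewrite /psum big_distrr /=; apply: eq_bigr => k _; rewrite mulrA.
Qed.

Lemma pvalB a b z : Ecoef a -> Ecoef b -> pval (fun k => a k - b k) z = pval a z - pval b z.
Proof.
move=> ha hb; rewrite -[- pval b z]mulN1r -pvalZ // -pvalD //; last exact: EcoefZ.
by congr pval; apply/funext => k; rewrite mulN1r.
Qed.

Lemma pval0 a : Ecoef a -> pval a 0 = a 0%N.
Proof.
move=> ha; apply: limn_lim_to => e e0; exists 1%N => -[//|n] _.
rewrite /psum big_ord_recl /= expr0 mulr1 big1 ?addr0 ?subrr ?nm0 ?ltW //.
by move=> i _; rewrite expr0n mulr0.
Qed.

Lemma pval_dclose a b (r e : R) : 0 < r -> Ecoef a -> Ecoef b ->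
  (forall k, nm (a k - b k) * (2 * r) ^+ k <= e) -> dclose r (2 * e) (pval a) (pval b).
Proof.
move=> r0 ha hb h z zr; rewrite -pvalB //.
by apply: (pval_bound r0) => //; apply: EcoefB.
Qed.

Definition shiftd (a : nat -> C) k : C := k.+1%:R * a k.+1.

Lemma Ecoef_shiftd a : Ecoef a -> Ecoef (shiftd a).
Proof.
move=> ha r r0; have [|K hK] := ha (2 * r); first by rewrite mulr_gt0.
exists (K / r) => k; rewrite ler_pdivlMr // -mulrA -exprSr nmM nmn.
apply: le_trans (hK k.+1); rewrite exprMn mulrCA !mulrA.
rewrite ler_wpM2r ?exprn_ge0 ?(ltW r0) // ler_wpM2r ?nm_ge0 //.
by rewrite -natrX ler_nat ltnW // ltn_expl.
Qed.

(** The bound is geometric in k, so that it can be summed against the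
    coefficients of an entire function. *)
Lemma pow_remainder (z h : C) (rho : R) k : nm h <= 1 -> nm z + 1 <= rho ->
  nm ((z + h) ^+ k - z ^+ k - h * (k%:R * z ^+ k.-1)) <= nm h ^+ 2 * (2 * rho) ^+ k.
Proof.
move=> h1 hz; have z0 := nm_ge0 z; have hh0 := nm_ge0 h.
have r1 : 1 <= rho by lra.
elim: k => [|k IH].
  by rewrite !expr0 subrr mul0r mulr0 subr0 nm0 mulr1 exprn_ge0.
have -> : (z + h) ^+ k.+1 - z ^+ k.+1 - h * (k.+1%:R * z ^+ k.+1.-1) =
    (z + h) * ((z + h) ^+ k - z ^+ k - h * (k%:R * z ^+ k.-1)) + h ^+ 2 * (k%:R * z ^+ k.-1).
  case: k {IH} => [|k]; first by rewrite /= !expr0 !expr1 ; ring.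
  by rewrite /= !exprS -!natr1; ring.
apply: le_trans (nmD _ _) _; rewrite !nmM nmn !nmX.
have hzh : nm (z + h) <= rho by apply: le_trans (nmD _ _) _; lra.
have kk : k%:R * nm z ^+ k.-1 <= (2 * rho) ^+ k.
  rewrite exprMn ler_pM ?exprn_ge0 //.
    by rewrite -natrX ler_nat ltnW // ltn_expl.
  apply: (@le_trans _ _ (rho ^+ k.-1)); first by rewrite lerXn2r ?nnegrE //; lra.
  by rewrite ler_weXn2l // leq_pred.
have := ler_pM (nm_ge0 _) (nm_ge0 _) hzh IH.
have := ler_wpM2l (exprn_ge0 2 hh0) kk.
have : 0 <= nm h ^+ 2 * (2 * rho) ^+ k by rewrite mulr_ge0 ?exprn_ge0 //; lra.
set A := nm h ^+ 2 * _ ^+ k => A0 hB hD.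
rewrite [leRHS](_ : _ = rho * A + rho * A); last by rewrite /A (exprS _ k); ring.
apply: lerD => //; apply: le_trans hB _.
by rewrite ler_peMl.
Qed.

(** By [pow_remainder] the second-order remainders of the terms add up to O(h^2). *)
Lemma pval_cdiff a z : Ecoef a -> cdiff (pval a) z (pval (shiftd a) z).
Proof.
move=> ha e e0.
have rho0 : 0 < nm z + 1 by rewrite ltr_wpDl ?nm_ge0.
have [|K hK] := ha (2 * (2 * (nm z + 1))); first by rewrite !mulr_gt0.
have K0 : 0 <= K by apply: le_trans (hK 0%N); rewrite mulr_ge0 ?nm_ge0.
exists (Num.min 1 (e / (2 * K + 1))); first by rewrite lt_min ltr01 divr_gt0 //; lra.
move=> h; rewrite le_min => /andP[h1 h2].
have hs := Ecoef_shiftd ha.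
have hl := lim_toB (lim_toB (lim_toS (pval_lim (z + h) ha)) (lim_toS (pval_lim z ha)))
  (lim_toM (lim_to_cst h) (pval_lim z hs)).
rewrite -[X in nm X]subr0; apply: (lim_to_le hl); exists 0%N => n _; rewrite subr0.
have -> : psum a n.+1 (z + h) - psum a n.+1 z - h * psum (shiftd a) n z =
   \sum_(k < n.+1) a k * ((z + h) ^+ k - z ^+ k - h * (k%:R * z ^+ k.-1)).
  rewrite /psum [X in h * X](_ : _ = \sum_(k < n.+1) k%:R * a k * z ^+ k.-1); last first.
    by rewrite big_ord_recl /= mul0r mul0r add0r.
  rewrite big_distrr -!sumrB; apply: eq_bigr => k _ /=; ring.
apply: le_trans (nm_sum _ _ _) _.
have : forall k, nm (a k * ((z + h) ^+ k - z ^+ k - h * (k%:R * z ^+ k.-1))) <=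
   nm h ^+ 2 * (K * 2^-1 ^+ k).
  move=> k; rewrite nmM.
  apply: (@le_trans _ _ (nm (a k) * (nm h ^+ 2 * (2 * (nm z + 1)) ^+ k))).
    by rewrite ler_wpM2l ?nm_ge0 // pow_remainder.
  rewrite mulrCA ler_wpM2l ?exprn_ge0 ?nm_ge0 // exprVn ler_pdivlMr ?exprn_gt0 //.
  by apply: le_trans (hK k); rewrite (exprMn k 2 (2 * (nm z + 1))) -mulrA (mulrC _ (2 ^+ k)).
move=> hk; apply: (le_trans (ler_sum _ (fun i _ => hk _))).
rewrite -big_distrr /= -big_distrr /= .
have : \sum_(i < n.+1) (2^-1 : R) ^+ i <= 2.
  suff -> : \sum_(i < n.+1) (2^-1 : R) ^+ i = 2 - 2^-1 ^+ n by rewrite gerBl exprn_ge0 ?invr_ge0.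
  elim: n {hl} => [|n IH]; first by rewrite big_ord_recl big_ord0 !expr0; ring.
  by rewrite big_ord_recr /= IH exprS; lra.
rewrite ler_pdivlMr in h2; last by lra.
have := nm_ge0 h; move: (\sum_(i < _) _) (nm h) h2 => S x h2 x0 S2.
have : K * S <= K * 2 by rewrite ler_wpM2l.
nra.
Qed.

Lemma pval_entire a : Ecoef a -> entire (pval a : fctC R).
Proof. by move=> ha; apply/entireP => z; exists (pval (shiftd a) z); apply: pval_cdiff. Qed.

Lemma pval_derive1 a : Ecoef a -> derive1 (pval a) = pval (shiftd a).
Proof. by move=> ha; apply/funext => z; apply: cdiff_derive1; apply: pval_cdiff. Qed.

Definition shiftn n (a : nat -> C) k : C := ((k + n) ^_ n)%:R * a (k + n)%N.

Lemma shiftnS n a : shiftd (shiftn n a) = shiftn n.+1 a.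
Proof.
apply/funext => k; rewrite /shiftd /shiftn mulrA -natrM addSnnS.
by by rewrite ffactnSr addnS subSn ?leq_addl // addnK mulnC.
Qed.

Lemma Ecoef_shiftn n a : Ecoef a -> Ecoef (shiftn n a).
Proof.
move=> ha; elim: n => [|n IH]; last by rewrite -shiftnS; apply: Ecoef_shiftd.
by apply: Ecoef_ext ha => k; rewrite /shiftn addn0 ffactn0 mul1r.
Qed.

Lemma pval_derive1n n a : Ecoef a -> derive1n n (pval a) = pval (shiftn n a).
Proof.
move=> ha; elim: n => [|n IH].
  by rewrite derive1n0; congr pval; apply/funext => k; rewrite /shiftn addn0 ffactn0 mul1r.
by rewrite derive1nS IH pval_derive1 ?shiftnS //; apply: Ecoef_shiftn.
Qed.

Lemma taylor_coef_pval a k : Ecoef a -> taylor_coef (pval a) k = a k.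
Proof.
move=> ha; rewrite /taylor_coef pval_derive1n // pval0; last exact: Ecoef_shiftn.
by rewrite /shiftn add0n ffactnn mulrC mulrA mulVf ?mul1r // pnatr_eq0 -lt0n fact_gt0.
Qed.

End PowerSeries.
Arguments pval_entire {R a} _.

(** * Means over roots of unity and Cauchy estimates *)

Section RootsOfUnity.
Variable R : realType.
Local Notation C := (Cplx R).
Local Notation nm := (@nm R).

(** A primitive root of unity of order 2^(m+1). Of the two square roots of the
    previous one, the closer to 1 is taken, so that the polygon of the powers has
    mesh tending to 0. *)
Fixpoint uroot (m : nat) : C :=
  if m is m'.+1 then
    let s := sqrtC (uroot m') in if nm (s - 1) <= nm (s + 1) then s else - s
  else -1.

Lemma uroot_sqr m : uroot m.+1 ^+ 2 = uroot m.
Proof. by rewrite /=; case: ifP => _; rewrite ?sqrrN sqrtCK. Qed.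

Lemma uroot_half m : uroot m ^+ (2 ^ m) = -1.
Proof. by elim: m => [|m IH]; rewrite ?expr1 // expnS exprM uroot_sqr. Qed.

Lemma uroot_full m : uroot m ^+ (2 ^ m.+1) = 1.
Proof. by rewrite expnSr exprM uroot_half sqrrN expr1n. Qed.

Lemma uroot_neq1 m l : (0 < l < 2 ^ m.+1)%N -> uroot m ^+ l != 1.
Proof.
elim: m l => [|m IH] l.
  by case: l => [|[|l]] // _; rewrite expr1 -subr_eq0 -opprD oppr_eq0 (_ : 1 + 1 = 2%:R) // pnatr_eq0.
(* For l even, u_(m+1)^l = u_m^(l/2); for l odd, raising to the power 2^(m+1)
   gives (-1)^l = -1. *)
have [lo|le] := boolP (odd l); last first.
  have -> : l = (2 * l./2)%N by rewrite mul2n even_halfK.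
  move=> /andP[l0 l1]; rewrite exprM uroot_sqr IH //.
  by move: l0 l1; rewrite (expnS 2 m.+1); lia.
move=> _; apply/eqP => h.
have : (uroot m.+1 ^+ l) ^+ (2 ^ m.+1) = 1 by rewrite h expr1n.
rewrite exprAC uroot_half -signr_odd lo expr1 => /eqP.
by rewrite -subr_eq0 -opprD oppr_eq0 (_ : 1 + 1 = 2%:R) // pnatr_eq0.
Qed.

Lemma uroot_nm m : nm (uroot m) = 1.
Proof.
elim: m => [|m IH]; first by rewrite /= nmN nm1.
by apply/eqP; rewrite -(@eqrXn2 _ 2) ?nm_ge0 // -nmX uroot_sqr IH expr1n.
Qed.

Lemma nm_parallelogram (z : C) : nm (z - 1) ^+ 2 + nm (z + 1) ^+ 2 = 2 * nm z ^+ 2 + 2.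
Proof.
have r1 : re (1 : C) = 1 by [].
have i1 : im (1 : C) = 0 by [].
by rewrite !nm_sqr reB imB reD imD r1 i1; ring.
Qed.

(** From (s - 1) (s + 1) = s^2 - 1 and |s + 1|^2 >= 2, by the parallelogram law. *)
Lemma uroot_near1 m : nm (uroot m - 1) ^+ 2 <= 4 * 2^-1 ^+ m.
Proof.
elim: m => [|m IH].
  rewrite /= -opprD nmN (_ : 1 + 1 = 2%:R) // nmn; lra.
have hs : nm (uroot m.+1 - 1) <= nm (uroot m.+1 + 1).
  rewrite /=; case: ifP => // /negbT; rewrite -ltNge => /ltW.
  by rewrite -opprD nmN addrC (addrC (- _)) (nmB 1).
have h1 : nm (uroot m.+1 - 1) * nm (uroot m.+1 + 1) = nm (uroot m - 1).
  by rewrite -nmM -subr_sqr_1 uroot_sqr.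
have := nm_parallelogram (uroot m.+1); rewrite uroot_nm expr1n => h2.
have : nm (uroot m.+1 - 1) ^+ 2 <= nm (uroot m.+1 + 1) ^+ 2 by rewrite lerXn2r ?nnegrE ?nm_ge0.
move: IH; rewrite -h1 exprMn (exprS _ m).
have := sqr_ge0 (nm (uroot m.+1 - 1)).
move: (nm (uroot m.+1 - 1) ^+ 2) (nm (uroot m.+1 + 1) ^+ 2) h2 => x y h2 x0 hx h.
have : 2 <= y by lra.
nra.
Qed.

Lemma uroot_mesh (e : R) : 0 < e -> exists m0, forall m, (m0 <= m)%N -> nm (uroot m - 1) <= e.
Proof.
move=> e0; have [N hN] := half_pow_small 4 (exprn_gt0 2 e0).
exists N => m /hN h; rewrite -(@ler_pXn2r _ 2) ?nnegrE ?nm_ge0 ?(ltW e0) //.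
exact: le_trans (uroot_near1 m) h.
Qed.

Definition pts m (r : R) j : C := ofR r * uroot m ^+ j.
Definition avg m (h : nat -> C) : C := (2 ^ m.+1)%:R^-1 * \sum_(j < 2 ^ m.+1) h j.

Lemma nm_pts m r j : 0 <= r -> nm (pts m r j) = r.
Proof. by move=> r0; rewrite nmM nmX uroot_nm expr1n mulr1 nm_ofR ger0_norm. Qed.

Let Nneq0 m : (2 ^ m.+1)%:R != 0 :> C.
Proof. by rewrite pnatr_eq0 -lt0n expn_gt0. Qed.

Lemma avg_le m h (B : R) : (forall j, (j < 2 ^ m.+1)%N -> nm (h j) <= B) -> nm (avg m h) <= B.
Proof.
move=> hB; rewrite /avg nmM nmV nmn mulrC ler_pdivrMr ?ltr0n ?expn_gt0 //.
apply: le_trans (nm_sum _ _ _) _.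
apply: (@le_trans _ _ (\sum_(j < 2 ^ m.+1) B)); first by apply: ler_sum => i _; apply: hB.
by rewrite sumr_const card_ord mulr_natr.
Qed.

Lemma avg_cst m c : avg m (fun=> c) = c.
Proof. by rewrite /avg sumr_const card_ord -[c *+ _]mulr_natl mulrA mulVf ?mul1r. Qed.

Lemma avgD m f g : avg m (fun j => f j + g j) = avg m f + avg m g.
Proof. by rewrite /avg big_split mulrDr. Qed.

Lemma avgZ m c f : avg m (fun j => c * f j) = c * avg m f.
Proof. by rewrite /avg -big_distrr /= mulrCA. Qed.

Lemma avgB m f g : avg m (fun j => f j - g j) = avg m f - avg m g.
Proof.
rewrite -mulN1r -avgZ -avgD; congr avg; apply/funext => j; by rewrite mulN1r.
Qed.

Lemma avg_sum m n (F : nat -> nat -> C) : avg m (fun j => \sum_(k < n) F k j) = \sum_(k < n) avg m (F k).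
Proof. by rewrite /avg exchange_big /= big_distrr. Qed.

Lemma avg_pow m l : (0 < l < 2 ^ m.+1)%N -> avg m (fun j => uroot m ^+ (j * l)) = 0.
Proof.
move=> hl; have w1 := uroot_neq1 hl; set w := uroot m ^+ l in w1.
rewrite /avg (eq_bigr (fun j : 'I__ => w ^+ j)); last by move=> j _; rewrite mulnC exprM.
have : (w - 1) * \sum_(j < 2 ^ m.+1) w ^+ j = 0.
  by rewrite -subrX1 /w -exprM mulnC exprM uroot_full expr1n subrr.
by move/eqP; rewrite mulf_eq0 subr_eq0 (negbTE w1) /= => /eqP ->; rewrite mulr0.
Qed.

(** The character of index -k of the group of roots of unity, written with a
    nonnegative exponent. *)
Definition chr m k j : C := uroot m ^+ (j * (2 ^ m.+1 - k)).

Lemma nm_chr m k j : nm (chr m k j) = 1.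
Proof. by rewrite nmX uroot_nm expr1n. Qed.

Lemma chrE m k j : (k <= 2 ^ m.+1)%N -> chr m k j = (uroot m ^+ j) ^- k.
Proof.
move=> hk; have u0 : uroot m != 0.
  by apply/eqP => h; have := uroot_nm m; rewrite h nm0 => /esym/eqP; rewrite oner_eq0.
apply: (mulIf (expf_neq0 k (expf_neq0 j u0))).
rewrite mulVf ?expf_neq0 // /chr -!exprM -exprD -mulnDr subnK //.
by rewrite mulnC exprM uroot_full expr1n.
Qed.

Lemma avg_chr m k l : (k < 2 ^ m.+1)%N -> (l < 2 ^ m.+1)%N ->
  avg m (fun j => (uroot m ^+ j) ^+ l * chr m k j) = (k == l)%:R.
Proof.
move=> hk hl.
have e j : (uroot m ^+ j) ^+ l * chr m k j = uroot m ^+ (j * (l + (2 ^ m.+1 - k))).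
  by rewrite /chr -exprM -exprD mulnDr.
rewrite (_ : (fun _ => _) = fun j => uroot m ^+ (j * (l + (2 ^ m.+1 - k)))); last exact/funext.
have [lk|lk|lk] := ltngtP l k.
- by rewrite avg_pow ?gtn_eqF //; apply/andP; split; lia.
- rewrite (_ : (fun _ => _) = fun j => uroot m ^+ (j * (l - k))); last first.
    apply/funext => j; rewrite addnBA 1?ltnW // -addnBAC 1?ltnW // mulnDr exprD.
    by rewrite [X in _ * X](_ : _ = 1) ?mulr1 // mulnC exprM uroot_full expr1n.
  by rewrite avg_pow ?ltn_eqF //; apply/andP; split; lia.
- rewrite lk (_ : (fun _ => _) = fun=> 1) ?avg_cst //.
  by apply/funext => j; rewrite subnKC 1?ltnW // mulnC exprM uroot_full expr1n.
Qed.

(** Orthogonality of characters: the mean is exact once the order of the root of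
    unity exceeds the degree. *)
Lemma avg_psum m a n k (r : R) : (k < 2 ^ m.+1)%N -> (n <= 2 ^ m.+1)%N ->
  avg m (fun j => psum a n (pts m r j) * chr m k j) = (k < n)%:R * a k * ofR r ^+ k.
Proof.
move=> hk hn.
rewrite (_ : (fun _ => _) = fun j => \sum_(l < n) a l * ofR r ^+ l * ((uroot m ^+ j) ^+ l * chr m k j)); last first.
  apply/funext => j; rewrite /psum big_distrl; apply: eq_bigr => l _ /=.
  by rewrite /pts exprMn; ring.
rewrite (avg_sum m n (fun l j => a l * ofR r ^+ l * ((uroot m ^+ j) ^+ l * chr m k j))).
rewrite (eq_bigr (fun l : 'I_n => (k == l)%:R * (a l * ofR r ^+ l))); last first.
  by move=> l _; rewrite avgZ avg_chr 1?mulrC // (leq_trans _ hn).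
have [kn|kn] := ltnP k n.
  rewrite (bigD1 (Ordinal kn)) //= eqxx big1 ?addr0 ?mulrA // => l.
  by rewrite -val_eqE /= eq_sym => /negbTE ->; rewrite mul0r.
rewrite big1 ?mul0r // => l _; rewrite gtn_eqF ?mul0r //.
by rewrite (leq_trans _ kn).
Qed.

Lemma exists_pow n : exists m, (n <= 2 ^ m.+1)%N.
Proof. by exists n; rewrite (leq_trans (ltnW (ltn_expl n (ltnSn 1)))) // leq_exp2l. Qed.

(** By [avg_psum] a coefficient is a mean of values on the circle of radius r. *)
Lemma cauchy_estimate a (r M : R) k : Ecoef a -> 0 < r ->
  (forall z, nm z <= r -> nm (pval a z) <= M) -> nm (a k) * r ^+ k <= M.
Proof.
move=> ha r0 hM; apply: le_eps => e e0.
have [N hN] := pval_approx ha r0 e0.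
pose n := maxn N k.+1.
have [m hm] := exists_pow n.
have kn : (k < n)%N by rewrite leq_maxr.
have := @avg_psum m a n k r (leq_trans kn hm) hm.
rewrite kn mul1r => /(congr1 nm); rewrite nmM nmX nm_ofR gtr0_norm // => <-.
apply: avg_le => j _; rewrite nmM nm_chr mulr1.
have pr : nm (pts m r j) <= r by rewrite nm_pts // ltW.
apply: le_trans (nm_le_dist _ (pval a (pts m r j))) _.
by rewrite lerD ?hM // nmB hN // leq_maxl.
Qed.

Lemma pval_inj (a b : nat -> C) : Ecoef a -> Ecoef b -> (forall z, pval a z = pval b z) -> a = b.
Proof.
move=> ha hb h; apply/funext => k; apply/eqP; rewrite -subr_eq0; apply/eqP/nm_eq0/le_anti.
rewrite nm_ge0 andbT.
have := @cauchy_estimate _ 1 0 k (EcoefB ha hb) ltr01; rewrite expr1n mulr1; apply.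
by move=> z _; rewrite pvalB // h subrr nm0.
Qed.

(** Completeness of the space of entire functions. By the Cauchy estimates the
    coefficients of the approximants converge, uniformly after weighting by r^k. *)
Lemma pval_closed (f : C -> C) :
  (forall r e : R, 0 < r -> 0 < e -> exists2 a, Ecoef a & dclose r e (pval a) f) ->
  exists2 a, Ecoef a & forall z, f z = pval a z.
Proof.
move=> hf.
have [A hA] : {A : nat -> nat -> C & forall n, Ecoef (A n) /\ dclose n.+1%:R (2^-1 ^+ n) (pval (A n)) f}.
  apply: (@choice _ _ (fun n b => Ecoef b /\ dclose n.+1%:R (2^-1 ^+ n) (pval b) f)) => n.
  by have [||a ha h] := hf n.+1%:R (2^-1 ^+ n); rewrite ?ltr0n ?exprn_gt0 ?invr_gt0 //; exists a.
have hAc n m k : (n <= m)%N -> nm (A m k - A n k) * n.+1%:R ^+ k <= 2 * 2^-1 ^+ n.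
  move=> nm_; have [h1 h2] := hA n; have [h3 h4] := hA m.
  apply: (cauchy_estimate _ (EcoefB h3 h1)); first by rewrite ltr0n.
  move=> z zr; rewrite pvalB // (le_trans (nm_tri _ (f z) _)) //.
  have := h2 z zr; have /h4 : nm z <= m.+1%:R by rewrite (le_trans zr) // ler_nat.
  rewrite (nmB (f z)); have : (2^-1 : R) ^+ m <= 2^-1 ^+ n.
    by rewrite ler_wiXn2l ?invr_ge0 // invf_le1 // ler1n.
  lra.
have [a ha] : {a : nat -> C & forall k, lim_to (fun n => A n k) (a k)}.
  apply: (@choice _ _ (fun k => lim_to (fun n => A n k))) => k; apply: cauchy_lim_to => e e0.
  have [N hN] := half_pow_small 2 e0; exists N => n Nn.
  apply: le_trans (hN N (leqnn N)); apply: le_trans (hAc _ _ k Nn).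
  by rewrite ler_peMr ?nm_ge0 // exprn_ege1 // ler1n.
have hAa n k : nm (a k - A n k) * n.+1%:R ^+ k <= 2 * 2^-1 ^+ n.
  rewrite -ler_pdivlMr ?exprn_gt0 ?ltr0n //; apply: (lim_to_le (ha k)).
  by exists n => m nm_; rewrite ler_pdivlMr ?exprn_gt0 ?ltr0n // hAc.
have archi (r : R) : exists n, r <= n.+1%:R.
  exists (Num.truncn r); rewrite ltW // truncnS_gt //.
have half1 n : (2^-1 : R) ^+ n <= 1 by rewrite exprn_ile1 ?invr_ge0 // invf_le1 // ler1n.
have Ea : Ecoef a.
  move=> r r0; have [n hn] := archi r.
  have [K hK] := (hA n).1 _ r0; exists (K + 2) => k.
  have r1 : r ^+ k <= n.+1%:R ^+ k by rewrite lerXn2r ?nnegrE ?(ltW r0).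
  apply: (@le_trans _ _ (nm (A n k) * r ^+ k + nm (a k - A n k) * r ^+ k)).
    by rewrite -mulrDl ler_wpM2r ?nm_le_dist // exprn_ge0 // ltW.
  rewrite lerD //; apply: (@le_trans _ _ (nm (a k - A n k) * n.+1%:R ^+ k)).
    by rewrite ler_wpM2l ?nm_ge0.
  by apply: le_trans (hAa _ _) _; have := half1 n; lra.
exists a => // z; apply/eqP; rewrite -subr_eq0; apply/eqP/nm_eq0/le_anti.
rewrite nm_ge0 andbT; apply: le_eps => e e0; rewrite add0r.
have [n0 hn0] := archi (2 * (nm z + 1)).
have [N hN] := half_pow_small 5 e0; pose n := maxn n0 N.
have hn : 2 * (nm z + 1) <= n.+1%:R by rewrite (le_trans hn0) // ler_nat ltnS leq_maxl.
have z0 := nm_ge0 z.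
apply: le_trans (nm_tri _ (pval (A n) z) _) _.
apply: (@le_trans _ _ (2^-1 ^+ n + 2 * (2 * 2^-1 ^+ n))); last first.
  by have := hN n (leq_maxr _ _); lra.
rewrite nmB lerD //; first by apply: (hA n).2; lra.
rewrite nmB; apply: (@pval_dclose _ _ _ (nm z + 1)) => //; rewrite ?lerDl //; first by lra.
  exact: (hA n).1.
move=> k; apply: le_trans (hAa n k); rewrite ler_wpM2l ?nm_ge0 //.
rewrite lerXn2r ?nnegrE //; lra.
Qed.

End RootsOfUnity.

(** * Goursat's theorem and primitives *)

Section Goursat.
Variable R : realType.
Local Notation C := (Cplx R).
Local Notation nm := (@nm R).
Local Notation lim_to := (@lim_to R).
Variable f : C -> C.
Hypothesis df : forall z, exists v, cdiff f z v.

Let cf : ccont f. Proof. exact: cdiff_ccont. Qed.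

Definition mid (a b : C) : C := (a + b) / 2%:R.

Let two_neq0 : 2%:R != 0 :> C. Proof. by rewrite pnatr_eq0. Qed.

Lemma midC a b : mid a b = mid b a. Proof. by rewrite /mid addrC. Qed.
Lemma mid_subl a b : mid a b - a = (b - a) / 2%:R. Proof. by rewrite /mid; field. Qed.
Lemma mid_subr a b : b - mid a b = (b - a) / 2%:R. Proof. by rewrite /mid; field. Qed.
Lemma nm_half (a : C) : nm (a / 2%:R) = nm a / 2.
Proof. by rewrite nmM nmV nmn. Qed.

Definition midconv (K : C -> Prop) := forall p q, K p -> K q -> K (mid p q).

Lemma midconv_disc c r : midconv (fun q => nm (q - c) <= r).
Proof.
move=> p q hp hq; rewrite (_ : mid p q - c = ((p - c) + (q - c)) / 2%:R); last by rewrite /mid; field.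
by rewrite nm_half; have := nmD (p - c) (q - c); lra.
Qed.

(** The Riemann sum over 2^n equal pieces of the segment, defined by bisection so
    that additivity under bisection holds by definition. *)
Fixpoint riemann n a b : C := if n is n'.+1 then riemann n' a (mid a b) + riemann n' (mid a b) b else (b - a) * f a.

(** Comparison of f with an affine function on a convex set containing the
    segment. The last term is the error of the Riemann sums of the affine function. *)
Lemma riemann_linear (K : C -> Prop) alpha beta (eta : R) n a b : midconv K ->
  (forall q, K q -> nm (f q - (alpha + beta * q)) <= eta) -> K a -> K b ->
  nm (riemann n a b - (alpha * (b - a) + beta * (b ^+ 2 - a ^+ 2) / 2%:R)) <=
    eta * nm (b - a) + nm beta * nm (b - a) ^+ 2 / 2 * 2^-1 ^+ n.
Proof.
move=> hK hf; elim: n a b => [|n IH] a b Ka Kb /=.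
  rewrite (_ : _ - _ = (b - a) * (f a - (alpha + beta * a)) - beta * (b - a) ^+ 2 / 2%:R); last by field.
  apply: le_trans (nmD _ _) _; rewrite nmN nm_half (nmM beta) nmX (nmM (b - a)) expr0 mulr1 lerD2r mulrC.
  by rewrite ler_wpM2r ?nm_ge0 ?hf.
have Km := hK _ _ Ka Kb.
have h1 := IH _ _ Ka Km; have h2 := IH _ _ Km Kb.
rewrite mid_subl nm_half in h1; rewrite mid_subr nm_half in h2.
rewrite (_ : _ - _ = (riemann n a (mid a b) - (alpha * ((b - a) / 2%:R) + beta * (mid a b ^+ 2 - a ^+ 2) / 2%:R)) +
   (riemann n (mid a b) b - (alpha * ((b - a) / 2%:R) + beta * (b ^+ 2 - mid a b ^+ 2) / 2%:R))); last by field.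
apply: le_trans (nmD _ _) _; apply: le_trans (lerD h1 h2) _.
rewrite le_eqVlt; apply/orP; left; apply/eqP; rewrite (exprS _ n).
by field.
Qed.

Lemma riemann_unif (r d eta : R) a b n p :
  (forall z w, nm z <= r -> nm (w - z) <= d -> nm (f w - f z) <= eta) ->
  nm a <= r -> nm b <= r -> nm (b - a) <= d * 2 ^+ n ->
  nm (riemann (n + p) a b - riemann n a b) <= eta * nm (b - a).
Proof.
move=> hu; elim: n a b => [|n IH] a b ar br hab.
  rewrite expr0 mulr1 in hab; rewrite add0n /=.
  have := @riemann_linear (fun q => nm (q - a) <= d) (f a) 0 eta p a b (@midconv_disc a d).
  rewrite !mul0r nm0 !mul0r !addr0 (mulrC (f a)); apply => //.
    by move=> q hq; rewrite mul0r addr0; apply: hu.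
  by rewrite subrr nm0; apply: le_trans hab; rewrite nm_ge0.
have mr : nm (mid a b) <= r.
  by have := @midconv_disc 0 r a b; rewrite !subr0; apply.
rewrite /= opprD addrACA; apply: le_trans (nmD _ _) _.
have hm : nm (b - a) / 2 <= d * 2 ^+ n by move: hab; rewrite exprS; lra.
have h1 := IH a (mid a b) ar mr; rewrite mid_subl nm_half in h1.
have h2 := IH (mid a b) b mr br; rewrite mid_subr nm_half in h2.
by have := h1 hm; have := h2 hm; lra.
Qed.

Lemma pow2_large (x d : R) : 0 < d -> exists n, x <= d * 2 ^+ n.
Proof.
move=> d0; have [N hN] := half_pow_small x d0; exists N.
by have := hN N (leqnn N); rewrite exprVn ler_pdivrMr ?exprn_gt0.
Qed.

Definition seg a b : C := limn (fun n => riemann n a b).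

Lemma riemann_lim a b : lim_to (fun n => riemann n a b) (seg a b).
Proof.
suff [l hl] : exists l, lim_to (fun n => riemann n a b) l by rewrite /seg (limn_lim_to hl).
apply: cauchy_lim_to => e e0; pose r := Num.max (nm a) (nm b).
have n1 : 0 < nm (b - a) + 1 by rewrite ltr_wpDl ?nm_ge0.
have [d d0 hd] := ccont_unif r cf (divr_gt0 e0 n1).
have [n hn] := pow2_large (nm (b - a)) d0.
exists n => m nm_; rewrite -(subnKC nm_).
have := @riemann_unif r d _ a b n (m - n) hd; rewrite !le_max !lexx orbT => /(_ isT isT hn) h.
apply: le_trans h _; rewrite mulrAC ler_pdivrMr // ler_wpM2l ?(ltW e0) // lerDl //.
Qed.

Lemma seg_split a b : seg a b = seg a (mid a b) + seg (mid a b) b.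
Proof.
apply: (lim_to_uniq (lim_toS (riemann_lim a b))).
exact: lim_toD (riemann_lim _ _) (riemann_lim _ _).
Qed.

Lemma seg_linear (K : C -> Prop) alpha beta (eta : R) a b : midconv K ->
  (forall q, K q -> nm (f q - (alpha + beta * q)) <= eta) -> K a -> K b ->
  nm (seg a b - (alpha * (b - a) + beta * (b ^+ 2 - a ^+ 2) / 2%:R)) <= eta * nm (b - a).
Proof.
move=> hK hf Ka Kb; apply: le_eps => e e0; apply: (lim_to_le (riemann_lim a b)).
have [N hN] := half_pow_small (nm beta * nm (b - a) ^+ 2 / 2) e0.
exists N => n /hN h; apply: le_trans (riemann_linear _ hK hf Ka Kb) _.
by rewrite lerD2l.
Qed.

Lemma riemann_rev (r d eta : R) a b n :
  (forall z w, nm z <= r -> nm (w - z) <= d -> nm (f w - f z) <= eta) ->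
  nm a <= r -> nm b <= r -> nm (b - a) <= d * 2 ^+ n ->
  nm (riemann n a b + riemann n b a) <= eta * nm (b - a).
Proof.
move=> hu; elim: n a b => [|n IH] a b ar br hab.
  rewrite expr0 mulr1 in hab; rewrite /=.
  rewrite (_ : _ + _ = (b - a) * - (f b - f a)); last by ring.
  by rewrite nmM nmN mulrC ler_wpM2r ?nm_ge0 // hu.
have mr : nm (mid a b) <= r.
  by have := @midconv_disc 0 r a b; rewrite !subr0; apply.
rewrite /= (midC b a) (_ : _ + _ + (_ + _) = (riemann n a (mid a b) + riemann n (mid a b) a) + (riemann n (mid a b) b + riemann n b (mid a b))); last by ring.
apply: le_trans (nmD _ _) _.
have hm : nm (b - a) / 2 <= d * 2 ^+ n by move: hab; rewrite exprS; lra.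
have h1 := IH a (mid a b) ar mr; rewrite mid_subl nm_half in h1.
have h2 := IH (mid a b) b mr br; rewrite mid_subr nm_half in h2.
by have := h1 hm; have := h2 hm; lra.
Qed.

Lemma seg_rev a b : seg b a = - seg a b.
Proof.
apply/eqP; rewrite -subr_eq0 opprK addrC; apply/eqP/nm_eq0/le_anti.
rewrite nm_ge0 andbT; apply: le_eps => e e0; rewrite add0r.
rewrite -[X in nm X]subr0; apply: (lim_to_le (lim_toD (riemann_lim a b) (riemann_lim b a))).
pose r := Num.max (nm a) (nm b).
have n1 : 0 < nm (b - a) + 1 by rewrite ltr_wpDl ?nm_ge0.
have [d d0 hd] := ccont_unif r cf (divr_gt0 e0 n1).
have [N hN] := pow2_large (nm (b - a)) d0.
exists N => n Nn; rewrite subr0.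
have hn : nm (b - a) <= d * 2 ^+ n.
  by apply: le_trans hN _; rewrite ler_wpM2l ?(ltW d0) // ler_weXn2l // ler1n.
have := @riemann_rev r d _ a b n hd; rewrite !le_max !lexx orbT => /(_ isT isT hn) h.
apply: le_trans h _; rewrite mulrAC ler_pdivrMr // ler_wpM2l ?(ltW e0) // lerDl //.
Qed.

Definition tri (t : C * C * C) : C := let: (a, b, c) := t in seg a b + seg b c + seg c a.

Definition sub1 (t : C * C * C) : C * C * C := let: (a, b, c) := t in (a, mid a b, mid c a).
Definition sub2 (t : C * C * C) : C * C * C := let: (a, b, c) := t in (mid a b, b, mid b c).
Definition sub3 (t : C * C * C) : C * C * C := let: (a, b, c) := t in (mid c a, mid b c, c).
Definition sub4 (t : C * C * C) : C * C * C := let: (a, b, c) := t in (mid a b, mid b c, mid c a).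

Lemma tri_split t : tri t = tri (sub1 t) + tri (sub2 t) + tri (sub3 t) + tri (sub4 t).
Proof.
case: t => [[a b] c] /=.
rewrite (seg_split a b) (seg_split b c) (seg_split c a).
rewrite (seg_rev (mid c a) (mid a b)) (seg_rev (mid a b) (mid b c)) (seg_rev (mid b c) (mid c a)).
by ring.
Qed.

Definition tdiam (d : R) (t : C * C * C) : Prop :=
  let: (a, b, c) := t in [/\ nm (b - a) <= d, nm (c - b) <= d & nm (a - c) <= d].

Definition fstv (t : C * C * C) : C := t.1.1.

(** If all four triangles cut out by the midpoints had an integral less than
    tau / 4, their sum would be less than tau. *)
Lemma tri_step (d tau : R) t : tdiam d t -> tau <= nm (tri t) ->
  exists t', [/\ tdiam (d / 2) t', tau / 4 <= nm (tri t') & nm (fstv t' - fstv t) <= d].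
Proof.
move=> hd htau.
have [h|h1] := leP (tau / 4) (nm (tri (sub1 t))); last
have [h|h2] := leP (tau / 4) (nm (tri (sub2 t))); last
have [h|h3] := leP (tau / 4) (nm (tri (sub3 t))); last
have [h|h4] := leP (tau / 4) (nm (tri (sub4 t))).
- exists (sub1 t); split => //.
    case: t hd {htau h} => [[a b] c] [h1 h2 h3] /=.
    rewrite mid_subl mid_subr nm_half (_ : mid c a - mid a b = (c - b) / 2%:R); last by rewrite /mid; field.
    by rewrite !nm_half; split; lra.
  by case: t hd {htau h} => [[a b] c] [h1 h2 h3] /=; rewrite subrr nm0 (le_trans (nm_ge0 _) h1).
- exists (sub2 t); split => //.
    case: t hd {htau h h1} => [[a b] c] [h1 h2 h3] /=.
    rewrite mid_subl mid_subr (_ : mid a b - mid b c = (a - c) / 2%:R); last by rewrite /mid; field.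
    by rewrite !nm_half; split; lra.
  case: t hd {htau h h1} => [[a b] c] [h1 h2 h3] /=; rewrite mid_subl nm_half.
  by have := nm_ge0 (b - a); lra.
- exists (sub3 t); split => //.
    case: t hd {htau h h1 h2} => [[a b] c] [h1 h2 h3] /=.
    rewrite mid_subl mid_subr (_ : mid b c - mid c a = (b - a) / 2%:R); last by rewrite /mid; field.
    by rewrite !nm_half; split; lra.
  case: t hd {htau h h1 h2} => [[a b] c] [h1 h2 h3] /=; rewrite midC mid_subl nm_half nmB.
  by have := nm_ge0 (a - c); lra.
- exists (sub4 t); split => //.
    case: t hd {htau h h1 h2 h3} => [[a b] c] [h1 h2 h3] /=.
    rewrite (_ : mid b c - mid a b = (c - a) / 2%:R); last by rewrite /mid; field.
    rewrite (_ : mid c a - mid b c = (a - b) / 2%:R); last by rewrite /mid; field.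
    rewrite (_ : mid a b - mid c a = (b - c) / 2%:R); last by rewrite /mid; field.
    by rewrite !nm_half (nmB c a) (nmB a b) (nmB b c); split; lra.
  case: t hd {htau h h1 h2 h3} => [[a b] c] [h1 h2 h3] /=; rewrite mid_subl nm_half.
  by have := nm_ge0 (b - a); lra.
- exfalso; move: htau; rewrite tri_split.
  have := nmD (tri (sub1 t) + tri (sub2 t) + tri (sub3 t)) (tri (sub4 t)).
  have := nmD (tri (sub1 t) + tri (sub2 t)) (tri (sub3 t)).
  have := nmD (tri (sub1 t)) (tri (sub2 t)).
  by lra.
Qed.

Lemma tri_small (K : C -> Prop) alpha beta (eta d : R) a b c : midconv K -> 0 <= eta ->
  (forall q, K q -> nm (f q - (alpha + beta * q)) <= eta) -> K a -> K b -> K c ->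
  tdiam d (a, b, c) -> nm (tri (a, b, c)) <= 3 * eta * d.
Proof.
move=> hK e0 hf Ka Kb Kc [h1 h2 h3].
have s1 := seg_linear hK hf Ka Kb; have s2 := seg_linear hK hf Kb Kc; have s3 := seg_linear hK hf Kc Ka.
pose q x y := alpha * (y - x) + beta * (y ^+ 2 - x ^+ 2) / 2%:R.
rewrite (_ : tri (a, b, c) = (seg a b - q a b) + (seg b c - q b c) + (seg c a - q c a)); last first.
  by rewrite /tri /q; field.
apply: le_trans (nmD _ _) _; have := nmD (seg a b - q a b) (seg b c - q b c).
have := ler_wpM2l e0 h1; have := ler_wpM2l e0 h2; have := ler_wpM2l e0 h3.
rewrite /q; lra.
Qed.

(** Differentiability is used at the limit point of the nested triangles only;
    nothing is assumed on the derivative. *)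
Lemma goursat t : tri t = 0.
Proof.
apply: nm_eq0; apply/eqP; apply: contraT => tau0.
have {}tau0 : 0 < nm (tri t) by rewrite lt_neqAle eq_sym tau0 nm_ge0.
set tau := nm (tri t) in tau0.
have [d d0 hd] : exists2 d : R, 0 < d & tdiam d t.
  case: t {tau tau0} => [[a b] c].
  exists (nm (b - a) + nm (c - b) + nm (a - c) + 1).
    by have := nm_ge0 (b - a); have := nm_ge0 (c - b); have := nm_ge0 (a - c); lra.
  by split; have := nm_ge0 (b - a); have := nm_ge0 (c - b); have := nm_ge0 (a - c); lra.
(* Nested triangles, the n-th one of size d / 2^n and integral at least
   tau / 4^n; their first vertices converge to a point p, where f is replaced
   by its affine approximation. *)
pose P n (s : C * C * C) := tdiam (d * 2^-1 ^+ n) s /\ tau * 4^-1 ^+ n <= nm (tri s).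
have step n s : exists s', P n s -> P n.+1 s' /\ nm (fstv s' - fstv s) <= d * 2^-1 ^+ n.
  have [[h1 h2]|nP] := pselect (P n s); last by exists s.
  have [s' [h3 h4 h5]] := tri_step h1 h2; exists s' => _; split => //; split.
    by move: h3; rewrite exprSr mulrA.
  by move: h4; rewrite exprSr mulrA.
have [nx hnx] := @choice _ _ (fun ns s' => P ns.1 ns.2 -> P ns.1.+1 s' /\ nm (fstv s' - fstv ns.2) <= d * 2^-1 ^+ ns.1) (fun ns => step ns.1 ns.2).
pose T := fix T n := if n is n'.+1 then nx (n', T n') else t.
have hT n : P n (T n).
  elim: n => [|n IH]; first by rewrite /P /= !expr0 !mulr1.
  exact: (hnx (n, T n) IH).1.
have hT2 n : nm (fstv (T n.+1) - fstv (T n)) <= d * 2^-1 ^+ n by exact: (hnx (n, T n) (hT n)).2.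
have hT3 n k : nm (fstv (T (n + k)%N) - fstv (T n)) <= 2 * d * (2^-1 ^+ n - 2^-1 ^+ (n + k)).
  elim: k => [|k IH]; first by rewrite addn0 !subrr nm0 mulr0.
  rewrite addnS; apply: le_trans (nm_tri _ (fstv (T (n + k)%N)) _) _.
  by have := hT2 (n + k)%N; rewrite (exprS _ (n + k)); lra.
have hT4 n m : (n <= m)%N -> nm (fstv (T m) - fstv (T n)) <= 2 * d * 2^-1 ^+ n.
  move=> nm_; have := hT3 n (m - n)%N; rewrite subnKC // => h; apply: le_trans h _.
  by rewrite ler_wpM2l ?mulr_ge0 ?(ltW d0) // gerBl exprn_ge0 ?invr_ge0.
have [p hp] : exists p, lim_to (fun n => fstv (T n)) p.
  apply: cauchy_lim_to => e e0; have [N hN] := half_pow_small (2 * d) e0.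
  by exists N => n Nn; apply: le_trans (hN N (leqnn N)); apply: hT4.
have hpn n : nm (p - fstv (T n)) <= 2 * d * 2^-1 ^+ n.
  by apply: (lim_to_le hp); exists n => m; apply: hT4.
suff : tau <= 0 by rewrite leNgt tau0.
apply: le_eps => e e0; rewrite add0r.
have e1 : 0 < e / (9 * d ^+ 2) by rewrite divr_gt0 // mulr_gt0 // exprn_gt0.
have [v hv] := df p; have [dl dl0 hdl] := hv _ e1.
have [N hN] := half_pow_small (3 * d) dl0.
have := hN N (leqnn N) => hdN; have [hd1 hd2] := hT N.
have := hpn N; case: (T N) hd1 hd2 => [[a b] c] hd1 hd2 hpa.
rewrite /fstv /= in hpa.
set D := d * 2^-1 ^+ N in hd1; have D0 : 0 < D by rewrite mulr_gt0 // exprn_gt0 // invr_gt0.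
have hpa' : nm (a - p) <= 2 * D by rewrite nmB /D mulrA.
have hdN' : 3 * D <= dl by rewrite /D mulrA.
have hK q : nm (q - p) <= 3 * D -> nm (f q - ((f p - v * p) + v * q)) <= e / (9 * d ^+ 2) * (3 * D).
  move=> hq; have := hdl (q - p) (le_trans hq hdN').
  rewrite (_ : p + (q - p) = q); last by ring.
  rewrite (_ : f q - f p - (q - p) * v = f q - (f p - v * p + v * q)); last by ring.
  by move=> h; apply: le_trans h _; rewrite ler_wpM2l ?(ltW e1).
have := tri_small (@midconv_disc p (3 * D)) _ hK _ _ _ hd1.
have [h1 h2 h3] := hd1.
have -> : 0 <= e / (9 * d ^+ 2) * (3 * D) by rewrite mulr_ge0 ?(ltW e1) //; lra.
move=> /(_ isT).
have ka : nm (a - p) <= 3 * D by lra.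
have kb : nm (b - p) <= 3 * D by apply: le_trans (nm_tri _ a _) _; lra.
have kc : nm (c - p) <= 3 * D by apply: le_trans (nm_tri _ a _) _; rewrite (nmB c a); lra.
move=> /(_ ka kb kc) h; have := le_trans hd2 h.
rewrite (_ : 3 * (e / (9 * d ^+ 2) * (3 * D)) * D = e * 4^-1 ^+ N).
  by rewrite ler_pM2r // exprn_gt0 // invr_gt0.
have -> : (4^-1 : R) ^+ N = (2^-1 ^+ N) ^+ 2.
  by rewrite -exprM mulnC exprM; congr (_ ^+ _); lra.
by rewrite /D; field; rewrite gt_eqF.
Qed.

(** The integral over the segment from 0 is a primitive by [goursat]. The increment
    formula is uniform on discs because f is uniformly continuous there. *)
Lemma primitive : exists F : C -> C,
  forall r e : R, 0 < e -> exists2 d : R, 0 < d & forall z h, nm z <= r -> nm h <= d ->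
    nm (F (z + h) - F z - h * f z) <= e * nm h.
Proof.
exists (seg 0) => r e e0; have [d d0 hd] := ccont_unif r cf e0.
exists d => // z h zr hh.
have := goursat (0, z, z + h); rewrite /tri (seg_rev 0 (z + h)) => /eqP.
rewrite subr_eq0 => /eqP <-.
rewrite (_ : seg 0 z + seg z (z + h) - seg 0 z = seg z (z + h)); last by ring.
have := @seg_linear (fun q => nm (q - z) <= d) (f z) 0 e z (z + h) (@midconv_disc z d).
rewrite !mul0r addr0 (_ : z + h - z = h); last by ring.
rewrite (mulrC (f z)) subrr nm0; apply; rewrite ?(ltW d0) //.
by move=> q hq; rewrite mul0r addr0; apply: hd.
Qed.

End Goursat.

(** * Entire functions are sums of power series *)

Section EntireIsPowerSeries.
Variable R : realType.
Local Notation C := (Cplx R).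
Local Notation nm := (@nm R).

Lemma ofRV (x : R) : ofR x^-1 = (ofR x)^-1.
Proof. exact: (fmorphV (real_complex R)). Qed.

Section Cauchy.
Variables F f : C -> C.
Hypothesis hF : forall r e : R, 0 < e -> exists2 d : R, 0 < d & forall z h, nm z <= r -> nm h <= d ->
  nm (F (z + h) - F z - h * f z) <= e * nm h.

Lemma prim_cdiff z : cdiff F z (f z).
Proof. by move=> e e0; have [d d0 hd] := hF (nm z) e0; exists d => // h; apply: hd. Qed.

Lemma tele_nat (u : nat -> C) n : \sum_(j < n) (u j.+1 - u j) = u n - u 0%N.
Proof. by elim: n => [|n IH]; rewrite ?big_ord0 ?subrr // big_ord_recr /= IH; ring. Qed.

Lemma pts_next m (r : R) j : pts m r j.+1 - pts m r j = (uroot R m - 1) * pts m r j.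
Proof. by rewrite /pts exprS; ring. Qed.

Lemma pts_full m (r : R) : pts m r (2 ^ m.+1) = pts m r 0.
Proof. by rewrite /pts uroot_full expr0. Qed.

(** Discrete form of the vanishing of the contour integral of f(z + t (w - z)) dw,
    whose integrand has a primitive: the increments of F between consecutive
    points telescope to 0. *)
Lemma avg_circle (r d e t : R) z m : 0 < r -> 0 < e -> nm z <= r -> 0 < t <= 1 ->
  (forall z h, nm z <= r -> nm h <= d -> nm (F (z + h) - F z - h * f z) <= e * nm h) ->
  nm (uroot R m - 1) * r <= d ->
  nm (avg m (fun j => pts m r j * f (z + ofR t * (pts m r j - z)))) <= e * r.
Proof.
move=> r0 e0 zr /andP[t0 t1] hd hm.
pose p j := z + ofR t * (pts m r j - z).
have pr j : nm (p j) <= r.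
  rewrite (_ : p j = ofR (1 - t) * z + ofR t * pts m r j); last by rewrite /p ofRD ofRN ofR1; ring.
  apply: le_trans (nmD _ _) _; rewrite nmM (nmM (ofR t)) !nm_ofR nm_pts ?(ltW r0) //.
  rewrite !ger0_norm ?(ltW t0) ?subr_ge0 //.
  have : (1 - t) * nm z <= (1 - t) * r by rewrite ler_wpM2l ?subr_ge0.
  by lra.
have u1 : 0 < nm (uroot R m - 1).
  apply: nm_gt0; rewrite subr_eq0 -[uroot R m]expr1 uroot_neq1 //=.
  by rewrite expnS (leq_trans _ (leq_pmulr 2 _)) ?expn_gt0.
pose h j := ofR t * (uroot R m - 1) * pts m r j.
have nmh j : nm (h j) = t * nm (uroot R m - 1) * r.
  by rewrite /h nmM nm_pts ?(ltW r0) // nmM nm_ofR gtr0_norm.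
have ph j : p j.+1 = p j + h j.
  rewrite /p /h -mulrA -pts_next; ring.
have key : nm (\sum_(j < 2 ^ m.+1) h j * f (p j)) <= (2 ^ m.+1)%:R * (e * (t * nm (uroot R m - 1) * r)).
  rewrite -[X in nm X]opprK nmN.
  have -> : - \sum_(j < 2 ^ m.+1) h j * f (p j) = \sum_(j < 2 ^ m.+1) (F (p j + h j) - F (p j) - h j * f (p j)).
    have e1 : \sum_(j < 2 ^ m.+1) (F (p j + h j) - F (p j)) = 0.
      rewrite (eq_bigr (fun j : 'I__ => F (p j.+1) - F (p j))); last by move=> j _; rewrite ph.
      by rewrite (tele_nat (fun j => F (p j))) /p pts_full subrr.
    by rewrite sumrB e1 sub0r.
  apply: le_trans (nm_sum _ _ _) _.
  rewrite mulr_natl -[X in _ *+ X](card_ord (2 ^ m.+1)) -sumr_const.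
  apply: ler_sum => j _; rewrite -(nmh j); apply: hd => //.
  rewrite nmh; apply: le_trans hm; rewrite -mulrA ler_piMl // mulr_ge0 ?nm_ge0 //; exact: ltW.
rewrite (_ : \sum_(j < _) _ = ofR t * (uroot R m - 1) * \sum_(j < 2 ^ m.+1) pts m r j * f (p j)) in key; last first.
  by rewrite big_distrr /=; apply: eq_bigr => j _; rewrite /h -mulrA.
rewrite /avg nmM nmV nmn mulrC ler_pdivrMr ?ltr0n ?expn_gt0 //.
move: key; rewrite !nmM nm_ofR gtr0_norm //.
have tu : 0 < t * nm (uroot R m - 1) by rewrite mulr_gt0.
move: (nm (\sum_(i < _) _)) => S key; rewrite -(ler_pM2l tu).
apply: le_trans key _; rewrite le_eqVlt; apply/orP; left; apply/eqP; ring.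
Qed.

(** The difference quotient (F w - F z) / (w - z) is the mean of f over the segment
    from z to w. *)
Lemma diff_quot_avg (r d e : R) z w S : 0 < e -> nm z <= r -> nm w <= r -> (0 < S)%N -> 2 * r / S%:R <= d ->
  (forall z h, nm z <= r -> nm h <= d -> nm (F (z + h) - F z - h * f z) <= e * nm h) ->
  nm (F w - F z - (w - z) * (S%:R^-1 * \sum_(s < S) f (z + ofR (s.+1%:R / S%:R) * (w - z)))) <= e * nm (w - z).
Proof.
move=> e0 zr wr S0 hS hd.
have SR0 : 0 < S%:R :> R by rewrite ltr0n.
pose p s := z + ofR (s%:R / S%:R) * (w - z).
have r0 : 0 <= r by apply: le_trans zr; apply: nm_ge0.
have wz : nm (w - z) <= 2 * r by apply: le_trans (nmBD _ _) _; lra.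
have pr s : (s <= S)%N -> nm (p s) <= r.
  move=> sS; pose t : R := s%:R / S%:R; have t0 : 0 <= t by rewrite divr_ge0.
  have t1 : t <= 1 by rewrite ler_pdivrMr // mul1r ler_nat.
  rewrite (_ : p s = ofR (1 - t) * z + ofR t * w); last by rewrite /p /t ofRD ofRN ofR1; ring.
  apply: le_trans (nmD _ _) _; rewrite !nmM !nm_ofR !ger0_norm ?subr_ge0 //.
  have : (1 - t) * nm z <= (1 - t) * r by rewrite ler_wpM2l ?subr_ge0.
  have : t * nm w <= t * r by rewrite ler_wpM2l.
  by lra.
pose h : C := - (ofR S%:R^-1 * (w - z)).
have nmh : nm h = S%:R^-1 * nm (w - z).
  by rewrite /h nmN nmM nm_ofR ger0_norm // invr_ge0.
have ph s : p s = p s.+1 + h.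
  rewrite /p /h -natr1 mulrDl ofRD mul1r; ring.
have -> : F w - F z - (w - z) * (S%:R^-1 * \sum_(s < S) f (z + ofR (s.+1%:R / S%:R) * (w - z))) =
  - \sum_(s < S) (F (p s.+1 + h) - F (p s.+1) - h * f (p s.+1)).
  have e1 : F w - F z = \sum_(s < S) (F (p s.+1) - F (p s)).
    rewrite (tele_nat (fun s => F (p s))) /p mul0r ofR0 mul0r addr0 divff ?gt_eqF //.
    by rewrite ofR1 mul1r (_ : z + (w - z) = w) //; ring.
  rewrite e1 mulrA big_distrr -sumrB -sumrN; apply: eq_bigr => s _ /=.
  rewrite -ph /h (_ : S%:R^-1 = ofR S%:R^-1) /p; first by ring.
  by rewrite ofRV ofRn.
rewrite nmN; apply: le_trans (nm_sum _ _ _) _.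
apply: (@le_trans _ _ (\sum_(s < S) e * nm h)).
  apply: ler_sum => s _; apply: hd; first exact: pr.
  by rewrite nmh mulrC; apply: le_trans hS; rewrite ler_wpM2r ?invr_ge0.
rewrite sumr_const card_ord nmh -mulr_natl le_eqVlt; apply/orP; left; apply/eqP; field.
by rewrite gt_eqF.
Qed.

(** Cauchy's formula. The mean of (F w - F z) w / (w - z) over a circle around 0 is
    small by [diff_quot_avg] and [avg_circle]; expanding w / (w - z) in powers of z
    turns this into an approximation of F by polynomials on a smaller disc. *)
Lemma cauchy_poly (r e : R) : 0 < r -> 0 < e -> exists2 a, Ecoef a & dclose (r / 2) e (pval a) F.
Proof.
move=> r0 e0.
have [M M0 hM] := ccont_bounded r (cdiff_ccont (fun z => ex_intro _ _ (prim_cdiff z))).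
have eta0 : 0 < e / (4 * r) by rewrite divr_gt0 // mulr_gt0.
have [d d0 hd] := hF r eta0.
have [n [n0 hn]] : exists n, (0 < n)%N /\ 4 * M * 2^-1 ^+ n <= e / 2.
  have [n hn] := half_pow_small (4 * M) (divr_gt0 e0 (ltr0n R 2)).
  by exists n.+1; split => //; apply: hn.
have [m0 hm0] := uroot_mesh (divr_gt0 d0 r0).
pose m := maxn m0 n.
have hm : nm (uroot R m - 1) * r <= d by rewrite -ler_pdivlMr // hm0 // leq_maxl.
have nN : (n < 2 ^ m.+1)%N.
  by rewrite (leq_trans (ltn_expl n (ltnSn 1))) // leq_exp2l // leqW // leq_maxr.
have [S S0 hS] : exists2 S, (0 < S)%N & 2 * r / S%:R <= d.
  exists (Num.truncn (2 * r / d)).+1 => //.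
  by rewrite ler_pdivrMr ?ltr0n // [d * _]mulrC -ler_pdivrMr // ltW // truncnS_gt.
pose a k : C := if (k < n)%N then ofR r ^- k * avg m (fun j => F (pts m r j) * chr R m k j) else 0.
have Ea : Ecoef a by apply: (@Ecoef_poly _ _ n) => k nk; rewrite /a ltnNge nk.
exists a => // z zr; rewrite (@pval_poly _ _ n); last by move=> k nk; rewrite /a ltnNge nk.
have zr' : nm z <= r by lra.
pose w j := pts m r j.
have nw j : nm (w j) = r by rewrite nm_pts ?(ltW r0).
have w0 j : w j != 0 by apply/eqP => h; move: (nw j); rewrite h nm0; lra.
have wz j : w j - z != 0.
  rewrite subr_eq0; apply/eqP => h; move: (nw j); rewrite h; lra.
have nwz j : r / 2 <= nm (w j - z).
  have := nm_le_dist (w j) z; rewrite nw; lra.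
(* Expansion of w / (w - z) as a geometric series in z / w: the truncation
   averages to psum a n z - F z, its remainder is O(2^-n). *)
have -> : psum a n z - F z = avg m (fun j => (F (w j) - F z) * \sum_(k < n) (z / w j) ^+ k).
  rewrite (_ : (fun _ => _) = fun j => \sum_(k < n) (z ^+ k * ofR r ^- k * (F (w j) * chr R m k j)
      - F z * (z ^+ k * ofR r ^- k) * ((uroot R m ^+ j) ^+ 0 * chr R m k j))); last first.
    apply/funext => j; rewrite big_distrr; apply: eq_bigr => k _ /=.
    rewrite expr0 mul1r chrE; last by rewrite (leq_trans _ (ltnW nN)) // ltnW.
    rewrite expr_div_n /w /pts exprMn invfM; ring.
  rewrite (avg_sum m n (fun k j => z ^+ k * ofR r ^- k * (F (w j) * chr R m k j)
      - F z * (z ^+ k * ofR r ^- k) * ((uroot R m ^+ j) ^+ 0 * chr R m k j))).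
  rewrite (eq_bigr (fun k : 'I_n => a k * z ^+ k - F z * (z ^+ k * ofR r ^- k) * ((k : nat) == 0%N)%:R)); last first.
    move=> k _; rewrite avgB avgZ (avgZ m (F z * (z ^+ k * ofR r ^- k))) avg_chr ?expn_gt0 //; last by rewrite (leq_trans _ (ltnW nN)).
    by rewrite /a ltn_ord; congr (_ - _); ring.
  rewrite sumrB /psum; congr (_ - _).
  rewrite (bigD1 (Ordinal n0)) //= big1 ?addr0 ?expr0 ?invr1 ?mulr1 // => k.
  by rewrite -val_eqE /= => /negbTE ->; rewrite mulr0.
have nq j : nm (w j / (w j - z)) = r / nm (w j - z) by rewrite nmM nmV nw.
have w_id j : \sum_(k < n) (z / w j) ^+ k = w j / (w j - z) - (z / w j) ^+ n * (w j / (w j - z)).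
  have h := subrX1 (z / w j) n.
  have zw : z / w j - 1 = - ((w j - z) / w j) by field.
  rewrite zw in h.
  apply: (mulfI (_ : - ((w j - z) / w j) != 0)).
    by rewrite oppr_eq0 mulf_neq0 ?invr_eq0.
  by rewrite -h; field; rewrite w0 wz.
rewrite (_ : (fun _ => _) = fun j => (F (w j) - F z) * (w j / (w j - z)) - (F (w j) - F z) * ((z / w j) ^+ n * (w j / (w j - z)))); last first.
  by apply/funext => j; rewrite w_id; ring.
rewrite avgB; apply: le_trans (nmBD _ _) _.
have B2 : nm (avg m (fun j => (F (w j) - F z) * ((z / w j) ^+ n * (w j / (w j - z))))) <= e / 2.
  apply: le_trans hn; apply: avg_le => j _.
  rewrite (nmM (F (w j) - F z)) (nmM (_ ^+ n)) nmX nq (nmM z) nmV nw.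
  have f2 : nm (F (w j) - F z) <= 2 * M.
    apply: le_trans (nmBD _ _) _; have := hM (w j); rewrite nw lexx => /(_ isT).
    by have := hM z zr'; lra.
  have f3 : (nm z / r) ^+ n <= 2^-1 ^+ n.
    rewrite lerXn2r ?nnegrE ?divr_ge0 ?nm_ge0 ?(ltW r0) ?invr_ge0 //.
    by rewrite ler_pdivrMr //; lra.
  have f4 : r / nm (w j - z) <= 2.
    by rewrite ler_pdivrMr; have := nwz j; lra.
  rewrite (_ : 4 * M * 2^-1 ^+ n = 2 * M * (2^-1 ^+ n * 2)); last by ring.
  have rw0 : 0 <= r / nm (w j - z) by rewrite divr_ge0 ?nm_ge0 // ltW.
  have zr0 : 0 <= (nm z / r) ^+ n by rewrite exprn_ge0 // divr_ge0 ?nm_ge0 // ltW.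
  apply: (ler_pM (nm_ge0 _) _ f2); first exact: mulr_ge0.
  exact: ler_pM.
have B1 : nm (avg m (fun j => (F (w j) - F z) * (w j / (w j - z)))) <= e / 2.
  pose g j := S%:R^-1 * \sum_(s < S) f (z + ofR (s.+1%:R / S%:R) * (w j - z)).
  rewrite (_ : (fun _ => _) = fun j => w j * g j + (F (w j) - F z - (w j - z) * g j) * (w j / (w j - z))); last first.
    by apply/funext => j; field.
  rewrite avgD; apply: le_trans (nmD _ _) _.
  rewrite (_ : e / 2 = e / (4 * r) * r + e / (4 * r) * r); last by field; rewrite gt_eqF.
  apply: lerD.
    rewrite (_ : (fun _ => _) = fun j => S%:R^-1 * \sum_(s < S) w j * f (z + ofR (s.+1%:R / S%:R) * (w j - z))); last first.
      by apply/funext => j; rewrite /g mulrCA big_distrr.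
    rewrite avgZ (avg_sum m S (fun s j => w j * f (z + ofR (s.+1%:R / S%:R) * (w j - z)))).
    rewrite nmM nmV nmn mulrC ler_pdivrMr ?ltr0n //.
    apply: le_trans (nm_sum _ _ _) _.
    apply: (@le_trans _ _ (\sum_(s < S) (e / (4 * r) * r))); last by rewrite sumr_const card_ord mulr_natr.
    apply: ler_sum => s _; apply: (avg_circle r0 eta0 zr' _ hd hm).
    by rewrite divr_gt0 ?ltr0n //= ler_pdivrMr ?ltr0n // mul1r ler_nat.
  apply: avg_le => j _; rewrite nmM nq.
  have wr : nm (w j) <= r by rewrite nw.
  have := diff_quot_avg eta0 zr' wr S0 hS hd; rewrite -/(g j).
  have nn : 0 < nm (w j - z) by apply: nm_gt0.
  move=> h; rewrite mulrA ler_pdivrMr //; rewrite mulrAC ler_wpM2r ?(ltW r0) //.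
by lra.
Qed.

Lemma prim_pval : exists2 a, Ecoef a & forall z, F z = pval a z.
Proof.
apply: pval_closed => r e r0 e0.
have [|a ha h] := @cauchy_poly (2 * r) e _ e0; first by rewrite mulr_gt0.
by exists a => // z zr; apply: h; rewrite mulrC mulKf.
Qed.

End Cauchy.

Lemma cdiff_uniq (f : C -> C) z v w : cdiff f z v -> cdiff f z w -> v = w.
Proof. by move=> /cdiff_derive1 <- /cdiff_derive1. Qed.

(** The primitive of f is a power series by [cauchy_poly] and [pval_closed], hence
    so is f. *)
Theorem entire_pval (f : fctC R) : entire f -> exists2 a, Ecoef a & (f : C -> C) = pval a.
Proof.
move=> /entireP hf; have [F hF] := primitive hf.
have [a ha hFa] := prim_pval hF.
exists (shiftd a); first exact: Ecoef_shiftd.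
apply/funext => z; apply: (cdiff_uniq (prim_cdiff hF z)).
by rewrite (_ : F = pval a); [exact: pval_cdiff|apply/funext].
Qed.

Lemma entire_taylor (f : fctC R) : entire f -> Ecoef (taylor_coef f) /\ (f : C -> C) = pval (taylor_coef f).
Proof.
move=> /entire_pval [a ha ->].
by rewrite (_ : taylor_coef _ = a) //; apply/funext => k; apply: taylor_coef_pval.
Qed.

End EntireIsPowerSeries.

(** * Operators and universality *)

Opaque entire.

Section Operators.
Variable R : realType.
Local Notation C := (Cplx R).
Local Notation nm := (@nm R).
Local Notation fct := (fctC R).

Definition lin (a : C) (f g : fct) : fct := fun z => a * (f : C -> C) z + (g : C -> C) z.
Definition scl (a : C) (f : fct) : fct := fun z => a * (f : C -> C) z.
Definition add (f g : fct) : fct := fun z => (f : C -> C) z + (g : C -> C) z.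
Definition zer : fct := fun=> 0.

Lemma linE (a : C) (f g : fct) : a *: f + g = lin a f g. Proof. by []. Qed.
Lemma sclE (a : C) (f : fct) : a *: f = scl a f. Proof. by []. Qed.

Lemma linV a f g z : lin a f g z = a * f z + g z. Proof. by []. Qed.
Lemma sclV a f z : scl a f z = a * f z. Proof. by []. Qed.
Lemma addV f g z : add f g z = f z + g z. Proof. by []. Qed.
Lemma zerV z : zer z = 0. Proof. by []. Qed.
Opaque lin scl add zer.

Lemma entire_lin (a : C) (f g : fct) : entire f -> entire g -> entire (lin a f g).
Proof.
move=> /entire_pval [b hb hf] /entire_pval [c hc hg].
have -> : lin a f g = pval (fun k => a * b k + c k).
  apply/funext => z; rewrite pvalD //; last exact: EcoefZ.
  by rewrite pvalZ // linV -hf -hg.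
by apply: pval_entire; apply: EcoefD => //; apply: EcoefZ.
Qed.

Lemma entire0 : entire zer.
Proof.
have -> : zer = pval (fun=> 0 : C).
  by apply/funext => z; rewrite zerV (@pval_poly _ _ 0) // /psum big_ord0.
by apply: pval_entire; apply: (@Ecoef_poly _ _ 0).
Qed.

Lemma lin_scl a f : lin a f zer = scl a f.
Proof. by apply/funext => z; rewrite linV sclV zerV addr0. Qed.
Lemma lin_add f g : lin 1 f g = add f g.
Proof. by apply/funext => z; rewrite linV addV mul1r. Qed.

Lemma entireZ (a : C) (f : fct) : entire f -> entire (scl a f).
Proof.
move=> hf.
rewrite -lin_scl.
apply: (@entire_lin a f zer).
  exact: hf.
exact: entire0.
Qed.

Lemma entireD (f g : fct) : entire f -> entire g -> entire (add f g).
Proof. by move=> hf hg; rewrite -lin_add; exact: (@entire_lin 1 f g hf hg). Qed.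

Definition cont_op (T : fct -> fct) : Prop :=
  [/\ forall f, entire f -> entire (T f),
      forall (a : C) (f g : fct), entire f -> entire g -> T (lin a f g) = lin a (T f) (T g)
    & forall (f : fct) (r e : R), entire f -> 0 < e ->
        exists r' e' : R, [/\ 0 < r', 0 < e' & forall g : fct, entire g -> dclose r' e' g f -> dclose r e (T g) (T f)]].

Lemma is_operator_cont_op T : is_operator T -> cont_op T.
Proof.
move=> [h1 h2 h3]; split; first exact: h1.
  by move=> a f g hf hg; rewrite -linE h2.
by move=> f r e fE e0; exact: within_cont.
Qed.

Lemma dclose_tri (r e d : R) (f g h : C -> C) : dclose r e f g -> dclose r d g h -> dclose r (e + d) f h.
Proof. by move=> h1 h2 z zr; apply: le_trans (nm_tri _ (g z) _) _; rewrite lerD ?h1 ?h2. Qed.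

Lemma dclose_sym (r e : R) (f g : C -> C) : dclose r e f g -> dclose r e g f.
Proof. by move=> h z zr; rewrite nmB h. Qed.

Lemma dclose_le (r r' e e' : R) (f g : C -> C) : r' <= r -> e <= e' -> dclose r e f g -> dclose r' e' f g.
Proof. by move=> hr he h z zr; apply: le_trans he; apply: h; apply: le_trans hr. Qed.

Lemma dclose_refl (r e : R) (f : C -> C) : 0 <= e -> dclose r e f f.
Proof. by move=> e0 z _; rewrite subrr nm0. Qed.

Lemma cont_op_id : cont_op id.
Proof. by split => // f r e fE e0; exists (Num.max 1 r), e; split => // [|g _]; rewrite ?lt_max ?ltr01 //; apply: dclose_le => //; rewrite le_max lexx orbT. Qed.

Lemma cont_op_comp T S : cont_op T -> cont_op S -> cont_op (T \o S).
Proof.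
move=> [t1 t2 t3] [s1 s2 s3]; split => /=.
- by move=> f /s1 /t1.
- by move=> a f g hf hg; rewrite (s2 a f g hf hg) (t2 a _ _ (s1 _ hf) (s1 _ hg)).
- move=> f r e fE e0; have [r1 [e1 [r10 e10 h1]]] := t3 _ r e (s1 f fE) e0.
  have [r2 [e2 [r20 e20 h2]]] := s3 _ r1 e1 fE e10.
  by exists r2, e2; split => // g gE /h2 h; apply: h1; [exact: s1|exact: h].
Qed.

Lemma cont_op_iter T n : cont_op T -> cont_op (iter n T).
Proof. by move=> hT; elim: n => [|n IH]; [exact: cont_op_id|exact: (cont_op_comp hT IH)]. Qed.

Lemma cont_op_scale (c : C) T : cont_op T -> cont_op (fun f => scl c (T f)).
Proof.
move=> [t1 t2 t3]; split.
- by move=> f /t1 /entireZ.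
- by move=> a f g hf hg; rewrite (t2 a f g hf hg); apply/funext => z; rewrite !(sclV, linV); ring.
- move=> f r e fE e0; have c1 : 0 < nm c + 1 by rewrite ltr_wpDl ?nm_ge0.
  have [r' [e' [r0 e'0 h]]] := t3 f r (e / (nm c + 1)) fE (divr_gt0 e0 c1).
  exists r', e'; split => // g gE /(h _ gE) hg z zr.
  rewrite !sclV -mulrBr nmM; have := hg z zr; rewrite ler_pdivlMr //.
  by have := nm_ge0 (T g z - T f z); lra.
Qed.

Lemma cont_op0 T : cont_op T -> T zer = zer.
Proof.
move=> [_ h _]; have := h 1 zer zer entire0 entire0.
rewrite !lin_add (_ : add zer zer = zer); last by apply/funext => z; rewrite addV zerV addr0.
move=> e; apply/funext => z; have := congr1 (fun u : C -> C => u z) e.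
rewrite addV zerV => /eqP; rewrite -subr_eq0 opprD addrA subrr sub0r oppr_eq0 => /eqP.
exact.
Qed.

Lemma cont_opZ T a f : cont_op T -> entire f -> T (scl a f) = scl a (T f).
Proof.
move=> hT fE; have [_ h _] := hT.
by rewrite -!lin_scl (h a f zer fE entire0) (cont_op0 hT).
Qed.

Lemma cont_opD T f g : cont_op T -> entire f -> entire g -> T (add f g) = add (T f) (T g).
Proof. by move=> [_ h _] fE gE; rewrite -!lin_add (h 1 f g fE gE). Qed.

Definition ratC (q : rat * rat) : C := ofR (ratr q.1) + ci R * ofR (ratr q.2).

Lemma ratC_dense (z : C) (e : R) : 0 < e -> exists q, nm (z - ratC q) <= e.
Proof.
move=> e0.
have rd (x : R) : exists q : rat, `|x - ratr q| <= e / 2.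
  have [|q] := @rat_in_itvoo R (x - e / 2) (x + e / 2); first by lra.
  rewrite in_itv /= => /andP[h1 h2]; exists q.
  by rewrite ler_norml; apply/andP; split; lra.
have [p hp] := rd (re z); have [q hq] := rd (im z).
exists (p, q); rewrite {1}(ReIm z) /ratC /=.
rewrite (_ : _ - _ = ofR (re z - ratr p) + ci R * ofR (im z - ratr q)); last first.
  by rewrite !ofRD !ofRN; ring.
by apply: le_trans (nmD _ _) _; rewrite nmM nm_i mul1r !nm_ofR; lra.
Qed.

Definition ratpoly (s : seq (rat * rat)) : nat -> C := fun k => ratC (nth (0, 0) s k).

Lemma Ecoef_ratpoly s : Ecoef (ratpoly s).
Proof.
apply: (@Ecoef_poly _ _ (size s)) => k hk.
by rewrite /ratpoly nth_default // /ratC /= rmorph0 ofR0 mulr0 addr0.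
Qed.

Lemma entire_poly_approx (f : fct) (r e : R) : entire f -> 0 < r -> 0 < e ->
  exists n, dclose r e (psum (taylor_coef f) n) f.
Proof.
move=> /entire_taylor [hE hf] r0 e0.
have [n hn] := pval_approx hE r0 e0; exists n => z zr.
by rewrite nmB {1}hf; apply: hn.
Qed.

(** Separability: polynomials with coefficients in Q + iQ form a countable dense
    set. *)
Lemma ratpoly_dense (f : fct) (r e : R) : entire f -> 0 < r -> 0 < e ->
  exists s, dclose r e (pval (ratpoly s)) f.
Proof.
move=> fE r0 e0; have e2 : 0 < e / 2 by rewrite divr_gt0.
have [n hn] := entire_poly_approx fE r0 e2.
pose S := 1 + \sum_(k < n) r ^+ k.
have S0 : 0 < S by rewrite ltr_wpDr // sumr_ge0 // => i _; rewrite exprn_ge0 // ltW.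
have d0 : 0 < e / 2 / S by rewrite divr_gt0.
have [q hq] := @choice _ _ (fun k q => nm (taylor_coef f k - ratC q) <= e / 2 / S) (fun k => ratC_dense (taylor_coef f k) d0).
exists (mkseq q n); rewrite (_ : e = e / 2 + e / 2); last by lra.
apply: dclose_tri hn => z zr.
rewrite (@pval_poly _ _ n); last first.
  by move=> k hk; rewrite /ratpoly nth_default ?size_mkseq // /ratC /= rmorph0 ofR0 mulr0 addr0.
rewrite /psum -sumrB; apply: le_trans (nm_sum _ _ _) _.
apply: (@le_trans _ _ (\sum_(k < n) e / 2 / S * r ^+ k)).
  apply: ler_sum => k _; rewrite -mulrBl nmM nmX /ratpoly nth_mkseq //.
  rewrite ler_pM ?nm_ge0 ?exprn_ge0 ?nm_ge0 //; first by rewrite nmB.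
  by rewrite lerXn2r ?nnegrE ?nm_ge0 // ltW.
rewrite -big_distrr /= mulrAC ler_pdivrMr // ler_wpM2l ?(ltW e2) //.
by rewrite /S lerDr.
Qed.

(** Baire category argument. A sequence of nested balls is built, the n-th of which
    is mapped close to the n-th target function by some S i; their centres converge
    to an entire function. *)
Lemma universality (I : Type) (S : I -> fct -> fct) : (forall i, cont_op (S i)) ->
  (forall (x y : fct) (r e : R), entire x -> entire y -> 0 < r -> 0 < e ->
     exists i (v : fct), [/\ entire v, dclose r e v x & dclose r e (S i v) y]) ->
  exists2 f, entire f & dense_in_entire [set g | exists i, g = S i f].
Proof.
move=> hS hU.
pose Y n : fct := pval (ratpoly (odflt [::] (@unpickle (seq (rat * rat)) n))).
have YE n : entire (Y n) by apply: pval_entire; apply: Ecoef_ratpoly.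
(* Each target function is paired with each radius l+1, the tolerance being
   (l+1)^-1. *)
pose target n : fct * R := if @unpickle (nat * nat)%type n is Some p then (Y p.1, p.2.+1%:R) else (zer, 1).
have tE n : entire (target n).1 /\ 0 < (target n).2.
  rewrite /target; case: unpickle => [[k l]|] /=; split; [exact: YE|by rewrite ltr0n|exact: entire0|exact: ltr01].
(* A state is a closed ball: a centre, a radius for the disc of uniform
   approximation, and a tolerance. Successive balls are nested. *)
pose good n (st : fct * (R * R)) := [/\ entire st.1, n%:R <= st.2.1, 0 < st.2.1, 0 < st.2.2 & st.2.2 <= 2^-1 ^+ n].
pose nxt n (st st' : fct * (R * R)) := forall g : fct, entire g -> dclose st'.2.1 st'.2.2 g st'.1 ->
   exists i, dclose (target n).2 (target n).2^-1 (S i g) (target n).1.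
pose sub (st st' : fct * (R * R)) := forall g : C -> C, dclose st'.2.1 st'.2.2 g st'.1 -> dclose st.2.1 st.2.2 g st.1.
have step n st : exists st', good n st -> [/\ good n.+1 st', nxt n st st' & sub st st'].
  have [[fE rn r0 e0 en]|ng] := pselect (good n st); last by exists st.
  have [tEn tpos] := tE n.
  pose r1 := Num.max st.2.1 (target n).2; pose e1 := Num.min (st.2.2 / 2) ((target n).2^-1 / 2).
  have [||i [v [vE v1 v2]]] := hU st.1 (target n).1 r1 e1 fE tEn.
  - by rewrite lt_max r0.
  - by rewrite lt_min !divr_gt0 ?invr_gt0.
  have [_ _ hc] := hS i.
  have [|r' [e' [r'0 e'0 h]]] := hc v (target n).2 ((target n).2^-1 / 2) vE; first by rewrite divr_gt0 ?invr_gt0.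
  exists (v, (Num.max (Num.max st.2.1 r') n.+1%:R, Num.min (Num.min (st.2.2 / 2) e') (2^-1 ^+ n.+1))) => _; split.
  - split => //=; first by rewrite le_max lexx orbT.
    + by rewrite !lt_max r0.
    + by rewrite !lt_min divr_gt0 // e'0 exprn_gt0 // invr_gt0.
    + by rewrite ge_min lexx orbT.
  - move=> g gE /= hg; exists i.
    rewrite (_ : (target n).2^-1 = (target n).2^-1 / 2 + (target n).2^-1 / 2); last by lra.
    apply: dclose_tri; last first.
      by apply: dclose_le v2; [rewrite /r1 le_max lexx orbT|rewrite /e1 ge_min lexx orbT].
    apply: h => //; apply: dclose_le hg; first by rewrite !le_max lexx orbT.
    by rewrite !ge_min lexx orbT.
  - move=> g /= hg; rewrite (_ : st.2.2 = st.2.2 / 2 + st.2.2 / 2); last by lra.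
    apply: dclose_tri; last first.
      by apply: dclose_le v1; [rewrite /r1 le_max lexx|rewrite /e1 ge_min lexx].
    apply: dclose_le hg; first by rewrite !le_max lexx.
    by rewrite !ge_min lexx.
have [nx hnx] := @choice _ _ (fun ns st' => good ns.1 ns.2 -> [/\ good ns.1.+1 st', nxt ns.1 ns.2 st' & sub ns.2 st'])
  (fun ns => step ns.1 ns.2).
pose T := fix T n := if n is n'.+1 then nx (n', T n') else (zer, (1 : R, 1 : R)).
have gT n : good n (T n).
  elim: n => [|n IH]; first by split => //=; rewrite ?expr0 //; exact: entire0.
  by have [] := hnx (n, T n) IH.
have nT n : nxt n (T n) (T n.+1) by have [] := hnx (n, T n) (gT n).
have sT n k : sub (T n) (T (n + k)%N).
  elim: k => [|k IH]; first by rewrite addn0.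
  by move=> g; rewrite addnS => hg; apply: IH; have [_ _] := hnx (n + k, T (n + k))%N (gT _); apply.
have cT n m : (n <= m)%N -> dclose (T n).2.1 (T n).2.2 (T m).1 (T n).1.
  move=> h; rewrite -(subnKC h); apply: sT; apply: dclose_refl.
  by have [_ _ _ /ltW] := gT (n + (m - n))%N.
have archi (x : R) : exists n, x <= n%:R.
  by exists (Num.truncn x).+1; rewrite ltW // truncnS_gt.
have rT z : exists n0, forall n, (n0 <= n)%N -> nm z <= (T n).2.1.
  have [n0 h0] := archi (nm z); exists n0 => n hn; have [_ h _ _ _] := gT n.
  by rewrite (le_trans h0) // (le_trans _ h) // ler_nat.
have [f hf] : {f : C -> C & forall z, lim_to (fun n => (T n).1 z) (f z)}.
  apply: (@choice _ _ (fun z l => lim_to (fun n => (T n).1 z) l)) => z; apply: cauchy_lim_to => e e0.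
  have [n0 h0] := rT z; have [N hN] := half_pow_small 1 e0.
  exists (maxn n0 N) => m hm; apply: le_trans (hN (maxn n0 N) (leq_maxr _ _)); rewrite mul1r.
  have [_ _ _ _ h] := gT (maxn n0 N); apply: le_trans h.
  by apply: cT => //; apply: h0; rewrite leq_maxl.
have fT n : dclose (T n).2.1 (T n).2.2 f (T n).1.
  by move=> z zr; apply: (lim_to_le (hf z)); exists n => m hm; apply: cT.
have fE : entire (f : fct).
  suff [a ha hfa] : exists2 a, Ecoef a & forall z, f z = pval a z.
    by rewrite (_ : (f : fct) = pval a); [exact: pval_entire|apply/funext].
  apply: pval_closed => r e r0 e0.
  have [n0 h0] := archi r; have [N hN] := half_pow_small 1 e0.
  pose n := maxn n0 N; have [gE grn _ _ ge] := gT n.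
  have [gc gp] := entire_taylor gE; exists (taylor_coef (T n).1) => //; rewrite -gp.
  apply: dclose_sym; apply: dclose_le (fT n).
    by apply: le_trans grn; apply: le_trans h0 _; rewrite ler_nat leq_maxl.
  by apply: le_trans ge _; rewrite -[leLHS]mul1r hN // leq_maxr.
exists (f : fct); first exact: fE.
apply/dense_in_entireP => y r e yE r0 e0.
have [s hs] := ratpoly_dense yE r0 (divr_gt0 e0 (ltr0n R 2)).
have [l hl] := archi (Num.max r (2 / e)).
move: hl; rewrite ge_max => /andP[hl1 hl2].
pose n := pickle (pickle s, l).
have [i hi] := nT n f fE (fT n.+1).
exists (S i f); first by exists i.
rewrite (_ : e = e / 2 + e / 2); last by lra.
apply: dclose_tri hs.
move: hi; rewrite /target /n pickleK /= /Y pickleK /=.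
apply: dclose_le; first by rewrite (le_trans hl1) // ler_nat.
have l0 : 0 < l.+1%:R :> R by rewrite ltr0n.
rewrite -[e / 2]invrK lef_pV2 ?posrE ?invr_gt0 ?divr_gt0 // invf_div.
by rewrite (le_trans hl2) // ler_nat.
Qed.

Definition dense_sub (V : fct -> Prop) := forall (f : fct) (r e : R), entire f -> 0 < r -> 0 < e ->
  exists2 g : fct, V g & dclose r e g f.

Definition small_on (r e : R) (f : C -> C) := forall z, nm z <= r -> nm (f z) <= e.

(** This set and the next one are those of the hypercyclicity criterion. Both are
    linear subspaces, so that it is enough to exhibit exponentials or monomials in
    them. *)
Definition vanishing_orbit (T : fct -> fct) (x : fct) := entire x /\
  forall r e : R, 0 < r -> 0 < e -> exists N, forall n, (N <= n)%N -> small_on r e (iter n T x).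
(** The preimages h depend on n and need not come from a right inverse of T. *)
Definition vanishing_preorbit (T : fct -> fct) (y : fct) := entire y /\
  forall r e : R, 0 < r -> 0 < e -> exists N, forall n, (N <= n)%N ->
    exists h : fct, [/\ entire h, small_on r e h & iter n T h = y].

(** The vector h + x is close to x, and T^n maps it close to y since T^n x is small
    and T^n h = y. *)
Lemma hypercyclicity_criterion (T : fct -> fct) : cont_op T -> dense_sub (vanishing_orbit T) -> dense_sub (vanishing_preorbit T) -> hypercyclic T.
Proof.
move=> hT hX hY.
have [||f fE hf] := @universality nat (fun n => iter n.+1 T).
- by move=> n; apply: cont_op_iter.
- move=> x y r e xE yE r0 e0; have e2 : 0 < e / 2 by rewrite divr_gt0.
  have [x' [x'E hx'] xx'] := hX x r _ xE r0 e2.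
  have [y' [y'E hy'] yy'] := hY y r _ yE r0 e2.
  have [N hN] := hx' r _ r0 e2; have [M hM] := hy' r _ r0 e2.
  pose n := maxn N M; have Nn : (N <= n.+1)%N by rewrite leqW // leq_maxl.
  have [h [hE hs hT']] := hM n.+1 (leqW (leq_maxr _ _)).
  exists n, (add h x'); split; first exact: entireD.
    move=> z zr; rewrite addV -addrA.
    apply: le_trans (nmD _ _) _; have := hs z zr; have := xx' z zr; lra.
  move=> z zr; rewrite (cont_opD (cont_op_iter n.+1 hT) hE x'E) hT'.
  rewrite addV addrAC; apply: le_trans (nmD _ _) _; have := hN _ Nn z zr; have := yy' z zr; lra.
exists f => //; move=> g gE; have := hf g gE; apply: closureS.
by move=> _ [n ->]; exists n.+1.
Qed.

Lemma hypercyclic_power (T : fct -> fct) q : (0 < q)%N -> hypercyclic (iter q T) -> hypercyclic T.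
Proof.
move=> q0 [f fE hf]; exists f => // g gE; have := hf g gE; apply: closureS.
by move=> _ [n /= n0 <-]; exists (n * q)%N; rewrite /= ?muln_gt0 ?n0 // iterM.
Qed.

End Operators.
Arguments entire_lin {R} a {f g} _ _.
Arguments entire0 {R}.
Arguments entireZ {R} a {f} _.
Arguments entireD {R f g} _ _.

(** * Rules of differentiation, Liouville's theorem, exponentials *)

Section Calculus.
Variable R : realType.
Local Notation C := (Cplx R).
Local Notation nm := (@nm R).

Definition cont_at (f : C -> C) (z : C) := forall e : R, 0 < e -> exists2 d : R, 0 < d &
  forall w, nm (w - z) <= d -> nm (f w - f z) <= e.

Lemma cont_at_cst c z : cont_at (fun=> c) z.
Proof. by move=> e e0; exists 1 => // w _; rewrite subrr nm0 ltW. Qed.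

Lemma cont_at_id z : cont_at id z.
Proof. by move=> e e0; exists e. Qed.

Lemma cont_at_add f g z : cont_at f z -> cont_at g z -> cont_at (fun w => f w + g w) z.
Proof.
move=> hf hg e e0; have e2 : 0 < e / 2 by rewrite divr_gt0.
have [d d0 hd] := hf _ e2; have [d' d'0 hd'] := hg _ e2.
exists (Num.min d d'); first by rewrite lt_min d0.
move=> w; rewrite le_min => /andP[/hd h1 /hd' h2].
by rewrite opprD addrACA; apply: le_trans (nmD _ _) _; lra.
Qed.

Lemma cont_at_mul f g z : cont_at f z -> cont_at g z -> cont_at (fun w => f w * g w) z.
Proof.
move=> hf hg e e0.
have m1 : 0 < nm (g z) + 1 by rewrite ltr_wpDl ?nm_ge0.
have l1 : 0 < nm (f z) + 1 by rewrite ltr_wpDl ?nm_ge0.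
have e2 : 0 < e / 2 / (nm (g z) + 1) by rewrite !divr_gt0.
have e3 : 0 < Num.min 1 (e / 2 / (nm (f z) + 1)) by rewrite lt_min ltr01 !divr_gt0.
have [d d0 hd] := hf _ e2; have [d' d'0 hd'] := hg _ e3.
exists (Num.min d d'); first by rewrite lt_min d0.
move=> w; rewrite le_min => /andP[/hd h1 /hd'].
rewrite le_min => /andP[h2 h3].
rewrite (_ : _ - _ = (f w - f z) * g w + f z * (g w - g z)); last by ring.
rewrite (le_trans (nmD _ _)) // (nmM (f w - f z)) (nmM (f z)).
have hv1 : nm (g w) <= nm (g z) + 1 by rewrite (le_trans (nm_le_dist _ (g z))) // lerD2l.
have -> : e = e / 2 / (nm (g z) + 1) * (nm (g z) + 1) + (nm (f z) + 1) * (e / 2 / (nm (f z) + 1)).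
  by field; rewrite !gt_eqF.
by rewrite lerD // ler_pM ?nm_ge0 // lerDl.
Qed.

Lemma cont_at_comp f g z : cont_at g z -> cont_at f (g z) -> cont_at (fun w => f (g w)) z.
Proof.
by move=> hg hf e /hf [d d0 hd]; have [d' d'0 hd'] := hg _ d0; exists d' => // w /hd' /hd.
Qed.

Lemma cont_at_inv f z : cont_at f z -> f z != 0 -> cont_at (fun w => (f w)^-1) z.
Proof.
move=> hf fz e e0; have n0 := nm_gt0 fz; set q := nm (f z) in n0.
have [|d d0 hd] := hf (Num.min (q / 2) (e * (q * q / 2))).
  by rewrite lt_min divr_gt0 //= mulr_gt0 // divr_gt0 // mulr_gt0.
exists d => // w /hd; rewrite le_min => /andP[h1 h2].
have fw : q / 2 <= nm (f w).
  by have := nm_le_dist (f z) (f w); rewrite nmB -/q; lra.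
have fw0 : f w != 0 by apply/eqP => h; rewrite h nm0 in fw; lra.
rewrite (_ : _ - _ = - (f w - f z) / (f w * f z)); last by field; rewrite fz fw0.
rewrite (nmM (- _)) nmN nmV nmM -/q ler_pdivrMr; last by rewrite mulr_gt0 //; lra.
apply: le_trans h2 _; rewrite ler_wpM2l ?(ltW e0) // mulrAC.
by rewrite ler_wpM2r ?(ltW n0).
Qed.

(** Caratheodory's form of differentiability: the rules for products, composites
    and inverses become rules for continuous functions. *)
Lemma cdiff_carath f z v : cdiff f z v <-> exists q : C -> C,
  [/\ q 0 = v, forall h, f (z + h) - f z = h * q h & cont_at q 0].
Proof.
split.
  move=> hf; exists (fun h => if h == 0 then v else (f (z + h) - f z) / h); split.
  - by rewrite eqxx.
  - move=> h; have [->|h0] := eqVneq h 0; first by rewrite addr0 subrr mul0r.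
    by rewrite mulrCA divff ?mulr1.
  - move=> e e0; have [d d0 hd] := hf _ e0; exists d => // w; rewrite subr0 eqxx => wd.
    have [_|w0] := eqVneq w 0; first by rewrite subrr nm0 ltW.
    rewrite (_ : _ - v = (f (z + w) - f z - w * v) / w); last by field.
    by rewrite nmM nmV ler_pdivrMr ?nm_gt0 // hd.
move=> [q [<- hq cq]] e /cq [d d0 hd]; exists d => // h hh.
rewrite hq -mulrBr nmM mulrC ler_wpM2r ?nm_ge0 //; apply: hd; by rewrite subr0.
Qed.

Lemma cdiff_cst (c z : C) : cdiff (fun=> c) z 0.
Proof. by move=> e e0; exists 1 => // h _; rewrite subrr mulr0 subr0 nm0 mulr_ge0 ?nm_ge0 ?(ltW e0). Qed.

Lemma cdiff_id (z : C) : cdiff id z 1.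
Proof.
move=> e e0; exists 1 => // h _; rewrite (_ : _ - _ = 0); last by rewrite mulr1; ring.
by rewrite nm0 mulr_ge0 ?nm_ge0 ?(ltW e0).
Qed.

Lemma cdiff_cont f z v : cdiff f z v -> cont_at f z.
Proof.
move=> /cdiff_carath [q [_ hq cq]].
have h1 : cont_at (fun h => f z + h * q h) 0.
  by apply: cont_at_add; [exact: cont_at_cst|apply: cont_at_mul => //; exact: cont_at_id].
move=> e /h1 [d d0 hd]; exists d => // w hw.
have := hd (w - z); rewrite subr0 => /(_ hw).
by rewrite -hq mul0r addr0 (_ : z + (w - z) = w) 1?(_ : f z + (f w - f z) = f w) //; ring.
Qed.

Lemma cdiff_add (f g : C -> C) z v w : cdiff f z v -> cdiff g z w -> cdiff (fun x => f x + g x) z (v + w).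
Proof.
move=> /cdiff_carath [p [hp0 hp cp]] /cdiff_carath [q [hq0 hq cq]]; apply/cdiff_carath.
exists (fun h => p h + q h); split; first by rewrite hp0 hq0.
  by move=> h; rewrite opprD addrACA hp hq mulrDr.
exact: cont_at_add.
Qed.

Lemma cdiff_mul (f g : C -> C) z v w : cdiff f z v -> cdiff g z w -> cdiff (fun x => f x * g x) z (v * g z + f z * w).
Proof.
move=> hf hg; move: (hf) (hg).
move=> /cdiff_carath [p [hp0 hp cp]] /cdiff_carath [q [hq0 hq cq]]; apply/cdiff_carath.
exists (fun h => p h * (g z + h * q h) + f z * q h); split; first by rewrite hp0 hq0 mul0r addr0.
  move=> h; rewrite -hq; have -> : g z + (g (z + h) - g z) = g (z + h) by ring.
  rewrite (_ : h * _ = (h * p h) * g (z + h) + f z * (h * q h)); last by ring.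
  by rewrite -hp -hq; ring.
apply: cont_at_add; last by apply: cont_at_mul => //; exact: cont_at_cst.
apply: cont_at_mul => //; apply: cont_at_add; first exact: cont_at_cst.
by apply: cont_at_mul => //; exact: cont_at_id.
Qed.

Lemma cdiff_comp (f g : C -> C) z v w : cdiff g z v -> cdiff f (g z) w -> cdiff (fun x => f (g x)) z (w * v).
Proof.
move=> /cdiff_carath [p [hp0 hp cp]] /cdiff_carath [q [hq0 hq cq]]; apply/cdiff_carath.
exists (fun h => q (h * p h) * p h); split; first by rewrite mul0r hq0 hp0.
  move=> h; have -> : g (z + h) = g z + h * p h by rewrite -hp; ring.
  by rewrite hq; ring.
apply: cont_at_mul => //; apply: (@cont_at_comp q (fun h => h * p h)).
  by apply: cont_at_mul => //; exact: cont_at_id.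
by rewrite mul0r.
Qed.

Lemma cdiff_inv (f : C -> C) z v : cdiff f z v -> f z != 0 -> (forall w, f w != 0) -> cdiff (fun x => (f x)^-1) z (- v / (f z * f z)).
Proof.
move=> hf f0 fn; move: (hf); move=> /cdiff_carath [p [hp0 hp cp]]; apply/cdiff_carath.
exists (fun h => - p h * ((f z + h * p h)^-1 * (f z)^-1)); split.
- by rewrite mul0r addr0 hp0 invfM.
- move=> h; rewrite -hp (_ : f z + (f (z + h) - f z) = f (z + h)); last by ring.
  rewrite mulrA mulrN -hp; field; by rewrite f0 fn.
- apply: cont_at_mul.
    rewrite (_ : (fun w => - p w) = fun w => (-1) * p w); last by apply/funext => w; rewrite mulN1r.
    by apply: cont_at_mul => //; exact: cont_at_cst.
  apply: cont_at_mul; last exact: cont_at_cst.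
  apply: cont_at_inv; last by rewrite mul0r addr0.
  apply: cont_at_add; first exact: cont_at_cst.
  by apply: cont_at_mul => //; exact: cont_at_id.
Qed.

Lemma entire_mul (f g : fctC R) : entire f -> entire g -> entire ((fun z => f z * g z) : fctC R).
Proof.
move=> /entireP hf /entireP hg; apply/entireP => z.
have [v hv] := hf z; have [w hw] := hg z; exists (v * g z + f z * w); exact: cdiff_mul.
Qed.

Lemma entire_affine (f : fctC R) (a b : C) : entire f -> entire ((fun z => f (a * z + b)) : fctC R).
Proof.
move=> /entireP hf; apply/entireP => z; have [v hv] := hf (a * z + b).
exists (v * (0 * z + a * 1 + 0)); apply: (@cdiff_comp f (fun z => a * z + b)) => //.
apply: cdiff_add; last exact: cdiff_cst.
by apply: cdiff_mul; [exact: cdiff_cst|exact: cdiff_id].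
Qed.

Lemma entire_inv (f : fctC R) : entire f -> (forall z, f z != 0) -> entire ((fun z => (f z)^-1) : fctC R).
Proof.
move=> /entireP hf f0; apply/entireP => z; have [v hv] := hf z.
by eexists; apply: (cdiff_inv hv).
Qed.

Lemma zero_derivative (g : fctC R) : (forall z, cdiff (g : C -> C) z 0) -> forall z, g z = g 0.
Proof.
move=> hg; have /entire_pval [a ha hga] : entire g by apply/entireP => z; exists 0.
have : shiftd a = (fun=> 0).
  apply: pval_inj; first exact: Ecoef_shiftd.
    exact: (@Ecoef_poly _ _ 0).
  move=> z; rewrite (@pval_poly _ (fun=> 0) 0) // /psum big_ord0.
  by apply: (cdiff_uniq (f := g) (z := z)) => //; rewrite hga; exact: pval_cdiff.
move=> h z; rewrite hga !(@pval_poly _ a 1) //.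
- by rewrite /psum !big_ord_recl !big_ord0 !expr0.
- move=> [//|k] _; have := congr1 (fun u => u k) h; rewrite /shiftd /= => /eqP.
  by rewrite mulf_eq0 pnatr_eq0 /= => /eqP.
- move=> [//|k] _; have := congr1 (fun u => u k) h; rewrite /shiftd /= => /eqP.
  by rewrite mulf_eq0 pnatr_eq0 /= => /eqP.
Qed.

Lemma liouville (g : fctC R) (M : R) : entire g -> (forall z, nm (g z) <= M) -> forall z, g z = g 0.
Proof.
move=> /entire_pval [a ha hga] hM z.
have ak k : a k.+1 = 0.
  apply: nm_eq0; apply/le_anti; rewrite nm_ge0 andbT; apply: le_eps => e e0; rewrite add0r.
  have M0 : 0 <= M by apply: le_trans (hM 0); rewrite nm_ge0.
  pose r : R := Num.max 1 (M / e).
  have r1 : 1 <= r by rewrite le_max lexx.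
  have := @cauchy_estimate R a r M k.+1 ha (lt_le_trans ltr01 r1) _.
  move=> h; have {}h : nm (a k.+1) * r ^+ k.+1 <= M by apply: h => w _; rewrite -hga.
  have hr : r <= r ^+ k.+1 by rewrite -[leLHS]expr1 ler_weXn2l.
  have : nm (a k.+1) * r <= M by apply: le_trans h; rewrite ler_wpM2l ?nm_ge0.
  have Mr : M <= e * r by rewrite mulrC -ler_pdivrMr // le_max lexx orbT.
  by move=> h2; rewrite -(ler_pM2r (lt_le_trans ltr01 r1)) (le_trans h2).
rewrite hga !(@pval_poly _ a 1) //; try by case.
by rewrite /psum !big_ord_recl !big_ord0 !expr0.
Qed.

Definition exp_seq (a : C) k : C := a ^+ k / k`!%:R.
Definition cexp (a : C) : fctC R := pval (exp_seq a).

Lemma fact_neq0 k : k`!%:R != 0 :> C.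
Proof. by rewrite pnatr_eq0 -lt0n fact_gt0. Qed.

Lemma pow_fact N k : (0 < N -> N ^ k <= N ^ N * k`!)%N.
Proof.
move=> N0; elim: k => [|k IH]; first by rewrite expn0 fact0 muln1 expn_gt0 N0.
have [h|h] := leqP k.+1 N.
  by rewrite (leq_trans (leq_pexp2l N0 h)) // leq_pmulr // fact_gt0.
rewrite expnS factS mulnCA; apply: leq_mul => //; exact: ltnW.
Qed.

Lemma Ecoef_fact : Ecoef (fun k => (k`!%:R)^-1 : C).
Proof.
move=> r r0; pose N := (Num.truncn r).+1.
have rN : r <= N%:R by rewrite ltW // truncnS_gt.
exists (N ^ N)%:R => k; rewrite nmV nmn mulrC ler_pdivrMr ?ltr0n ?fact_gt0 // -natrM.
apply: (@le_trans _ _ (N%:R ^+ k)); first by rewrite lerXn2r ?nnegrE ?(ltW r0).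
by rewrite -natrX ler_nat pow_fact.
Qed.

Lemma Ecoef_exp_seq a : Ecoef (exp_seq a).
Proof.
apply: (@Ecoef_dom _ _ (fun k => (k`!%:R)^-1 : C) 1 (nm a + 1)) => //.
- by rewrite ltr_wpDl ?nm_ge0.
- move=> k; rewrite mul1r nmM nmX ler_wpM2r ?nm_ge0 // lerXn2r ?nnegrE ?nm_ge0 //.
    by rewrite addr_ge0 ?nm_ge0.
  by rewrite lerDl.
- exact: Ecoef_fact.
Qed.

Lemma entire_cexp a : entire (cexp a).
Proof. exact: pval_entire (Ecoef_exp_seq a). Qed.

Lemma cexp_swap a z : cexp a z = cexp 1 (a * z).
Proof.
apply: (lim_to_uniq (pval_lim z (Ecoef_exp_seq a))).
apply: lim_to_ext (pval_lim (a * z) (Ecoef_exp_seq 1)) => n.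
by apply: eq_bigr => k _; rewrite /exp_seq expr1n exprMn; ring.
Qed.

Lemma cexp_0 a : cexp a 0 = 1.
Proof. by rewrite /cexp pval0 ?/exp_seq ?expr0 ?fact0 ?divr1 //; exact: Ecoef_exp_seq. Qed.

Lemma shiftd_exp_seq a : shiftd (exp_seq a) = fun k => a * exp_seq a k.
Proof.
apply/funext => k; rewrite /shiftd /exp_seq factS natrM exprS.
by field; rewrite fact_neq0 nat1r pnatr_eq0.
Qed.

Lemma cexp_cdiff a z : cdiff (cexp a) z (a * cexp a z).
Proof.
have := pval_cdiff z (Ecoef_exp_seq a); rewrite shiftd_exp_seq pvalZ //; exact: Ecoef_exp_seq.
Qed.

Lemma cexp1D x y : cexp 1 (x + y) = cexp 1 x * cexp 1 y.
Proof.
(* The derivative of w |-> e^w e^(x + y - w) vanishes. *)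
pose g : fctC R := fun w => cexp 1 w * cexp 1 ((-1) * w + (x + y)).
have hg z : cdiff (g : C -> C) z 0.
  have d1 := cexp_cdiff 1 z.
  have d2 : cdiff (fun w => cexp 1 ((-1) * w + (x + y))) z (1 * cexp 1 ((-1) * z + (x + y)) * (0 * z + (-1) * 1 + 0)).
    apply: (@cdiff_comp (cexp 1) (fun z => (-1) * z + (x + y))); last exact: cexp_cdiff.
    apply: cdiff_add; last exact: cdiff_cst.
    by apply: cdiff_mul; [exact: cdiff_cst|exact: cdiff_id].
  have := cdiff_mul d1 d2; rewrite [X in cdiff _ _ X](_ : _ = 0); first exact.
  by move: (cexp 1 z) (cexp 1 (_ + _)) => A B; ring.
have := zero_derivative hg x; rewrite /g cexp_0 mulN1r (_ : - x + (x + y) = y); last by ring.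
by rewrite mulr0 add0r mul1r => ->.
Qed.

Lemma cexpD a b z : cexp (a + b) z = cexp a z * cexp b z.
Proof. by rewrite cexp_swap mulrDl cexp1D -!cexp_swap. Qed.

Lemma cexp0 z : cexp 0 z = 1.
Proof. by rewrite cexp_swap mul0r cexp_0. Qed.

Lemma cexpN a z : cexp a z * cexp (- a) z = 1.
Proof. by rewrite -cexpD subrr cexp0. Qed.

Lemma derive1n_cexp n a : derive1n n (cexp a) = fun z => a ^+ n * cexp a z.
Proof.
rewrite pval_derive1n; last exact: Ecoef_exp_seq.
apply/funext => z; rewrite -pvalZ; last exact: Ecoef_exp_seq.
congr (pval _ z); apply/funext => k; rewrite /shiftn /exp_seq.
rewrite -(ffact_fact (leq_addl k n)) addnK natrM exprD; field.
by rewrite fact_neq0 pnatr_eq0 -lt0n ffact_gt0 leq_addl.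
Qed.

End Calculus.
Arguments entire_cexp {R} a.
Arguments entire_mul {R f g} _ _.
Arguments entire_affine {R f} a b _.
Arguments entire_inv {R f} _ _.

(** * Density of spans of exponentials *)

Section Density.
Variable R : realType.
Local Notation C := (Cplx R).
Local Notation nm := (@nm R).
Local Notation fct := (fctC R).

Definition linear_sub (V : fct -> Prop) := V (@zer R) /\ forall a f g, V f -> V g -> V (lin a f g).

(** The closure of V for uniform convergence on discs. *)
Definition clo (V : fct -> Prop) (f : fct) := forall r e : R, 0 < r -> 0 < e -> exists2 g : fct, V g & dclose r e g f.

Lemma subZ V a f : linear_sub V -> V f -> V (scl a f).
Proof. by move=> [h0 h] hf; rewrite -lin_scl; exact: (h a f _ hf h0). Qed.

Lemma sub_sum V n (F : nat -> fct) (c : nat -> C) : linear_sub V -> (forall k, (k < n)%N -> V (F k)) ->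
  V ((fun z => \sum_(k < n) c k * F k z) : fct).
Proof.
move=> [h0 h]; elim: n => [|n IH] hF.
  rewrite (_ : (fun _ => _) = @zer R) //; by apply/funext => z; rewrite big_ord0 zerV.
rewrite (_ : (fun _ => _) = lin (c n) (F n) (fun z => \sum_(k < n) c k * F k z)).
  apply: (h (c n) (F n)); first exact: hF.
  by apply: IH => k kn; apply: hF; apply: ltnW.
by apply/funext => z; rewrite linV big_ord_recr /= addrC.
Qed.

Lemma clo_sub V : linear_sub V -> linear_sub (clo V).
Proof.
move=> [h0 h]; split; first by move=> r e r0 e0; exists (@zer R) => //; apply: dclose_refl; exact: ltW.
move=> a f g hf hg r e r0 e0.
have a1 : 0 < nm a + 1 by rewrite ltr_wpDl ?nm_ge0.
have e2 : 0 < e / 2 by rewrite divr_gt0.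
have [f' Vf' hf'] := hf r _ r0 (divr_gt0 e2 a1); have [g' Vg' hg'] := hg r _ r0 e2.
exists (lin a f' g'); first exact: (h a f' g' Vf' Vg').
move=> z zr; rewrite !linV (_ : _ - _ = a * (f' z - f z) + (g' z - g z)); last by ring.
apply: le_trans (nmD _ _) _; rewrite nmM; have := hg' z zr; have := hf' z zr.
rewrite ler_pdivlMr //; have := nm_ge0 (f' z - f z); lra.
Qed.

Lemma clo_clo V f : clo (clo V) f -> clo V f.
Proof.
move=> h r e r0 e0; have e2 : 0 < e / 2 by rewrite divr_gt0.
have [g hg gf] := h r _ r0 e2; have [k Vk kg] := hg r _ r0 e2.
exists k => //; rewrite (_ : e = e / 2 + e / 2); last by lra.
exact: dclose_tri kg gf.
Qed.

Lemma clo_incl (V : fct -> Prop) f : V f -> clo V f.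
Proof. by move=> Vf r e r0 e0; exists f => //; apply: dclose_refl; exact: ltW. Qed.

(** The coefficient of h^k in the expansion of e_(b + h) in powers of h. *)
Definition cexp_coef (b : C) k : fct := fun z => z ^+ k / k`!%:R * cexp b z.

Lemma cexp_bounded b (r : R) : exists2 M : R, 0 <= M & forall z, nm z <= r -> nm (cexp b z) <= M.
Proof. by apply: ccont_bounded; apply: cdiff_ccont => z; exists (b * cexp b z); exact: cexp_cdiff. Qed.

Lemma exp_tail (r : R) p : 0 < r -> exists2 K : R, 0 < K & forall (h z : C), nm h <= 1 -> nm z <= r ->
  nm (cexp h z - \sum_(k < p) h ^+ k * (z ^+ k / k`!%:R)) <= K * nm h ^+ p.
Proof.
move=> r0; have [|K hK] := @Ecoef_fact R (2 * r); first by rewrite mulr_gt0.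
have K0 : 0 <= K by apply: le_trans (hK 0%N); rewrite mulr_ge0 ?nm_ge0.
exists (2 * K + 1); first by lra.
move=> h z h1 zr.
pose t k : C := if (k < p)%N then exp_seq h k else 0.
have Et : Ecoef t by apply: (@Ecoef_poly _ _ p) => k pk; rewrite /t ltnNge pk.
have -> : \sum_(k < p) h ^+ k * (z ^+ k / k`!%:R) = pval t z.
  rewrite (@pval_poly _ _ p); last by move=> k pk; rewrite /t ltnNge pk.
  by apply: eq_bigr => k _; rewrite /t ltn_ord /exp_seq; ring.
have hp0 : 0 <= nm h ^+ p by rewrite exprn_ge0 ?nm_ge0.
have := @pval_dclose R (exp_seq h) t r (nm h ^+ p * K) r0 (Ecoef_exp_seq h) Et.
move=> H; apply: (@le_trans _ _ (2 * (nm h ^+ p * K))); last by lra.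
apply: H => // k; have [kp|kp] := ltnP k p.
  by rewrite /t kp subrr nm0 mul0r mulr_ge0.
rewrite /t ltnNge kp /= subr0 /exp_seq nmM nmX -mulrA.
apply: ler_pM (hK k); rewrite ?exprn_ge0 ?mulr_ge0 ?nm_ge0 ?exprn_ge0 ?mulr_ge0 ?(ltW r0) //.
by apply: ler_wiXn2l => //; rewrite nm_ge0.
Qed.

(** Once the coefficients of order less than p are in the closure, so is the p-th
    divided remainder of h |-> e_(b + h) at every a = b + h with e_a in V; it tends
    to the p-th coefficient as a tends to b. *)
Lemma clo_cexp_coef V (b : C) : linear_sub V -> (forall d : R, 0 < d -> exists a, [/\ a != b, nm (a - b) <= d & V (cexp a)]) ->
  forall p, clo V (cexp_coef b p).
Proof.
move=> hV hacc p; elim/ltn_ind: p => p IH.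
apply: clo_clo => r e r0 e0.
have [K K0 hK] := exp_tail p.+1 r0.
have [M M0 hM] := cexp_bounded b r.
have KM : 0 < K * M + 1 by rewrite ltr_wpDl // mulr_ge0 // ltW.
have [|a [ab abd Va]] := hacc (Num.min 1 (e / (K * M + 1))).
  by rewrite lt_min ltr01 divr_gt0.
move: abd; rewrite le_min; set h := a - b => /andP[h1 h2].
have h0 : h != 0 by rewrite subr_eq0.
have hcV := clo_sub hV.
(* The p-th divided remainder of h |-> e_(b + h) at h = 0. *)
exists (scl (h ^- p) (lin (-1) ((fun z => \sum_(k < p) h ^+ k * cexp_coef b k z) : fct) (cexp a))).
  apply: (subZ _ hcV); apply: (hcV.2 (-1)); last exact: clo_incl.
  exact: (sub_sum _ hcV).
move=> z zr; rewrite sclV linV.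
have -> : cexp a z = cexp b z * cexp h z by rewrite -cexpD /h; congr (cexp _ z); ring.
have -> : \sum_(k < p) h ^+ k * cexp_coef b k z = cexp b z * \sum_(k < p) h ^+ k * (z ^+ k / k`!%:R).
  by rewrite big_distrr /=; apply: eq_bigr => k _; rewrite /cexp_coef; ring.
have := hK h z h1 zr; rewrite big_ord_recr /= => hk.
rewrite (_ : _ - _ = cexp b z * h ^- p * (cexp h z - (\sum_(k < p) h ^+ k * (z ^+ k / k`!%:R) + h ^+ p * (z ^+ p / p`!%:R)))); last first.
  rewrite /cexp_coef; move: (cexp b z) (cexp h z) (\sum_(k < p) _) => A B S.
  by field; rewrite fact_neq0 expf_neq0.
rewrite nmM (nmM (cexp b z)) nmV nmX.
have hp0 : 0 < nm h ^+ p by rewrite exprn_gt0 // nm_gt0.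
apply: (@le_trans _ _ (M / nm h ^+ p * (K * nm h ^+ p.+1))).
  apply: ler_pM => //; rewrite ?nm_ge0 ?mulr_ge0 ?nm_ge0 ?invr_ge0 ?(ltW hp0) //.
  by rewrite ler_wpM2r ?invr_ge0 ?(ltW hp0) // hM.
rewrite exprS (_ : M / _ * _ = K * M * nm h); last by field; rewrite gt_eqF.
rewrite ler_pdivlMr // in h2; have := nm_ge0 h; nra.
Qed.

Lemma clo_mono_dense V : linear_sub V -> (forall p, clo V ((fun z => z ^+ p) : fct)) -> dense_sub V.
Proof.
move=> hV hm f r e fE r0 e0; suff : clo V f by apply.
apply: clo_clo => {}r {}e {}r0 {}e0.
have [n hn] := entire_poly_approx fE r0 e0.
exists (psum (taylor_coef f) n) => //.
by apply: (sub_sum (F := fun k => (fun z => z ^+ k) : fct) (taylor_coef f) (clo_sub hV)).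
Qed.

(** Polynomial approximations of f e_(-b), multiplied by e_b, are combinations of
    the functions of [clo_cexp_coef]. *)
Lemma exp_dense V (b : C) : linear_sub V -> (forall d : R, 0 < d -> exists a, [/\ a != b, nm (a - b) <= d & V (cexp a)]) ->
  dense_sub V.
Proof.
move=> hV hacc f r e fE r0 e0; suff : clo V f by apply.
have hem := clo_cexp_coef hV hacc.
apply: clo_clo => {}r {}e {}r0 {}e0.
have [M M0 hM] := cexp_bounded b r.
have M1 : 0 < M + 1 by rewrite ltr_wpDl.
have gE : entire ((fun z => f z * cexp (- b) z) : fct) by exact: (@entire_mul R f (cexp (- b)) fE (@entire_cexp R (- b))).
have [n hn] := entire_poly_approx gE r0 (divr_gt0 e0 M1).
set a := taylor_coef _ in hn.
exists ((fun z => \sum_(k < n) (a k * k`!%:R) * cexp_coef b k z) : fct).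
  exact: (sub_sum (fun k => a k * k`!%:R) (clo_sub hV)).
move=> z zr.
have -> : \sum_(k < n) (a k * k`!%:R) * cexp_coef b k z = psum a n z * cexp b z.
  rewrite /psum big_distrl; apply: eq_bigr => k _ /=; rewrite /cexp_coef.
  move: (cexp b z) (fact_neq0 R k) => A h0; by field.
rewrite (_ : _ - _ = (psum a n z - f z * cexp (- b) z) * cexp b z); last first.
  by rewrite mulrBl -mulrA [cexp (- b) z * _]mulrC cexpN mulr1.
rewrite nmM.
have := hn z zr; rewrite ler_pdivlMr //; have := hM z zr.
have := nm_ge0 (psum a n z - f z * cexp (- b) z); move: (nm _) (nm _) => x y; nra.
Qed.

End Density.

(** * Functionals on Taylor coefficients *)

Section Functionals.
Variable R : realType.
Local Notation C := (Cplx R).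
Local Notation nm := (@nm R).
Local Notation fct := (fctC R).

Definition mono k : fct := fun z => z ^+ k.

Lemma mono_pval k : (mono k : C -> C) = pval (fun j => (j == k)%:R).
Proof.
apply/funext => z; rewrite (@pval_poly _ _ k.+1); last by move=> j kj; rewrite gtn_eqF.
rewrite /psum big_ord_recr /= eqxx mul1r big1 ?add0r // => j _.
by rewrite ltn_eqF ?mul0r.
Qed.

Lemma Ecoef_delta k : Ecoef (fun j => (j == k)%:R : C).
Proof. by apply: (@Ecoef_poly _ _ k.+1) => j kj; rewrite gtn_eqF. Qed.

Lemma entire_mono k : entire (mono k).
Proof. by rewrite mono_pval; exact: pval_entire (Ecoef_delta k). Qed.

Arguments entire_mono k : clear implicits.

Lemma taylor_pval (f : fct) a : Ecoef a -> (f : C -> C) = pval a -> taylor_coef f = a.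
Proof. by move=> ha ->; apply/funext => k; exact: taylor_coef_pval. Qed.

Lemma taylor_lin a (f g : fct) : entire f -> entire g ->
  taylor_coef (lin a f g) = fun k => a * taylor_coef f k + taylor_coef g k.
Proof.
move=> /entire_taylor [ef pf] /entire_taylor [eg pg].
apply: taylor_pval; first by apply: EcoefD => //; exact: EcoefZ.
apply/funext => z; rewrite linV pvalD //; last exact: EcoefZ.
by rewrite pvalZ // -pf -pg.
Qed.

Definition geo (d : nat -> C) := exists K M : R, [/\ 0 < K, 0 < M & forall k, nm (d k) <= K * M ^+ k].

Lemma geo_Ecoef d a : geo d -> Ecoef a -> Ecoef (fun k => d k * a k).
Proof.
move=> [K [M [K0 M0 h]]]; apply: (@Ecoef_dom _ _ a K M) => // [|k]; first exact: ltW.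
by rewrite nmM ler_wpM2r ?nm_ge0.
Qed.

(** A sequence d represents the functional f |-> sum d_k f_k on the Taylor
    coefficients of f; geometric growth of d makes it continuous. *)
Definition pairing (d : nat -> C) (f : fct) : C := pval (fun k => d k * taylor_coef f k) 1.

Lemma pairing_lin d a (f g : fct) : geo d -> entire f -> entire g -> pairing d (lin a f g) = a * pairing d f + pairing d g.
Proof.
move=> hd fE gE; have [ef pf] := entire_taylor fE; have [eg pg] := entire_taylor gE.
rewrite /pairing (taylor_lin a fE gE) -pvalZ; last exact: geo_Ecoef.
rewrite -pvalD; [|by apply: EcoefZ; exact: geo_Ecoef|exact: geo_Ecoef].
by congr (pval _ 1); apply/funext => k; ring.
Qed.

Lemma taylor_zer : taylor_coef (@zer R) = fun=> 0.
Proof.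
apply: taylor_pval; first exact: (@Ecoef_poly _ _ 0).
by apply/funext => z; rewrite zerV (@pval_poly _ _ 0) // /psum big_ord0.
Qed.

Lemma pairing_zer d : pairing d (@zer R) = 0.
Proof.
rewrite /pairing taylor_zer (@pval_poly _ _ 0) ?/psum ?big_ord0 // => k _.
by rewrite mulr0.
Qed.

Lemma pairing_scl d a (f : fct) : geo d -> entire f -> pairing d (scl a f) = a * pairing d f.
Proof. by move=> hd fE; rewrite -lin_scl (pairing_lin a hd fE entire0) pairing_zer addr0. Qed.

Lemma pairing_mono d k : pairing d (mono k) = d k.
Proof.
rewrite /pairing (taylor_pval (Ecoef_delta k) (mono_pval k)) (@pval_poly _ _ k.+1); last first.
  by move=> j kj; rewrite gtn_eqF // mulr0.
rewrite /psum big_ord_recr /= eqxx mulr1 expr1n mulr1 big1 ?add0r // => j _.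
by rewrite ltn_eqF ?mulr0 ?mul0r.
Qed.

Lemma taylor_dist (f g : fct) (r e : R) k : entire f -> entire g -> 0 < r -> dclose r e f g ->
  nm (taylor_coef f k - taylor_coef g k) * r ^+ k <= e.
Proof.
move=> /entire_taylor [ef pf] /entire_taylor [eg pg] r0 h.
apply: (cauchy_estimate _ (EcoefB ef eg) r0) => z zr.
by rewrite pvalB // -pf -pg; exact: h.
Qed.

Lemma pairing_cont d (e : R) : geo d -> 0 < e -> exists r t : R, [/\ 0 < r, 0 < t &
  forall f g : fct, entire f -> entire g -> dclose r t f g -> nm (pairing d f - pairing d g) <= e].
Proof.
move=> hd e0; have [K [M [K0 M0 h]]] := hd.
exists (2 * M), (e / (2 * K)); split; [by rewrite mulr_gt0|by rewrite divr_gt0 // mulr_gt0|].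
move=> f g fE gE hfg.
have [ef pf] := entire_taylor fE; have [eg pg] := entire_taylor gE.
have := @pval_dclose R (fun k => d k * taylor_coef f k) (fun k => d k * taylor_coef g k) 1 (e / 2) ltr01 (geo_Ecoef hd ef) (geo_Ecoef hd eg).
rewrite /dclose (_ : 2 * (e / 2) = e); last by field.
apply; last by rewrite nm1.
move=> k; rewrite mulr1 -mulrBr nmM.
have M20 : 0 < 2 * M by rewrite mulr_gt0.
have hk := taylor_dist k fE gE M20 hfg.
apply: (@le_trans _ _ (K * M ^+ k * nm (taylor_coef f k - taylor_coef g k) * 2 ^+ k)).
  by rewrite !ler_wpM2r ?nm_ge0 ?exprn_ge0.
rewrite exprMn in hk.
rewrite (_ : _ * 2 ^+ k = K * (nm (taylor_coef f k - taylor_coef g k) * (2 ^+ k * M ^+ k))); last by ring.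
rewrite (_ : e / 2 = K * (e / (2 * K))); last by field; rewrite gt_eqF.
by rewrite ler_wpM2l // ltW.
Qed.

Lemma entire_psum a n : entire (psum a n : fct).
Proof.
have h : (psum a n : C -> C) = pval (fun k => if (k < n)%N then a k else 0).
  apply/funext => z; rewrite (@pval_poly _ _ n); last by move=> k kn; rewrite ltnNge kn.
  by apply: eq_bigr => k _; rewrite ltn_ord.
by rewrite h; apply: pval_entire; apply: (@Ecoef_poly _ _ n) => k kn; rewrite ltnNge kn.
Qed.

Arguments entire_psum a n : clear implicits.

Lemma psum0 (a : nat -> C) : (psum a 0 : C -> C) = @zer R.
Proof. by apply/funext => z; rewrite /psum big_ord0 zerV. Qed.

Lemma psum_lin (a : nat -> C) n : (psum a n.+1 : C -> C) = lin (a n) (mono n) (psum a n : fct).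
Proof. by apply/funext => z; rewrite psumS linV addrC. Qed.

(** Both sides are linear and continuous, and polynomials are dense. *)
Lemma pairing_comp T d d' : cont_op T -> geo d -> geo d' -> (forall k, pairing d (T (mono k)) = d' k) ->
  forall f, entire f -> pairing d (T f) = pairing d' f.
Proof.
move=> hT hd hd' hk f fE; have [t1 t2 t3] := hT.
have hp a n : pairing d (T (psum a n : fct)) = pairing d' (psum a n : fct).
  elim: n => [|n IH].
    by rewrite psum0 (cont_op0 hT) !pairing_zer.
  rewrite psum_lin (t2 (a n) _ _ (entire_mono n) (entire_psum a n)).
  rewrite (pairing_lin _ hd (t1 _ (entire_mono n)) (t1 _ (entire_psum a n))).
  by rewrite (pairing_lin _ hd' (entire_mono n) (entire_psum a n)) IH hk pairing_mono.
apply/eqP; rewrite -subr_eq0; apply/eqP/nm_eq0/le_anti; rewrite nm_ge0 andbT.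
apply: le_eps => e e0; rewrite add0r.
have e2 : 0 < e / 2 by rewrite divr_gt0.
have [r [t [r0 t0 h]]] := pairing_cont hd e2; have [r' [t' [r'0 t'0 h']]] := pairing_cont hd' e2.
have [r1 [t1' [r10 t10 h1]]] := t3 f r t fE t0.
have [||n hn] := @entire_poly_approx R f (Num.max r' r1) (Num.min t' t1') fE.
- by rewrite lt_max r'0.
- by rewrite lt_min t'0.
set p : fct := psum _ n in hn; have pE : entire p by exact: entire_psum.
have b1 : nm (pairing d (T p) - pairing d (T f)) <= e / 2.
  apply: (h _ _ (t1 _ pE) (t1 _ fE)); apply: (h1 _ pE); apply: dclose_le hn; first by rewrite le_max lexx orbT.
  by rewrite ge_min lexx orbT.
have b2 : nm (pairing d' p - pairing d' f) <= e / 2.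
  apply: (h' _ _ pE fE); apply: dclose_le hn; first by rewrite le_max lexx.
  by rewrite ge_min lexx.
rewrite -hp in b2; rewrite (nmB (pairing d (T p))) in b1.
by apply: le_trans (nm_tri _ (pairing d (T p)) _) _; lra.
Qed.

(** The transpose of differentiation, see [pairing_diffop]. *)
Definition dshift (d : nat -> C) k : C := k%:R * d k.-1.

Lemma geo_dshift d : geo d -> geo (dshift d).
Proof.
move=> [K [M [K0 M0 h]]]; exists (K / M), (2 * M); split; rewrite ?divr_gt0 ?mulr_gt0 //.
move=> [|k]; first by rewrite /dshift mul0r nm0 expr0 mulr1 ltW // divr_gt0.
rewrite /dshift /= nmM nmn (_ : K / M * _ = 2 ^+ k.+1 * (K * M ^+ k)); last first.
  by rewrite exprMn (exprS M); field; rewrite gt_eqF.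
by rewrite ler_pM ?nm_ge0 // -natrX ler_nat ltnW // ltn_expl.
Qed.

Lemma diffop_pval (f : fct) : entire f -> (diffop f : C -> C) = pval (shiftd (taylor_coef f)).
Proof.
move=> fE; have [ef pf] := entire_taylor fE.
by rewrite /diffop {1}pf (pval_derive1 ef).
Qed.

Lemma pairing_diffop d (f : fct) : geo d -> entire f -> pairing d (diffop f) = pairing (dshift d) f.
Proof.
move=> hd fE; have [ef pf] := entire_taylor fE.
have pd := diffop_pval fE.
have es := Ecoef_shiftd ef.
rewrite /pairing (taylor_pval es pd).
have h1 := lim_toS (pval_lim 1 (geo_Ecoef (geo_dshift hd) ef)).
apply: (lim_to_uniq (pval_lim 1 (geo_Ecoef hd es))).
apply: lim_to_ext h1 => n.
rewrite /psum big_ord_recl /= /dshift mul0r !mul0r add0r.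
by apply: eq_bigr => k _; rewrite /= /bump /= add1n /shiftd !expr1n; ring.
Qed.

Lemma entire_diffop (f : fct) : entire f -> entire (diffop f).
Proof.
move=> fE; have [ef pf] := entire_taylor fE.
by rewrite (diffop_pval fE); exact: (pval_entire (Ecoef_shiftd ef)).
Qed.

Arguments entire_diffop f _ : clear implicits.
Arguments entire_diffop {f} _.

(** Put u = pairing d and v(f) = u(f'). Along c T^n f the ratio v / u is multiplied
    by lambda at each step, so in modulus it stays on one side of |v(f)| / |u(f)|;
    since u and v are linearly independent, this is incompatible with density. *)
Lemma not_supercyclic_eigen (T : fct -> fct) (lambda mu : C) d : cont_op T ->
  (forall f : fct, entire f -> diffop (T f) = scl lambda (T (diffop f))) ->
  geo d -> d 0%N = 1 -> (forall f, entire f -> pairing d (T f) = mu * pairing d f) -> ~ supercyclic T.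
Proof.
move=> hT hD hd d0 hu [f fE hf].
have [t1 t2 t3] := hT.
pose d1 := dshift d; have hd1 : geo d1 by exact: geo_dshift.
have hv g : entire g -> pairing d1 (T g) = lambda * mu * pairing d1 g.
  move=> gE; have dE := entire_diffop gE.
  rewrite -(pairing_diffop hd (t1 _ gE)) -(pairing_diffop hd gE).
  by rewrite (hD _ gE) (pairing_scl lambda hd (t1 _ dE)) (hu _ dE) mulrA.
have iE n : entire (iter n T f) by elim: n => [|n IH]; [exact: fE|rewrite iterS; exact: (t1 _ IH)].
have un n : pairing d (iter n T f) = mu ^+ n * pairing d f.
  by elim: n => [|n IH]; [rewrite expr0 mul1r|rewrite iterS (hu _ (iE n)) IH exprS mulrA].
have vn n : pairing d1 (iter n T f) = (lambda * mu) ^+ n * pairing d1 f.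
  by elim: n => [|n IH]; [rewrite expr0 mul1r|rewrite iterS (hv _ (iE n)) IH exprS mulrA].
set U := pairing d f in un; set V := pairing d1 f in vn.
have approx g (e : R) : entire g -> 0 < e -> exists c n,
    nm (c * (mu ^+ n * U) - pairing d g) <= e /\ nm (c * ((lambda * mu) ^+ n * V) - pairing d1 g) <= e.
  move=> gE e0; have [r [t [r0 t0 h]]] := pairing_cont hd e0; have [r' [t' [r'0 t'0 h']]] := pairing_cont hd1 e0.
  have [||o [c _ [n _ <-]] ho] := (iffLR (dense_in_entireP _) hf) g (Num.max r r') (Num.min t t') gE.
  - by rewrite lt_max r0.
  - by rewrite lt_min t0.
  rewrite sclE in ho; have oE : entire (scl c (iter n T f)) by exact: (entireZ c (iE n)).
  exists c, n; rewrite -un -vn -(pairing_scl c hd (iE n)) -(pairing_scl c hd1 (iE n)); split.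
    apply: (h _ _ oE gE); apply: dclose_le ho; first by rewrite le_max lexx.
    by rewrite ge_min lexx.
  apply: (h' _ _ oE gE); apply: dclose_le ho; first by rewrite le_max lexx orbT.
  by rewrite ge_min lexx orbT.
have limit_le (x y : C -> nat -> C) (X Y : C) (A B : R) :
    (forall e : R, 0 < e -> exists c n, nm (x c n - X) <= e /\ nm (y c n - Y) <= e) ->
    0 <= A -> 0 <= B -> (forall c n, A * nm (y c n) <= B * nm (x c n)) -> A * nm Y <= B * nm X.
  move=> hxy A0 B0 hc; apply: le_eps => e e0; have AB : 0 < A + B + 1 by lra.
  have [c [n [h1 h2]]] := hxy _ (divr_gt0 e0 AB).
  have := hc c n; rewrite nmB in h2.
  have k1 := ler_wpM2l B0 (le_trans (nm_le_dist (x c n) X) (lerD (lexx _) h1)).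
  have k2 := ler_wpM2l A0 (le_trans (nm_le_dist Y (y c n)) (lerD (lexx _) h2)).
  have : (A + B) * (e / (A + B + 1)) <= e.
    by rewrite mulrCA ler_piMr ?(ltW e0) // ler_pdivrMr //; lra.
  by rewrite !mulrDr in k1 k2; rewrite mulrDl; lra.
have pass g (A B : R) : entire g -> 0 <= A -> 0 <= B ->
    (forall c n, A * nm (c * ((lambda * mu) ^+ n * V)) <= B * nm (c * (mu ^+ n * U))) ->
    A * nm (pairing d1 g) <= B * nm (pairing d g).
  move=> gE; apply: (limit_le (fun c n => c * (mu ^+ n * U)) (fun c n => c * ((lambda * mu) ^+ n * V))).
  by move=> e; exact: approx.
have pass' g (A B : R) : entire g -> 0 <= A -> 0 <= B ->
    (forall c n, A * nm (c * (mu ^+ n * U)) <= B * nm (c * ((lambda * mu) ^+ n * V))) ->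
    A * nm (pairing d g) <= B * nm (pairing d1 g).
  move=> gE; apply: (limit_le (fun c n => c * ((lambda * mu) ^+ n * V)) (fun c n => c * (mu ^+ n * U))).
  by move=> e e0; have [c [n [h1 h2]]] := approx g e gE e0; exists c, n.
have v0 : pairing d1 (mono 0) = 0 by rewrite pairing_mono /d1 /dshift mul0r.
have v1 : pairing d1 (mono 1) = 1 by rewrite pairing_mono /d1 /dshift mul1r d0.
have u0 : pairing d (mono 0) = 1 by rewrite pairing_mono.
have U0 := nm_ge0 U; have V0 := nm_ge0 V.
have [l1|l1] := leP (nm lambda) 1.
  (* Test function z - d_1, on which u vanishes and v equals 1. *)
  have := pass (lin (- d 1%N) (mono 0) (mono 1)) (nm U) (nm V) (entire_lin _ (entire_mono 0) (entire_mono 1)) U0 V0.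
  rewrite (pairing_lin _ hd (entire_mono 0) (entire_mono 1)) (pairing_lin _ hd1 (entire_mono 0) (entire_mono 1)).
  rewrite v0 v1 u0 pairing_mono mulr0 add0r mulr1 addNr nm0 nm1 mulr0 mulr1 => H.
  have {}H : nm U <= 0.
    apply: H => c n; rewrite !nmM !nmX nmM exprMn.
    have : nm lambda ^+ n <= 1 by rewrite exprn_ile1 ?nm_ge0.
    have : 0 <= nm mu ^+ n by rewrite exprn_ge0 ?nm_ge0.
    have := nm_ge0 c.
    move: (nm c) (nm mu ^+ n) (nm lambda ^+ n) => x y l x0 y0 hl.
    rewrite (_ : nm V * _ = nm U * (x * (1 * y * nm V))); last by ring.
    by rewrite !ler_wpM2l // !ler_wpM2r.
  have := pass' (mono 0) 1 0 (entire_mono 0) ler01 (lexx _).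
  rewrite u0 nm1 mul0r mulr1 => H2; have : (1 : R) <= 0; last by rewrite ler10.
  apply: H2 => c n; rewrite mul0r mul1r !nmM.
  by rewrite (_ : nm U = 0) ?mulr0 //; apply/le_anti; rewrite H U0.
have := pass' (mono 0) (nm V) (nm U) (entire_mono 0) V0 U0.
rewrite v0 u0 nm0 nm1 mulr0 mulr1 => H.
have {}H : nm V <= 0.
  apply: H => c n; rewrite !nmM !nmX nmM exprMn.
  have : 1 <= nm lambda ^+ n by rewrite exprn_ege1 // ltW.
  have : 0 <= nm mu ^+ n by rewrite exprn_ge0 ?nm_ge0.
  have := nm_ge0 c.
  move: (nm c) (nm mu ^+ n) (nm lambda ^+ n) => x y l x0 y0 hl.
  rewrite (_ : nm V * _ = nm U * (x * (1 * y * nm V))); last by ring.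
  by rewrite !ler_wpM2l // !ler_wpM2r.
have := pass (mono 1) 1 0 (entire_mono 1) ler01 (lexx _).
rewrite v1 nm1 mul0r mulr1 => H2; have : (1 : R) <= 0; last by rewrite ler10.
apply: H2 => c n; rewrite mul0r mul1r !nmM.
by rewrite (_ : nm V = 0) ?mulr0 //; apply/le_anti; rewrite H V0.
Qed.

End Functionals.

Arguments entire_mono {R} k.
Arguments entire_psum {R} a n.
Arguments entire_diffop {R f} _.

(** * Action of L on exponentials and monomials *)

Section EigenOperator.
Variable R : realType.
Local Notation C := (Cplx R).
Local Notation nm := (@nm R).
Local Notation fct := (fctC R).
Variables (lambda : C) (phi : fct) (L : fct -> fct).
Hypothesis phiE : entire phi.
Hypothesis hL : forall f : fct, entire f -> L f = dilation lambda (fun_of_D phi f).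
Hypothesis LO : cont_op L.

Let a := taylor_coef phi.
Let Ea : Ecoef a := (entire_taylor phiE).1.
Let phip : (phi : C -> C) = pval a := (entire_taylor phiE).2.

Lemma series_psum (u : nat -> C) n : series u n = \sum_(k < n) u k.
Proof. by rewrite /series /= big_mkord. Qed.

(** Exponentials are eigenvectors of differentiation. *)
Lemma L_cexp b : L (cexp b) = scl (phi b) (cexp (lambda * b)).
Proof.
rewrite (hL (entire_cexp b)); apply/funext => z; rewrite sclV /dilation /fun_of_D.
have -> : cexp (lambda * b) z = cexp b (lambda * z).
  by rewrite cexp_swap (cexp_swap b) (_ : lambda * b * z = b * (lambda * z)) //; ring.
have h := lim_toM (pval_lim b Ea) (lim_to_cst (cexp b (lambda * z))).
rewrite -phip in h.
apply: limn_lim_to; move: h; set w := cexp b (lambda * z) => h.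
apply: lim_to_ext h => n.
rewrite series_psum /psum big_distrl; apply: eq_bigr => k _ /=.
by rewrite derive1n_cexp mulrA.
Qed.

Definition Lcoef k j : C := if (j <= k)%N then a (k - j)%N * (k ^_ (k - j))%:R * lambda ^+ j else 0.

Lemma L_mono k : (L (mono k) : C -> C) = pval (Lcoef k).
Proof.
rewrite (hL (entire_mono k)); apply/funext => z; rewrite /dilation /fun_of_D.
rewrite (@pval_poly _ _ k.+1); last by move=> j kj; rewrite /Lcoef leqNgt kj.
apply: limn_lim_to.
have hd n w : derive1n n (mono k : C -> C) w = if (n <= k)%N then (k ^_ n)%:R * w ^+ (k - n) else 0.
  rewrite mono_pval (pval_derive1n n (Ecoef_delta k)).
  rewrite (@pval_poly _ _ (k - n).+1); last first.
    move=> j hj; rewrite /shiftn; case: eqP => [e|_]; last by rewrite mulr0.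
    by move: hj; rewrite -e addnK ltnn.
  rewrite /psum big_ord_recr /= big1 ?add0r; last first.
    move=> j _; rewrite /shiftn; case: eqP => [e|_]; last by rewrite mulr0 mul0r.
    by have := ltn_ord j; move: e; move: (j : nat) => i; lia.
  rewrite /shiftn; have [nk|nk] := leqP n k; first by rewrite subnK // eqxx mulr1.
  case: eqP => [e|_]; last by rewrite mulr0 mul0r.
  by move: nk; rewrite -{1}e; lia.
move=> e e0; exists k.+1 => n hn.
rewrite (_ : series _ n = psum (Lcoef k) k.+1 z) ?subrr ?nm0 ?ltW //.
rewrite series_psum -(subnKC hn) big_split_ord /= [X in _ + X]big1 ?addr0; last first.
  by move=> i _; rewrite -[X in _ * X]/(derive1n (k.+1 + i) (mono k : C -> C) (lambda * z)) hd ifF ?mulr0 // leqNgt; apply/negbF; rewrite -ltnS leq_addr.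
rewrite /psum [RHS](reindex_inj rev_ord_inj) /=; apply: eq_bigr => j _.
have jk : (j <= k)%N by rewrite -ltnS.
by rewrite hd jk subSS /Lcoef leq_subr (subKn jk) exprMn !mulrA.
Qed.

Lemma Ecoef_Lcoef k : Ecoef (Lcoef k).
Proof. by apply: (@Ecoef_poly _ _ k.+1) => j kj; rewrite /Lcoef leqNgt kj. Qed.

(** The transpose of L, see [pairing_L]. *)
Definition dual_op (d : nat -> C) k : C := \sum_(j < k.+1) a (k - j)%N * (k ^_ (k - j))%:R * lambda ^+ j * d j.

Lemma pairing_L_mono d k : pairing d (L (mono k)) = dual_op d k.
Proof.
rewrite /pairing (taylor_pval (Ecoef_Lcoef k) (L_mono k)) (@pval_poly _ _ k.+1); last first.
  by move=> j kj; rewrite /Lcoef leqNgt kj mulr0.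
apply: eq_bigr => j _; rewrite /Lcoef -ltnS ltn_ord expr1n; ring.
Qed.

Lemma pairing_L d f : geo d -> geo (dual_op d) -> entire f -> pairing d (L f) = pairing (dual_op d) f.
Proof. by move=> hd hs fE; exact: (pairing_comp LO hd hs (pairing_L_mono d) fE). Qed.

End EigenOperator.

(** * The case |lambda| < 1: functionals *)

Section SmallLambda.
Variable R : realType.
Local Notation C := (Cplx R).
Local Notation nm := (@nm R).
Local Notation fct := (fctC R).

Lemma fact_le_pow k : (k`! <= k ^ k)%N.
Proof.
elim: k => [//|k IH]; rewrite factS expnS leq_mul2l /=.
by apply: leq_trans IH _; case: k => [//|k]; rewrite leq_exp2r.
Qed.

(** Cauchy estimates for a function of exponential type: k! phi_k grows at most
    geometrically. *)
Lemma exp_type_coef (phi : fct) : entire phi -> exponential_type phi ->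
  exists A B : R, [/\ 0 < A, 0 < B & forall i, nm (taylor_coef phi i) * i`!%:R <= A * B ^+ i].
Proof.
move=> phiE [A0 [B0 h0]]; have [Ea phip] := entire_taylor phiE; set a := taylor_coef phi in Ea phip *.
pose A := Num.max A0 1; pose B := Num.max B0 1.
have A1 : 1 <= A by rewrite le_max lexx orbT.
have B1 : 1 <= B by rewrite le_max lexx orbT.
have h z : nm (phi z) <= A * expR (B * nm z).
  apply: (le_trans (h0 z)); apply: (@le_trans _ _ (A * expR (B0 * nm z))).
    by rewrite ler_wpM2r ?expR_ge0 // le_max lexx.
  by rewrite ler_wpM2l ?(le_trans ler01) // ler_expR ler_wpM2r ?nm_ge0 // le_max lexx.
(* The Cauchy estimate of order k on the circle of radius k / B is optimal,
   and k! <= k^k. *)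
exists A, (expR 1 * B); split; [lra|by rewrite mulr_gt0 ?expR_gt0 //; lra|].
move=> [|i].
  rewrite expr0 mulr1 fact0 mulr1 -(pval0 Ea) -phip.
  by have := h 0; rewrite nm0 mulr0 expR0 mulr1.
pose r := i.+1%:R / B; have r0 : 0 < r by rewrite divr_gt0 ?ltr0n //; lra.
have hr : nm (a i.+1) * r ^+ i.+1 <= A * expR 1 ^+ i.+1.
  apply: (cauchy_estimate _ Ea r0) => z zr; rewrite -phip; apply: (le_trans (h z)).
  rewrite ler_wpM2l //; first lra.
  have e1 : (i.+1%:R : R) = B * r by rewrite /r mulrC divfK //; apply/eqP; lra.
  by rewrite -expRM_natl ler_expR mulr1 e1 ler_wpM2l //; lra.
rewrite exprMn mulrA; move: hr; rewrite /r expr_div_n mulrA ler_pdivrMr ?exprn_gt0 //; last lra.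
apply: le_trans; rewrite ler_wpM2l ?nm_ge0 // -natrX ler_nat; exact: fact_le_pow.
Qed.

Variables (lambda : C) (phi : fct) (L : fct -> fct).
Hypothesis phiE : entire phi.
Hypothesis phi_exp : exponential_type phi.
Hypothesis hL : forall f : fct, entire f -> L f = dilation lambda (fun_of_D phi f).
Hypothesis LO : cont_op L.
Let a := taylor_coef phi.
Hypothesis lam1 : nm lambda < 1.

Let rho := (1 + nm lambda) / 2.
Let rho01 : 0 <= rho < 1. Proof. rewrite /rho; have h := nm_ge0 lambda; move: lam1 => l1; apply/andP; split; lra. Qed.

(** The k-th entry of the transpose is a binomial sum. With the weights M^k, the
    factors lambda^j yield a gain rho^k with rho < 1, which beats the constant A
    for large k. *)
Lemma dual_op_bound : exists A M : R, [/\ 0 < A, 0 < M & forall d K k, 0 <= K -> (forall j, (j <= k)%N -> nm (d j) <= K * M ^+ j) ->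
   nm (dual_op lambda phi d k) <= K * (A * rho ^+ k) * M ^+ k].
Proof.
have [A [B [A0 B0 hAB]]] := exp_type_coef phiE phi_exp.
have l0 := nm_ge0 lambda; have l1 := lam1.
(* With this M, B + |lambda| M = rho M for rho = (1 + |lambda|) / 2 < 1. *)
pose M := 2 * B / (1 - nm lambda).
have M0 : 0 < M by rewrite divr_gt0 ?mulr_gt0 ?subr_gt0.
exists A, M; split => // d K k K0 hd.
apply: le_trans (nm_sum _ _ _) _.
apply: (@le_trans _ _ (\sum_(j < k.+1) K * A * ((B ^+ (k - j) * (nm lambda * M) ^+ j) *+ 'C(k, j)))).
  apply: ler_sum => j _; have jk : (j <= k)%N by rewrite -ltnS.
  rewrite (nmM _ (d j)) (nmM _ (lambda ^+ j)) (nmM (taylor_coef phi _)) nmn nmX.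
  have -> : (k ^_ (k - j))%:R = 'C(k, j)%:R * (k - j)`!%:R :> R by rewrite -natrM -bin_ffact bin_sub.
  have h1 := hAB (k - j)%N; have h2 := hd j jk.
  rewrite exprMn -[_ * _ *+ _]mulr_natl.
  rewrite (_ : _ * nm (d j) = 'C(k, j)%:R * nm lambda ^+ j * ((nm (a (k - j)%N) * (k - j)`!%:R) * nm (d j))); last by rewrite /a; ring.
  rewrite (_ : K * A * _ = 'C(k, j)%:R * nm lambda ^+ j * (A * B ^+ (k - j) * (K * M ^+ j))); last by ring.
  by rewrite ler_wpM2l ?mulr_ge0 ?exprn_ge0 // ler_pM ?mulr_ge0 ?nm_ge0.
rewrite -big_distrr /= -exprDn (_ : B + nm lambda * M = rho * M); last first.
  by rewrite /M /rho; field; lra.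
rewrite exprMn le_eqVlt; apply/orP; left; apply/eqP; ring.
Qed.

Section NonZero.
Hypothesis a0 : a 0%N != 0.

(** The equation dual_op d = a_0 d, solved for its entry of index k = size s. The
    divisor does not vanish since |lambda| < 1. *)
Definition next_d (s : seq C) : C := let k := size s in
  (\sum_(j < k) a (k - j)%N * (k ^_ (k - j))%:R * lambda ^+ j * nth 0 s j) / (a 0%N * (1 - lambda ^+ k)).
Fixpoint dseq n : seq C := if n is n'.+1 then rcons (dseq n') (next_d (dseq n')) else [:: 1].
Definition dual_eigen k : C := nth 0 (dseq k) k.

Lemma size_dseq n : size (dseq n) = n.+1.
Proof. by elim: n => [//|n IH]; rewrite /= size_rcons IH. Qed.

Lemma nth_dseq n j : (j <= n)%N -> nth 0 (dseq n) j = dual_eigen j.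
Proof.
elim: n => [|n IH]; first by rewrite leqn0 => /eqP ->.
rewrite leq_eqVlt => /orP[/eqP -> //|jn].
by rewrite /= nth_rcons size_dseq jn IH.
Qed.

Lemma one_sub_pow k : (0 < k)%N -> 1 - nm lambda <= nm (1 - lambda ^+ k).
Proof.
move=> k0; have := nm_le_dist 1 (lambda ^+ k); rewrite nm1 nmX; have l1 := lam1.
have : nm lambda ^+ k <= nm lambda.
  by rewrite -[leRHS]expr1 ler_wiXn2l ?nm_ge0 // ltW.
lra.
Qed.

Lemma one_sub_neq0 k : (0 < k)%N -> 1 - lambda ^+ k != 0.
Proof. by move=> k0; apply/eqP => h; have := one_sub_pow k0; have := lam1; rewrite h nm0; lra. Qed.

Lemma dual_eigenS k : dual_eigen k.+1 * (a 0%N * (1 - lambda ^+ k.+1)) =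
  \sum_(j < k.+1) a (k.+1 - j)%N * (k.+1 ^_ (k.+1 - j))%:R * lambda ^+ j * dual_eigen j.
Proof.
rewrite {1}/dual_eigen /= nth_rcons size_dseq ltnn eqxx /next_d size_dseq divfK; last first.
  by rewrite mulf_neq0 // one_sub_neq0.
by apply: eq_bigr => j _; rewrite nth_dseq // -ltnS.
Qed.

Lemma dual_op_eigen k : dual_op lambda phi dual_eigen k = a 0%N * dual_eigen k.
Proof.
case: k => [|k]; first by rewrite /dual_op big_ord_recl big_ord0 /= expr0 !mulr1 addr0.
rewrite /dual_op big_ord_recr /= subnn ffactn0 mulr1 -/a -dual_eigenS; ring.
Qed.

(** By [dual_op_bound] the bound propagates from the indices less than k to k as soon
    as k >= k0; the first k0 entries are absorbed in K. *)
Lemma dual_eigen_geo : geo dual_eigen.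
Proof.
have [A [M [A0 M0 hS]]] := dual_op_bound.
have l1 : 0 < nm (a 0%N) * (1 - nm lambda) by rewrite mulr_gt0 ?nm_gt0 ?subr_gt0.
have [k0 hk0] := pow_small A rho01 l1.
pose K := 1 + \sum_(j < k0) nm (dual_eigen j) / M ^+ j.
have pos j : 0 <= nm (dual_eigen j) / M ^+ j by rewrite divr_ge0 ?nm_ge0 ?exprn_ge0 // ltW.
have K0 : 0 < K by rewrite ltr_wpDr // sumr_ge0.
exists K, M; split => // k; elim/ltn_ind: k => k IH.
have [kk|kk] := ltnP k k0.
  rewrite -ler_pdivrMr ?exprn_gt0 // /K (bigD1 (Ordinal kk)) //= addrCA lerDl.
  by rewrite addr_ge0 // sumr_ge0.
case: k IH kk => [|k] IH kk; first by rewrite /dual_eigen /= nm1 expr0 mulr1 /K lerDl sumr_ge0.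
pose d' j := if (j <= k)%N then dual_eigen j else 0.
have := hS d' K k.+1 (ltW K0); rewrite /dual_op big_ord_recr /= (_ : d' k.+1 = 0) ?mulr0 ?addr0; last by rewrite /d' ltnn.
rewrite (eq_bigr (fun j : 'I_k.+1 => a (k.+1 - j)%N * (k.+1 ^_ (k.+1 - j))%:R * lambda ^+ j * dual_eigen j)); last first.
  by move=> j _; rewrite /d' -ltnS ltn_ord.
rewrite -dual_eigenS (nmM (dual_eigen _)) (nmM (a 0%N)) => H.
have {}H : nm (dual_eigen k.+1) * (nm (a 0%N) * nm (1 - lambda ^+ k.+1)) <= K * (A * rho ^+ k.+1) * M ^+ k.+1.
  apply: H => j jk; rewrite /d'; have [jk'|_] := leqP j k; first by apply: IH.
  by rewrite nm0 mulr_ge0 ?(ltW K0) // exprn_ge0 // ltW.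
have h1 := hk0 _ kk.
have h2 := one_sub_pow (ltn0Sn k).
rewrite -(ler_pM2r l1); apply: (@le_trans _ _ (nm (dual_eigen k.+1) * (nm (a 0%N) * nm (1 - lambda ^+ k.+1)))).
  by rewrite ler_wpM2l ?nm_ge0 // ler_wpM2l ?nm_ge0.
apply: (le_trans H); rewrite -mulrA (mulrC _ (M ^+ _)) mulrA ler_wpM2l //.
by rewrite mulr_ge0 ?(ltW K0) // exprn_ge0 // ltW.
Qed.

(** The sequence [dual_eigen] represents an eigenfunctional of L. *)
Lemma small_nonzero_not_supercyclic :
  (forall f : fct, entire f -> diffop (L f) = scl lambda (L (diffop f))) -> ~ supercyclic L.
Proof.
move=> hD; apply: (@not_supercyclic_eigen R L lambda (a 0%N) dual_eigen LO hD dual_eigen_geo) => // f fE.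
have e : dual_op lambda phi dual_eigen = fun k => a 0%N * dual_eigen k by apply/funext => k; exact: dual_op_eigen.
have [K [M [K0 M0 h]]] := dual_eigen_geo.
have hg : geo (dual_op lambda phi dual_eigen).
  exists (nm (a 0%N) * K), M; split => // [|k]; first by rewrite mulr_gt0 ?nm_gt0.
  by rewrite e nmM -mulrA ler_wpM2l ?nm_ge0.
have [ef pf] := entire_taylor fE.
rewrite (pairing_L hL LO dual_eigen_geo hg fE) e /pairing -pvalZ; last exact: (geo_Ecoef dual_eigen_geo ef).
by congr (pval _ 1); apply/funext => k; rewrite mulrA.
Qed.

End NonZero.

Section Zero.
Hypothesis a0 : a 0%N = 0.

(** It represents the functional f |-> (L^n f)(0), see [iter_at0]. *)
Definition dual_iter n : nat -> C := iter n (dual_op lambda phi) (fun k => (k == 0%N)%:R).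

Lemma dual_iter_zero n k : (k < n)%N -> dual_iter n k = 0.
Proof.
elim: n k => [//|n IH] k kn; rewrite /dual_iter iterS -/(dual_iter n) /dual_op big1 // => j _.
have [->|jk] := eqVneq (j : nat) k; first by rewrite subnn -/a a0 !mul0r.
rewrite IH ?mulr0 //; have := ltn_ord j; move: jk kn; move: (j : nat) => i; lia.
Qed.

(** The entries of index k >= k0 are controlled by [dual_op_bound], and those with
    k < n vanish, so that only finitely many pairs (n, k) remain. *)
Lemma dual_iter_bound : exists K M : R, [/\ 0 < K, 0 < M & forall n k, nm (dual_iter n k) <= K * M ^+ k].
Proof.
have [A [M [A0 M0 hS]]] := dual_op_bound.
have [k0 hk0] := pow_small A rho01 ltr01.
pose K := 1 + \sum_(n < k0) \sum_(j < k0) nm (dual_iter n j) / M ^+ j.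
have pos n j : 0 <= nm (dual_iter n j) / M ^+ j by rewrite divr_ge0 ?nm_ge0 ?exprn_ge0 // ltW.
have pos2 n : 0 <= \sum_(j < k0) nm (dual_iter n j) / M ^+ j by rewrite sumr_ge0.
have K1 : 1 <= K by rewrite lerDl sumr_ge0.
have K0 : 0 < K by apply: lt_le_trans K1.
exists K, M; split => //; elim => [|n IH] k.
  rewrite /dual_iter /=; case: k => [|k]; first by rewrite nm1 expr0 mulr1.
  by rewrite nm0 mulr_ge0 ?(ltW K0) // exprn_ge0 // ltW.
have [kk|kk] := leqP k0 k.
  rewrite /dual_iter iterS -/(dual_iter n); apply: le_trans (hS (dual_iter n) K k (ltW K0) (fun j _ => IH j)) _.
  rewrite ler_wpM2r ?exprn_ge0 ?(ltW M0) // ler_piMr ?(ltW K0) //; exact: hk0.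
have [kn|kn] := ltnP k n.+1; first by rewrite (dual_iter_zero kn) nm0 mulr_ge0 ?(ltW K0) // exprn_ge0 // ltW.
have nk0 : (n.+1 < k0)%N by apply: leq_ltn_trans kk.
rewrite -ler_pdivrMr ?exprn_gt0 // /K (bigD1 (Ordinal nk0)) //= (bigD1 (Ordinal kk)) //=.
set x := nm _ / _; set s1 := \sum_(i < k0 | _) _; set s2 := \sum_(i < k0 | _) _.
have : 0 <= s1 by apply: sumr_ge0 => i _; exact: (pos n.+1 i).
have : 0 <= s2 by apply: sumr_ge0 => i _; exact: pos2.
lra.
Qed.

Lemma pairing_delta0 (f : fct) : entire f -> pairing (fun k => (k == 0%N)%:R) f = f 0.
Proof.
move=> fE; have [ef pf] := entire_taylor fE.
rewrite /pairing (@pval_poly _ _ 1); last by move=> [|k] //; rewrite mul0r.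
by rewrite /psum big_ord_recl big_ord0 /= mul1r expr0 mulr1 addr0 {2}pf pval0.
Qed.

Lemma iter_at0 n (f : fct) : entire f -> (iter n L f) 0 = pairing (dual_iter n) f.
Proof.
have [K [M [K0 M0 h]]] := dual_iter_bound.
have hg m : geo (dual_iter m) by exists K, M; split.
have [t1 _ _] := LO.
elim: n f => [|n IH] f fE; first by rewrite /dual_iter /= pairing_delta0.
rewrite iterSr (IH _ (t1 _ fE)).
have hs : geo (dual_op lambda phi (dual_iter n)) by have := hg n.+1; rewrite /dual_iter iterS.
by rewrite (pairing_L hL LO (hg n) hs fE) /dual_iter iterS.
Qed.

(** Every orbit is bounded at the point 0. *)
Lemma small_not_hypercyclic : ~ hypercyclic L.
Proof.
move=> [f fE hf]; have [K [M [K0 M0 h]]] := dual_iter_bound.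
have hg m : geo (dual_iter m) by exists K, M; split.
have [ef pf] := entire_taylor fE.
have [|B hB] := ef (2 * M); first by rewrite mulr_gt0.
have bd n : nm ((iter n L f) 0) <= 2 * (K * B).
  rewrite (iter_at0 n fE) /pairing.
  apply: (@pval_bound R (fun k => dual_iter n k * taylor_coef f k) (K * B) 1 1 ltr01); last by rewrite nm1.
    move=> k; rewrite mulr1 nmM.
    apply: (@le_trans _ _ (K * (nm (taylor_coef f k) * (2 * M) ^+ k))); last by rewrite ler_wpM2l // ltW.
    rewrite exprMn (_ : K * _ = K * M ^+ k * nm (taylor_coef f k) * 2 ^+ k); last by ring.
    by rewrite !ler_wpM2r ?nm_ge0 ?exprn_ge0.
  exact: (geo_Ecoef (hg n) ef).
pose c : C := ofR (2 * (K * B) + 2).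
have KB : 0 <= 2 * (K * B) by apply: le_trans (bd 0%N); rewrite nm_ge0.
have [g [n _ <-] h1] := (iffLR (dense_in_entireP _) hf) (scl c (mono 0)) 1 1 (entireZ c (entire_mono 0)) ltr01 ltr01.
have {}h1 : nm (c - iter n L f 0) <= 1.
  by have := h1 0; rewrite nm0 ler01 => /(_ isT); rewrite sclV /mono expr0 mulr1 nmB.
have := nm_le_dist c ((iter n L f) 0); have := bd n.
have -> : nm c = 2 * (K * B) + 2 by rewrite nm_ofR ger0_norm //; lra.
lra.
Qed.

End Zero.

End SmallLambda.

(** * Polynomials, and zeros of phi at the origin *)

Section Polynomials.
Variable R : realType.
Local Notation C := (Cplx R).
Local Notation nm := (@nm R).
Local Notation fct := (fctC R).

Lemma cont_op_psum (T : fct -> fct) c n : cont_op T ->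
  (T (psum c n : fct) : C -> C) = fun z => \sum_(k < n) c k * (T (mono k) : C -> C) z.
Proof.
move=> hT; have [t1 t2 t3] := hT; elim: n => [|n IH].
  by rewrite psum0 (cont_op0 hT); apply/funext => z; rewrite zerV big_ord0.
rewrite psum_lin (t2 (c n) _ _ (entire_mono n) (entire_psum c n)).
by apply/funext => z; rewrite linV IH big_ord_recr /= addrC.
Qed.

Lemma mono_psum k : (mono k : C -> C) = psum (fun j => (j == k)%:R) k.+1.
Proof.
apply/funext => z; rewrite /psum big_ord_recr /= eqxx mul1r big1 ?add0r // => j _.
by rewrite ltn_eqF ?mul0r.
Qed.

Lemma ratio_small_on (c : C) (r e : R) (f : fct) : 0 < e -> small_on r (e / (nm c + 1)) f -> small_on r e (scl c f).
Proof.
move=> e0 h z zr; rewrite sclV nmM.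
have c1 : 0 < nm c + 1 by rewrite ltr_wpDl ?nm_ge0.
have := h z zr; rewrite ler_pdivlMr //; have := nm_ge0 (f z); lra.
Qed.

Lemma vanishing_orbit_sub T : cont_op T -> linear_sub (@vanishing_orbit R T).
Proof.
move=> hT; split.
  split; first exact: entire0.
  move=> r e r0 e0; exists 0%N => n _ z _; rewrite (cont_op0 (cont_op_iter n hT)) zerV nm0; exact: ltW.
move=> c f g [fE hf] [gE hg]; split; first exact: (entire_lin c fE gE).
move=> r e r0 e0; have c1 : 0 < nm c + 1 by rewrite ltr_wpDl ?nm_ge0.
have e2 : 0 < e / 2 by rewrite divr_gt0.
have [N hN] := hf r _ r0 (divr_gt0 e2 c1); have [M hM] := hg r _ r0 e2.
exists (maxn N M) => n; rewrite geq_max => /andP[/hN h1 /hM h2] z zr.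
have [_ h _] := cont_op_iter n hT; rewrite (h c f g fE gE) linV.
apply: le_trans (nmD _ _) _; have := ratio_small_on e2 h1 zr; rewrite sclV.
have := h2 z zr; lra.
Qed.

Lemma vanishing_preorbit_sub T : cont_op T -> linear_sub (@vanishing_preorbit R T).
Proof.
move=> hT; split.
  split; first exact: entire0.
  move=> r e r0 e0; exists 0%N => n _; exists (@zer R); split; first exact: entire0.
    by move=> z _; rewrite zerV nm0; exact: ltW.
  exact: (cont_op0 (cont_op_iter n hT)).
move=> c f g [fE hf] [gE hg]; split; first exact: (entire_lin c fE gE).
move=> r e r0 e0; have c1 : 0 < nm c + 1 by rewrite ltr_wpDl ?nm_ge0.
have e2 : 0 < e / 2 by rewrite divr_gt0.
have [N hN] := hf r _ r0 (divr_gt0 e2 c1); have [M hM] := hg r _ r0 e2.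
exists (maxn N M) => n; rewrite geq_max => /andP[/hN [h1 [h1E s1 T1]] /hM [h2 [h2E s2 T2]]].
exists (lin c h1 h2); split; first exact: (entire_lin c h1E h2E).
  move=> z zr; rewrite linV.
  apply: le_trans (nmD _ _) _; have := ratio_small_on e2 s1 zr; rewrite sclV.
  have := s2 z zr; lra.
by have [_ h _] := cont_op_iter n hT; rewrite (h c h1 h2 h1E h2E) T1 T2.
Qed.

Variables (lambda : C) (phi : fct) (L : fct -> fct).
Hypothesis lam0 : lambda != 0.
Hypothesis phiE : entire phi.
Hypothesis hL : forall f : fct, entire f -> L f = dilation lambda (fun_of_D phi f).
Hypothesis LO : cont_op L.
Let a := taylor_coef phi.
Variable m : nat.
Hypothesis am_lt : forall i, (i < m)%N -> a i = 0.
Hypothesis am : a m != 0.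

Lemma Lcoef_zero k j : (k - m < j)%N || (k < m)%N -> Lcoef lambda phi k j = 0.
Proof.
move=> h; rewrite /Lcoef; case: leqP => [jk|//]; rewrite -/a am_lt ?mul0r //.
by move: h jk; lia.
Qed.

Lemma L_pol c n : exists c', (L (psum c n : fct) : C -> C) = psum c' (n - m).
Proof.
exists (fun j => \sum_(k < n) c k * Lcoef lambda phi k j).
rewrite (cont_op_psum c n LO); apply/funext => z; rewrite /psum.
under [RHS]eq_bigr do rewrite big_distrl /=.
rewrite exchange_big /=; apply: eq_bigr => k _.
rewrite (L_mono hL k) (@pval_poly _ _ (n - m)); last first.
  by move=> j hj; apply: Lcoef_zero; move: hj (ltn_ord k); move: (k : nat) => i; lia.
by rewrite /psum big_distrr /=; apply: eq_bigr => j _; rewrite mulrA.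
Qed.

Lemma iterL_pol c n p : exists c', (iter p L (psum c n : fct) : C -> C) = psum c' (n - m * p).
Proof.
elim: p => [|p [c' IH]]; first by exists c; rewrite muln0 subn0.
have [d hd] := L_pol c' (n - m * p); exists d.
by rewrite iterS IH hd mulnS addnC subnDA.
Qed.

Lemma iterL_kill c n p : (n <= m * p)%N -> iter p L (psum c n : fct) = @zer R.
Proof.
move=> h; have [c' ->] := iterL_pol c n p.
by rewrite (_ : (n - m * p)%N = 0%N) ?psum0 //; apply/eqP; rewrite subn_eq0.
Qed.

(** The matrix of L on the monomials is triangular, with nonzero entries m places
    off the diagonal. *)
Lemma L_surj c n : exists c', (L (psum c' (n + m) : fct) : C -> C) = psum c n.
Proof.
have [t1 t2 t3] := LO.
elim: n c => [|n IH] c.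
  exists (fun=> 0); have [c' ->] := L_pol (fun=> 0) (0 + m).
  by rewrite add0n subnn !psum0.
pose l := Lcoef lambda phi (n + m) n.
have l0 : l != 0.
  rewrite /l /Lcoef leq_addr addKn -/a; apply: mulf_neq0; last by rewrite expf_neq0.
  by apply: mulf_neq0 => //; rewrite pnatr_eq0 -lt0n ffact_gt0 leq_addl.
pose t := c n / l.
have [c' hc'] := IH (fun k => c k - t * Lcoef lambda phi (n + m) k).
pose d k := if (k < n + m)%N then c' k else t.
exists d; rewrite addSn psum_lin (t2 _ _ _ (entire_mono (n + m)) (entire_psum d (n + m))).
have -> : (psum d (n + m) : C -> C) = psum c' (n + m).
  by apply/funext => z; apply: eq_bigr => k _; rewrite /d ltn_ord.
rewrite hc'; apply/funext => z; rewrite linV (L_mono hL (n + m)).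
rewrite (@pval_poly _ _ n.+1); last by move=> j hj; apply: Lcoef_zero; rewrite addnK hj.
rewrite /d ltnn !psumS -/l mulrDr mulrA divfK // addrAC addrC.
rewrite [RHS]addrC; congr (_ + _).
rewrite /psum big_distrr -big_split /=; apply: eq_bigr => k _; ring.
Qed.

Lemma iterL_surj p c n : exists n' c', (iter p L (psum c' n' : fct) : C -> C) = psum c n.
Proof.
elim: p c n => [|p IH] c n; first by exists n, c.
have [c1 h1] := L_surj c n; have [n' [c' h']] := IH c1 (n + m)%N.
by exists n', c'; rewrite iterS h' h1.
Qed.

(** Given polynomials p and q, choose n with L^n p = 0 and a polynomial w with
    L^n w = q. Then p + t w is close to p for small t, and is mapped to q by L^n / t;
    no bound on w is needed. *)
Lemma small_supercyclic : (0 < m)%N -> supercyclic L.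
Proof.
move=> m0.
have [||f fE hf] := @universality R (C * nat)%type (fun i f => scl i.1 (iter i.2 L f)).
- by move=> [c n]; apply: cont_op_scale; exact: cont_op_iter.
- move=> x y r e xE yE r0 e0; have e2 : 0 < e / 2 by rewrite divr_gt0.
  have [n hn] := entire_poly_approx xE r0 e2.
  have [n' hn'] := entire_poly_approx yE r0 e0.
  set p : fct := psum _ n in hn; set q : fct := psum _ n' in hn'.
  have [k [c hk]] := iterL_surj n (taylor_coef y) n'.
  set w : fct := psum c k in hk.
  have pE : entire p by exact: entire_psum.
  have wE : entire w by exact: entire_psum.
  have [M M0 hM] : exists2 M : R, 0 <= M & forall z, nm z <= r -> nm (w z) <= M.
    by apply: ccont_bounded; apply: cdiff_ccont; apply/entireP.
  have M1 : 0 < M + 1 by rewrite ltr_wpDl.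
  pose t : R := e / 2 / (M + 1); have t0 : 0 < t by rewrite divr_gt0.
  have ot : ofR t != 0.
    by apply/eqP => h; have := nm_ofR t; rewrite h nm0 gtr0_norm //; lra.
  exists ((ofR t)^-1, n), (lin (ofR t) w p); split; first exact: (entire_lin _ wE pE).
    move=> z zr; rewrite linV -addrA; apply: le_trans (nmD _ _) _.
    have := hn z zr; have : nm (ofR t * w z) <= e / 2.
      rewrite nmM nm_ofR gtr0_norm // /t mulrAC ler_pdivrMr // ler_wpM2l ?(ltW e2) //.
      by have := hM z zr; lra.
    lra.
  have [_ hl _] := cont_op_iter n LO.
  rewrite /= (hl (ofR t) w p wE pE) hk /p (iterL_kill (taylor_coef x)); last by rewrite leq_pmull.
  move=> z zr; rewrite sclV linV zerV addr0 mulrA mulVf // mul1r.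
  exact: hn'.
exists f; first exact: fE.
move=> g gE; have := hf g gE; apply: closureS => h [[c n] /= ->].
by exists c => //; exists n.
Qed.

Lemma iterL_cexp n b : iter n L (cexp b) = scl (\prod_(j < n) phi (lambda ^+ j * b)) (cexp (lambda ^+ n * b)).
Proof.
elim: n b => [|n IH] b.
  by apply/funext => z; rewrite sclV big_ord0 mul1r expr0 mul1r.
rewrite iterS IH (cont_opZ _ LO (entire_cexp _)) (L_cexp phiE hL).
apply/funext => z; rewrite !sclV big_ord_recr /= mulrA exprS mulrA.
by [].
Qed.

Lemma phi_lower : exists c0 d : R, [/\ 0 < c0, 0 < d <= 1 & forall b, nm b <= d -> c0 * nm b ^+ m <= nm (phi b)].
Proof.
have [Ea phip] := entire_taylor phiE; rewrite -/a in Ea phip.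
pose a' k := a (k + m)%N.
have Ea' : Ecoef a'.
  move=> r r0; have [K hK] := Ea r r0; exists (K / r ^+ m) => k.
  rewrite ler_pdivlMr ?exprn_gt0 // -mulrA -exprD; exact: hK.
have fac b : phi b = b ^+ m * pval a' b.
  rewrite phip; have h := lim_toM (lim_to_cst (b ^+ m)) (pval_lim b Ea').
  apply: limn_lim_to => e /h [N hN]; exists (N + m)%N => n hn.
  have nN : (N <= n - m)%N by rewrite leq_subRL 1?addnC // (leq_trans (leq_addl N m)).
  have := hN _ nN; rewrite (_ : _ * psum a' _ _ = psum a n b) //.
  rewrite -{2}(subnK (leq_trans (leq_addl N m) hn)) addnC /psum big_split_ord /=.
  rewrite [X in _ = X + _]big1 ?add0r; last by move=> i _; rewrite am_lt ?mul0r.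
  rewrite big_distrr /=; apply: eq_bigr => i _; rewrite /a' exprD (addnC i); ring.
have am0 : 0 < nm (a m) / 2 by rewrite divr_gt0 ?nm_gt0.
have [d d0 hd] := cdiff_cont (pval_cdiff 0 Ea') am0.
exists (nm (a m) / 2), (Num.min 1 d); split => //; first by rewrite lt_min ltr01 d0 ge_min lexx.
move=> b; rewrite le_min => /andP[_ bd]; rewrite fac nmM nmX mulrC ler_wpM2l ?exprn_ge0 ?nm_ge0 //.
have := hd b; rewrite subr0 => /(_ bd); rewrite (pval0 Ea') /a' add0n => h.
have := nm_le_dist (a m) (pval a' b); rewrite nmB; lra.
Qed.

Hypothesis lam1 : 1 <= nm lambda.

(** Polynomials are eventually killed by L, and exponentials of small exponent have
    small preimages under L^n. *)
Lemma big_zero_hypercyclic : (0 < m)%N -> hypercyclic L.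
Proof.
move=> m0; apply: (hypercyclicity_criterion LO).
  apply: clo_mono_dense; first exact: vanishing_orbit_sub.
  move=> k; apply: clo_incl; split; first exact: (entire_mono k).
  move=> r e r0 e0; exists k.+1 => n kn z _.
  have h : iter n L (mono k) = @zer R.
    rewrite (mono_psum k); apply: (iterL_kill (fun j => (j == k)%:R)).
    by rewrite (leq_trans kn) // leq_pmull.
  by rewrite h zerV nm0; exact: ltW.
have [c0 [d [c00 /andP[d0 d1] hc]]] := phi_lower.
apply: (@exp_dense R _ 0); first exact: vanishing_preorbit_sub.
move=> d' d'0; pose b : C := ofR (Num.min d d').
have nb : nm b = Num.min d d' by rewrite nm_ofR ger0_norm // le_min !ltW.
have nb0 : 0 < nm b by rewrite nb lt_min d0.
have bd : nm b <= d by rewrite nb ge_min lexx.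
have b0 : b != 0 by apply/eqP => h; rewrite h nm0 ltxx in nb0.
exists b; split; [exact: b0|by rewrite subr0 nb ge_min lexx orbT|].
split; first exact: entire_cexp.
move=> r e r0 e0.
pose D := Num.max 1 c0^-1.
have D1 : 1 <= D by rewrite le_max lexx.
have D0 : 0 < D by apply: lt_le_trans D1.
have Dc : D^-1 <= c0 by rewrite -[c0]invrK lef_pV2 ?posrE ?invr_gt0 // le_max lexx orbT.
have [|K hK] := @Ecoef_fact R (2 * r * (2 * D)); first by rewrite !mulr_gt0.
have K0 : 0 <= K by apply: le_trans (hK 0%N); rewrite mulr_ge0 ?nm_ge0.
have [N hN] := half_pow_small (2 * K) e0.
exists N => n Nn.
(* L^n e_bn = P e_b, and L^n kills the Taylor polynomial of e_bn of degree
   < m n, so the preimage is the tail of e_bn divided by P; the factor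
   1 / (m n)! in the tail beats every geometric growth. *)
pose bn := lambda ^- n * b; pose P := \prod_(j < n) phi (lambda ^+ j * bn).
have l0 : 0 < nm lambda by apply: lt_le_trans lam1.
have nbn : nm bn = nm b / nm lambda ^+ n by rewrite nmM nmV nmX mulrC.
have bn1 : nm bn <= 1.
  rewrite nbn ler_pdivrMr ?exprn_gt0 // mul1r (le_trans (le_trans bd d1)) // exprn_ege1 //.
have bn0 : 0 < nm bn by rewrite nbn divr_gt0 ?exprn_gt0.
have hP : c0 ^+ n * nm bn ^+ (m * n) <= nm P.
  rewrite /P nm_prod -[X in X <= _]mulr1 exprM -exprMn mulr1.
  rewrite -[X in _ ^+ X](card_ord n) -prodr_const; apply: ler_prod => j _.
  apply/andP; split; first by rewrite mulr_ge0 ?(ltW c00) // exprn_ge0 ?nm_ge0.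
  apply: le_trans (hc _ _); last first.
    rewrite nmM nmX nbn mulrCA mulrA -mulrA; apply: le_trans bd.
    by rewrite ler_piMr ?nm_ge0 // ler_pdivrMr ?exprn_gt0 // mul1r ler_weXn2l // ltnW // ltn_ord.
  rewrite ler_wpM2l ?(ltW c00) // lerXn2r ?nnegrE ?nm_ge0 // nmM nmX ler_peMl ?nm_ge0 //.
  by rewrite exprn_ege1.
have P0 : 0 < nm P by apply: lt_le_trans hP; rewrite mulr_gt0 ?exprn_gt0.
have Pn0 : P != 0 by apply/eqP => h; rewrite h nm0 ltxx in P0.
pose q : fct := psum (exp_seq bn) (m * n).
have qE : entire q by exact: entire_psum.
exists (scl P^-1 (lin (-1) q (cexp bn))); split.
- exact: (entireZ _ (entire_lin _ qE (entire_cexp _))).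
- move=> z zr; rewrite sclV linV mulN1r nmM nmV.
  pose t k := if (k < m * n)%N then exp_seq bn k else 0.
  have Et : Ecoef t by apply: (@Ecoef_poly _ _ (m * n)) => k hk; rewrite /t ltnNge hk.
  have -> : q z = pval t z.
    rewrite (@pval_poly _ _ (m * n)); last by move=> k hk; rewrite /t ltnNge hk.
    by apply: eq_bigr => k _; rewrite /t ltn_ord.
  have key : nm (cexp bn z - pval t z) <= 2 * (nm P * (K * 2^-1 ^+ n)).
    apply: (@pval_dclose R (exp_seq bn) t r (nm P * (K * 2^-1 ^+ n)) r0 (Ecoef_exp_seq bn) Et) => // k.
    rewrite /t; have [kmn|kmn] := ltnP k (m * n).
      by rewrite subrr nm0 mul0r !mulr_ge0 ?nm_ge0 ?exprn_ge0.
    rewrite subr0 /exp_seq nmM nmX.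
    have h1 : nm bn ^+ k <= nm bn ^+ (m * n) by rewrite ler_wiXn2l ?nm_ge0.
    have h2 : nm (k`!%:R^-1 : C) * (2 * r) ^+ k <= c0 ^+ n * (K * 2^-1 ^+ n).
      have h3 := hK k; rewrite exprMn mulrA -ler_pdivlMr ?exprn_gt0 ?mulr_gt0 // in h3.
      apply: (le_trans h3); rewrite -exprVn mulrCA ler_wpM2l //.
      apply: (@le_trans _ _ ((2 * D)^-1 ^+ n)).
        rewrite ler_wiXn2l ?invr_ge0 ?mulr_ge0 ?(ltW D0) //.
          by rewrite invf_le1 ?mulr_gt0 //; lra.
        by rewrite (leq_trans _ kmn) // leq_pmull.
      rewrite invfM exprMn mulrC ler_wpM2r ?exprn_ge0 ?invr_ge0 // lerXn2r ?nnegrE ?invr_ge0 ?(ltW D0) //.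
      exact: ltW.
    rewrite -mulrA; apply: (@le_trans _ _ (nm bn ^+ (m * n) * (c0 ^+ n * (K * 2^-1 ^+ n)))).
      by apply: ler_pM; rewrite ?exprn_ge0 ?nm_ge0 // mulr_ge0 ?nm_ge0 ?exprn_ge0 // mulr_ge0 ?(ltW r0).
    rewrite mulrA (mulrC (nm bn ^+ _)) ler_wpM2r // mulr_ge0 ?exprn_ge0 //.
  rewrite addrC mulrC ler_pdivrMr // (le_trans key) //.
  by rewrite mulrCA mulrC ler_wpM2r ?nm_ge0 //; have := hN n Nn; lra.
- have it := cont_op_iter n LO.
  rewrite (cont_opZ _ it (entire_lin _ qE (entire_cexp _))).
  have [_ hl _] := it; rewrite (hl (-1) q _ qE (entire_cexp bn)).
  rewrite iterL_cexp -/P /q (iterL_kill (exp_seq bn)) //.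
  apply/funext => z; rewrite sclV linV zerV sclV mulr0 add0r mulrA mulVf // mul1r.
  by rewrite /bn mulrA divff ?mul1r // expf_neq0.
Qed.

End Polynomials.

(** * The case |lambda| >= 1: zeros of phi away from the origin *)

Section BigLambda.
Variable R : realType.
Local Notation C := (Cplx R).
Local Notation nm := (@nm R).
Local Notation fct := (fctC R).

(** Two of the powers of lambda are close to each other, by compactness of the
    circle. *)
Lemma rotation_recurrent (lambda : C) (e : R) : nm lambda = 1 -> 0 < e ->
  exists2 k, (0 < k)%N & nm (lambda ^+ k - 1) <= e.
Proof.
move=> l1 e0; have [K hK] : exists K : nat, 2 / e < K%:R.
  by exists (Num.truncn (2 / e)).+1; rewrite truncnS_gt.
have K0 : 0 < K%:R :> R by apply: le_lt_trans hK; rewrite divr_ge0 // ltW.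
pose box (x : R) : 'I_(2 * K).+1 := inord (Num.truncn ((x + 1) * K%:R)).
have boxP (x y : R) : `|x| <= 1 -> `|y| <= 1 -> box x = box y -> `|x - y| <= K%:R^-1.
  have bnd (t : R) : `|t| <= 1 -> [/\ 0 <= (t + 1) * K%:R & (Num.truncn ((t + 1) * K%:R) < (2 * K).+1)%N].
    rewrite ler_norml => /andP[h1 h2]; have p : 0 <= (t + 1) * K%:R by rewrite mulr_ge0 ?(ltW K0) //; lra.
    split => //; rewrite ltnS -(ler_nat R); apply: le_trans (_ : (t + 1) * K%:R <= _).
      by rewrite truncn_le.
    by rewrite natrM ler_wpM2r ?(ltW K0) //; lra.
  move=> /bnd [px bx] /bnd [py by_] /(congr1 val); rewrite /= !inordK // => h.
  have hx := truncn_itv px; have hy := truncn_itv py; rewrite h in hx.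
  move: hx hy => /andP[x1 x2] /andP[y1 y2]; rewrite -natr1 in x2 y2.
  rewrite -[leRHS]mul1r ler_pdivlMr // -[X in _ * X](ger0_norm (ltW K0)) -normrM ler_norml mulrBl.
  by rewrite !mulrDl in x1 x2 y1 y2; apply/andP; split; lra.
(* Pigeonhole principle on a grid of mesh 1 / K. *)
pose f (n : 'I_(#|{: 'I_(2 * K).+1 * 'I_(2 * K).+1}|.+1)) := (box (re (lambda ^+ n)), box (im (lambda ^+ n))).
have nf : ~ injective f by move=> /leq_card; rewrite card_ord ltnn.
have [i [j [ij fij]]] : exists i j, i <> j /\ f i = f j.
  apply: contrapT => h; apply: nf => i j fij; apply: contrapT => ij; apply: h.
  by exists i, j.
have pw n : nm (lambda ^+ n) = 1 by rewrite nmX l1 expr1n.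
have near i' j' : (i' < j')%N -> nm (lambda ^+ j' - lambda ^+ i') <= e -> exists2 k, (0 < k)%N & nm (lambda ^+ k - 1) <= e.
  move=> h h2; exists (j' - i')%N; first by rewrite subn_gt0.
  move: h2; rewrite -{1}(subnKC (ltnW h)) exprD -{2}[lambda ^+ i']mulr1 -mulrBr nmM pw mul1r.
  exact.
have close_ : nm (lambda ^+ i - lambda ^+ j) <= e.
  case: fij => h1 h2.
  have rb n : `|re (lambda ^+ n)| <= 1 by rewrite -(pw n) nm_ge_re.
  have ib n : `|im (lambda ^+ n)| <= 1 by rewrite -(pw n) nm_ge_im.
  have r1 := boxP _ _ (rb i) (rb j) h1; have r2 := boxP _ _ (ib i) (ib j) h2.
  apply: le_trans (nm_le_reim _) _; rewrite reB imB.
  have : 2 / K%:R <= e by rewrite ler_pdivrMr // mulrC -ler_pdivrMr // ltW.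
  lra.
have [lt|lt|/val_inj e1] := ltngtP i j; last by case: ij.
  by apply: near lt _; rewrite nmB.
exact: near lt _.
Qed.

Variables (lambda : C) (phi : fct) (L : fct -> fct).
Hypothesis lam0 : lambda != 0.
Hypothesis phiE : entire phi.
Hypothesis hL : forall f : fct, entire f -> L f = dilation lambda (fun_of_D phi f).
Hypothesis LO : cont_op L.
Let a := taylor_coef phi.

Definition Phi q : fct := fun b => \prod_(j < q) phi (lambda ^+ j * b).

Lemma entire_prod q : entire (Phi q).
Proof.
elim: q => [|q IH].
  have -> : Phi 0 = mono 0 by apply/funext => b; rewrite /Phi /mono big_ord0 expr0.
  exact: entire_mono.
have -> : Phi q.+1 = (fun b => Phi q b * phi (lambda ^+ q * b + 0)).
  by apply/funext => b; rewrite /Phi big_ord_recr /= addr0.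
exact: (entire_mul IH (entire_affine (lambda ^+ q) 0 phiE)).
Qed.

Arguments entire_prod q : clear implicits.

(** The q-th power of L is diagonal on exponentials. *)
Lemma root_iter q n b : lambda ^+ q = 1 -> iter n (iter q L) (cexp b) = scl (Phi q b ^+ n) (cexp b).
Proof.
move=> hq; have it := cont_op_iter q LO.
elim: n => [|n IH]; first by apply/funext => z; rewrite sclV expr0 mul1r.
rewrite iterS IH (cont_opZ _ it (entire_cexp b)) (iterL_cexp phiE hL LO) hq mul1r.
by apply/funext => z; rewrite !sclV exprSr mulrA.
Qed.

Lemma near_points (f : fct) b (P : C -> Prop) : entire f ->
  (exists2 e : R, 0 < e & forall w, nm (f w - f b) <= e -> P w) ->
  forall d : R, 0 < d -> exists w, [/\ w != b, nm (w - b) <= d & P w].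
Proof.
move=> /entireP fE [e e0 h] d d0; have [v hv] := fE b.
have [d' d'0 hd'] := cdiff_cont hv e0.
pose x := Num.min d d'; have x0 : 0 < x by rewrite lt_min d0.
have nx : nm (b + ofR x - b) = x by rewrite addrAC subrr add0r nm_ofR gtr0_norm.
exists (b + ofR x); split.
- by rewrite -subr_eq0; apply/eqP => h2; move: nx; rewrite h2 nm0 => h3; rewrite -h3 ltxx in x0.
- by rewrite nx ge_min lexx.
- by apply: h; apply: hd'; rewrite nx ge_min lexx orbT.
Qed.

(** The Godefroy-Shapiro argument: around a1 the orbits of exponentials tend to 0
    under L^q, around a0 those under its inverse. *)
Lemma root_of_unity_hypercyclic q a1 a0 : (0 < q)%N -> lambda ^+ q = 1 -> nm (Phi q a1) < 1 -> 1 < nm (Phi q a0) ->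
  hypercyclic L.
Proof.
move=> q0 hq h1 h0; apply: (hypercyclic_power q0).
have it := cont_op_iter q LO; apply: (hypercyclicity_criterion it).
  apply: (@exp_dense R _ a1); first exact: (vanishing_orbit_sub it).
  apply: (@near_points (Phi q) a1 (fun w => vanishing_orbit (iter q L) (cexp w)) (entire_prod q)); pose t := (1 - nm (Phi q a1)) / 2.
  exists t; first by rewrite /t; lra.
  move=> w hw; have hw1 : nm (Phi q w) <= 1 - t.
    by have := nm_le_dist (Phi q w) (Phi q a1); rewrite /t in hw *; lra.
  split; first exact: entire_cexp.
  move=> r e r0 e0; have [M M0 hM] := cexp_bounded w r.
  have [|N hN] := @pow_small R M (1 - t) e _ e0.
    by rewrite /t; have h := nm_ge0 (Phi q a1); apply/andP; split; lra.
  exists N => n Nn z zr; rewrite (root_iter n w hq) sclV nmM nmX mulrC.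
  apply: le_trans (hN n Nn); apply: ler_pM; rewrite ?nm_ge0 ?exprn_ge0 ?nm_ge0 ?hM //.
  by rewrite lerXn2r ?nnegrE ?nm_ge0 // (le_trans _ hw1) ?nm_ge0.
apply: (@exp_dense R _ a0); first exact: (vanishing_preorbit_sub it).
apply: (@near_points (Phi q) a0 (fun w => vanishing_preorbit (iter q L) (cexp w)) (entire_prod q)); pose t := (nm (Phi q a0) - 1) / 2.
have t0 : 0 < t by rewrite /t; lra.
exists t; first exact: t0.
move=> w hw; have hw1 : 1 + t <= nm (Phi q w).
  by have := nm_le_dist (Phi q a0) (Phi q w); rewrite nmB /t in hw *; lra.
split; first exact: entire_cexp.
move=> r e r0 e0; have [M M0 hM] := cexp_bounded w r.
have [|N hN] := @pow_small R M (1 + t)^-1 e _ e0.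
  by rewrite invr_ge0 invf_lt1; lra.
have Pw0 : 0 < nm (Phi q w) by lra.
have Pw : Phi q w != 0 by apply/eqP => h; rewrite h nm0 ltxx in Pw0.
exists N => n Nn; exists (scl (Phi q w ^- n) (cexp w)); split.
- exact: (entireZ _ (entire_cexp w)).
- move=> z zr; rewrite sclV nmM nmV nmX mulrC -exprVn.
  apply: le_trans (hN n Nn); apply: ler_pM; rewrite ?nm_ge0 ?exprn_ge0 ?invr_ge0 ?nm_ge0 ?hM //.
  by rewrite lerXn2r ?nnegrE ?invr_ge0 ?nm_ge0 // ?lef_pV2 ?posrE //; lra.
- rewrite (cont_opZ _ (cont_op_iter n it) (entire_cexp w)) (root_iter n w hq).
  by apply/funext => z; rewrite !sclV mulrA mulVf ?mul1r // expf_neq0.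
Qed.

(** The function Phi q vanishes at w and not at 0, so by Liouville's theorem its
    modulus is not bounded by 1. *)
Lemma root_of_unity_zero_hypercyclic q w : (0 < q)%N -> lambda ^+ q = 1 -> phi 0 != 0 -> phi w = 0 -> hypercyclic L.
Proof.
move=> q0 hq p0 pw.
have Pw : Phi q w = 0.
  by rewrite /Phi; case: q q0 {hq} => // q _; rewrite big_ord_recl /= expr0 mul1r pw mul0r.
have [|/asboolPn h] := pselect (exists a0, 1 < nm (Phi q a0)).
  move=> [a0 h0]; apply: (@root_of_unity_hypercyclic q w a0) => //; by rewrite Pw nm0.
exfalso; have hb z : nm (Phi q z) <= 1.
  by rewrite leNgt; apply/negP => hz; move/asboolPn: h; apply; exists z.
have := liouville (entire_prod q) hb w; rewrite Pw /Phi => /esym/eqP.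
rewrite prodf_seq_eq0 => /hasP[j _] /=; rewrite mulr0 => h2.
by rewrite h2 in p0.
Qed.

(** A sequence c stands here for the function sum c_k z^k / k!, so that e_b is the
    sequence of the powers of b and differentiation is the backward shift. The
    equation (D - p) u = v with u_0 = 0 has a solution whose norm for the weights
    r^k is at most that of v divided by r - W. Solving it in turn for
    p = p_0, p_1, ... from v = e_b leads to a combination of e_b and of the e_(p_j),
    in which e_b has the coefficient 1 / prod (b - p_j). *)
Lemma small_combination (r : R) (b : C) n (p : nat -> C) (W : R) : 0 <= W -> W < r ->
  (forall j, (j < n)%N -> nm (p j) <= W) -> nm b <= r -> (forall j, (j < n)%N -> b != p j) ->
  (forall i j, (i < j)%N -> (j < n)%N -> p j != p i) ->
  exists kap : nat -> C, forall k,
    nm (b ^+ k / \prod_(j < n) (b - p j) + \sum_(j < n) kap j * p j ^+ k) <= (r - W)^-1 ^+ n * r ^+ k.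
Proof.
move=> W0 Wr; have r0 : 0 < r by apply: le_lt_trans Wr.
have q0 : 0 < r - W by rewrite subr_gt0.
elim: n => [|n IH] hp br hb hpp.
  exists (fun=> 0) => k; rewrite !big_ord0 addr0 divr1 expr0 mul1r nmX.
  by rewrite lerXn2r ?nnegrE ?nm_ge0 // ltW.
have [kap hk] := IH (fun j h => hp j (ltnW h)) br (fun j h => hb j (ltnW h)) (fun i j h h' => hpp i j h (ltnW h')).
set P := \prod_(j < n) (b - p j) in hk.
set v := fun k => b ^+ k / P + \sum_(j < n) kap j * p j ^+ k in hk.
have P0 : P != 0.
  apply/prodf_neq0 => j _; rewrite subr_eq0; apply: hb; exact: ltnW (ltn_ord j).
have bp : b - p n != 0 by rewrite subr_eq0 hb.
have pp (j : 'I_n) : p j - p n != 0.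
  by rewrite subr_eq0 eq_sym hpp.
pose kap' j := if (j < n)%N then kap j / (p j - p n) else
   - (1 / (P * (b - p n)) + \sum_(j < n) kap j / (p j - p n)).
exists kap'; rewrite big_ord_recr /= -/P.
(* u solves u_(k+1) = p_n u_k + v_k with u_0 = 0. *)
pose u k := b ^+ k / (P * (b - p n)) + \sum_(j < n.+1) kap' j * p j ^+ k.
have uE k : u k = (b ^+ k - p n ^+ k) / (P * (b - p n)) + \sum_(j < n) kap j / (p j - p n) * (p j ^+ k - p n ^+ k).
  rewrite /u big_ord_recr /= {2}/kap' ltnn.
  rewrite (eq_bigr (fun j : 'I_n => kap j / (p j - p n) * p j ^+ k)); last by move=> j _; rewrite /kap' ltn_ord.
  rewrite [X in _ = _ + X](eq_bigr (fun j : 'I_n => kap j / (p j - p n) * p j ^+ k - kap j / (p j - p n) * p n ^+ k)); last first.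
    by move=> j _; rewrite mulrBr.
  rewrite sumrB -big_distrl /=; ring.
have u0 : u 0%N = 0.
  rewrite uE !expr0 subrr mul0r add0r big1 // => j _; by rewrite mulr0.
have uS k : u k.+1 = p n * u k + v k.
  have h1 : (b ^+ k.+1 - p n ^+ k.+1) / (P * (b - p n)) = p n * ((b ^+ k - p n ^+ k) / (P * (b - p n))) + b ^+ k / P.
    by rewrite !exprS; field; rewrite P0 bp.
  have h2 : \sum_(j < n) kap j / (p j - p n) * (p j ^+ k.+1 - p n ^+ k.+1) =
      p n * (\sum_(j < n) kap j / (p j - p n) * (p j ^+ k - p n ^+ k)) + \sum_(j < n) kap j * p j ^+ k.
    rewrite [X in _ = X + _]big_distrr -big_split /=; apply: eq_bigr => j _.
    by rewrite !exprS; field; exact: pp.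
  by rewrite !uE /v h1 h2; ring.
move=> k; rewrite -/(u k); elim: k => [|k IHk].
  by rewrite u0 nm0 mulr_ge0 ?exprn_ge0 ?invr_ge0 ?(ltW q0) ?(ltW r0).
rewrite uS; apply: le_trans (nmD _ _) _; rewrite nmM.
set Q := (r - W)^-1 in hk IHk *; have Qq : Q * (r - W) = 1 by rewrite mulVf // gt_eqF.
have Q0 : 0 < Q by rewrite invr_gt0.
apply: (@le_trans _ _ (W * (Q ^+ n.+1 * r ^+ k) + Q ^+ n * r ^+ k)).
  by apply: lerD; [apply: ler_pM; rewrite ?nm_ge0 ?hp|exact: hk].
rewrite le_eqVlt; apply/orP; left; apply/eqP.
rewrite (_ : Q ^+ n * r ^+ k = Q ^+ n * r ^+ k * (Q * (r - W))); last by rewrite Qq mulr1.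
by rewrite !exprS; ring.
Qed.

Hypothesis lam1 : 1 <= nm lambda.

(** The exponentials of exponents lambda^-j w are eventually killed; these exponents
    accumulate at w if |lambda| = 1 and at 0 otherwise. Adding a suitable
    combination of them to a multiple of an exponential, as in [small_combination],
    makes it a small preimage of e_b under L^n. *)
Lemma generic_zero_hypercyclic w : (forall q, (0 < q)%N -> lambda ^+ q != 1) -> phi 0 != 0 -> phi w = 0 -> hypercyclic L.
Proof.
move=> hroot p0 pw.
have l0 : 0 < nm lambda by apply: lt_le_trans lam1.
have w0 : w != 0 by apply/eqP => h; rewrite h in pw; rewrite pw eqxx in p0.
have nw : 0 < nm w by apply: nm_gt0.
pose p j := lambda ^- j * w.
have pE i j : (i <= j)%N -> p j = lambda ^- (j - i) * p i.
  move=> ij; rewrite /p mulrA; congr (_ * _); rewrite -{1}(subnK ij) exprD invfM.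
  by [].
have pinj i j : (i < j)%N -> p j != p i.
  move=> ij; rewrite (pE i j (ltnW ij)) -subr_eq0 -{2}[p i]mul1r -mulrBl mulf_eq0 negb_or.
  have ji : (0 < j - i)%N by rewrite subn_gt0.
  rewrite subr_eq0 /p mulf_neq0 ?invr_neq0 ?expf_neq0 // andbT.
  by rewrite -(inj_eq invr_inj) invrK invr1 hroot.
have np j : nm (p j) = nm w / nm lambda ^+ j by rewrite nmM nmV nmX mulrC.
have npw j : nm (p j) <= nm w.
  by rewrite np ler_pdivrMr ?exprn_gt0 // ler_peMr ?nm_ge0 // exprn_ege1.
have kill n j : (j < n)%N -> iter n L (cexp (p j)) = @zer R.
  move=> jn; rewrite (iterL_cexp phiE hL LO).
  apply/funext => z; rewrite sclV zerV (bigD1 (Ordinal jn)) //= {1}/p mulrA divff ?expf_neq0 //.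
  by rewrite mul1r pw !mul0r.
apply: (hypercyclicity_criterion LO).
  have hX j : vanishing_orbit L (cexp (p j)).
    split; first exact: entire_cexp.
    move=> r e r0 e0; exists j.+1 => n jn z _; rewrite (kill n j jn) zerV nm0; exact: ltW.
  have [l1|l1] := eqVneq (nm lambda) 1.
    apply: (@exp_dense R _ w); first exact: (vanishing_orbit_sub LO).
    move=> d d0; have [k k0 hk] := rotation_recurrent l1 (divr_gt0 d0 nw).
    exists (p k); split; last exact: hX.
      by have := pinj 0%N k k0; rewrite {2}/p expr0 invr1 mul1r.
    rewrite (_ : p k - w = - (lambda ^+ k - 1) * lambda ^- k * w); last first.
      by rewrite /p; field; rewrite expf_neq0.
    by rewrite nmM nmM nmN nmV nmX l1 expr1n invr1 mulr1 -ler_pdivlMr.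
  apply: (@exp_dense R _ 0); first exact: (vanishing_orbit_sub LO).
  move=> d d0; have l2 : 1 < nm lambda by rewrite lt_neqAle eq_sym l1.
  have [|N hN] := @pow_small R (nm w) (nm lambda)^-1 d _ d0.
    by rewrite invr_ge0 nm_ge0 invf_lt1.
  exists (p N); split; last exact: hX.
    by rewrite /p mulf_neq0 ?invr_neq0 ?expf_neq0.
  by rewrite subr0 np -exprVn hN.
have am0 : a 0%N != 0 by have [Ea phip] := entire_taylor phiE; rewrite /a -(pval0 Ea) -phip.
have lt0 i : (i < 0)%N -> a i = 0 by [].
have [c0 [d [c00 /andP[d0 d1] hc]]] := phi_lower phiE lt0 am0.
apply: (@exp_dense R _ 0); first exact: (vanishing_preorbit_sub LO).
move=> d' d'0; pose b : C := ofR (Num.min (Num.min d d') (nm w / 2)).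
have nb : nm b = Num.min (Num.min d d') (nm w / 2).
  by rewrite nm_ofR ger0_norm // !le_min !ltW // divr_gt0.
have nb0 : 0 < nm b by rewrite nb !lt_min d0 d'0 divr_gt0.
have bd : nm b <= d by rewrite nb !ge_min lexx.
have bd' : nm b <= d' by rewrite nb !ge_min lexx orbT.
have bw : nm b <= nm w / 2 by rewrite nb !ge_min lexx orbT.
have b0 : b != 0 by apply/eqP => h; rewrite h nm0 ltxx in nb0.
exists b; split; [exact: b0|by rewrite subr0|].
split; first exact: entire_cexp.
move=> rho e rho0 e0.
pose r := nm w + 4 * nm w / c0.
have rw : 0 < 4 * nm w / c0 by rewrite divr_gt0 // mulr_gt0.
have r0 : 0 < r by rewrite /r; lra.
have [|K hK] := @Ecoef_fact R (r * (2 * rho)); first by rewrite !mulr_gt0.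
have [N hN] := half_pow_small (2 * K) e0.
exists N => n Nn.
(* L^n e_bn = P e_b, and L^n kills the exponentials of exponents p_j for
   j < n; r is so large that the gain of small_combination beats |Q / P|. *)
pose bn := lambda ^- n * b; pose P := \prod_(j < n) phi (lambda ^+ j * bn).
have nbn : nm bn = nm b / nm lambda ^+ n by rewrite nmM nmV nmX mulrC.
have bnb : nm bn <= nm b by rewrite nbn ler_pdivrMr ?exprn_gt0 // ler_peMr ?nm_ge0 // exprn_ege1.
have hP : c0 ^+ n <= nm P.
  rewrite /P nm_prod -[X in _ ^+ X](card_ord n) -prodr_const; apply: ler_prod => j _.
  rewrite (ltW c00) /=; have := hc (lambda ^+ j * bn); rewrite expr0 mulr1; apply.
  rewrite nmM nmX nbn mulrCA; apply: le_trans bd.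
  by rewrite ler_piMr ?nm_ge0 // ler_pdivrMr ?exprn_gt0 // mul1r ler_weXn2l // ltnW // ltn_ord.
have P0 : 0 < nm P by apply: lt_le_trans hP; rewrite exprn_gt0.
have Pn0 : P != 0 by apply/eqP => h; rewrite h nm0 ltxx in P0.
have bnp j : (j < n)%N -> bn != p j.
  have ln0 k : nm lambda ^+ k != 0 by rewrite expf_neq0 // gt_eqF.
  move=> jn; apply/eqP => h; have := nbn; rewrite h np => /eqP; rewrite (eqr_div _ _ (ln0 j) (ln0 n)).
  move/eqP => h2; have : nm w * nm lambda ^+ n <= nm b * nm lambda ^+ n.
    by rewrite h2 ler_wpM2l ?nm_ge0 // ler_weXn2l // ltnW.
  by rewrite ler_pM2r ?exprn_gt0 //; lra.
have [||kap hkap] := @small_combination r bn n p (nm w) (ltW nw) _ (fun j _ => npw j) _ bnp (fun i j ij _ => pinj i j ij).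
- by rewrite /r; lra.
- by rewrite /r; lra.
set Q := \prod_(j < n) (bn - p j) in hkap.
have Q0 : Q != 0 by apply/prodf_neq0 => j _; rewrite subr_eq0; apply: bnp; exact: ltn_ord.
have hQ : nm Q <= (2 * nm w) ^+ n.
  rewrite /Q nm_prod -[X in _ ^+ X](card_ord n) -prodr_const; apply: ler_prod => j _.
  rewrite nm_ge0 /=; apply: le_trans (nmBD _ _) _; have := npw j; lra.
pose s : fct := fun z => \sum_(j < n) kap j * cexp (p j) z.
have [sE sk] : entire s /\ iter n L s = @zer R.
  have hV : linear_sub (fun f : fct => entire f /\ iter n L f = @zer R).
    have it := cont_op_iter n LO; split; first by split; [exact: entire0|exact: (cont_op0 it)].
    move=> c f g [fE fz] [gE gz]; split; first exact: (entire_lin c fE gE).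
    have [_ hl _] := it; rewrite (hl c f g fE gE) fz gz.
    by apply/funext => z; rewrite linV zerV mulr0 addr0.
  apply: (@sub_sum R _ n (fun j => cexp (p j)) kap hV) => j jn.
  by split; [exact: entire_cexp|exact: kill].
exists (scl (Q / P) (lin Q^-1 (cexp bn) s)); split.
- exact: (entireZ _ (entire_lin _ (entire_cexp _) sE)).
- move=> z zr; rewrite sclV linV.
  pose t k := (bn ^+ k / Q + \sum_(j < n) kap j * p j ^+ k) / k`!%:R.
  have Et : Ecoef t.
    apply: (@Ecoef_dom R _ (fun k => k`!%:R^-1) ((r - nm w)^-1 ^+ n) r r0).
    + by rewrite exprn_ge0 // invr_ge0 /r; lra.
    + by move=> k; rewrite /t nmM ler_wpM2r ?nm_ge0.
    + exact: Ecoef_fact.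
  have tE : Q^-1 * cexp bn z + s z = pval t z.
    have hs : lim_to (fun n' => \sum_(j < n) kap j * psum (exp_seq (p j)) n' z) (s z).
      rewrite /s; elim: (n) => [|n' IH]; first by rewrite big_ord0; apply: lim_to_ext (lim_to_cst 0) => ?; rewrite big_ord0.
      rewrite big_ord_recr /=; apply: lim_to_ext (lim_toD IH (lim_toM (lim_to_cst (kap n')) (pval_lim z (Ecoef_exp_seq (p n'))))) => ?.
      by rewrite big_ord_recr.
    apply: (lim_to_uniq _ (pval_lim z Et)).
    apply: lim_to_ext (lim_toD (lim_toM (lim_to_cst Q^-1) (pval_lim z (Ecoef_exp_seq bn))) hs) => n'.
    rewrite /psum big_distrr /=.
    under [X in _ + X = _]eq_bigr do rewrite big_distrr /=.
    rewrite [X in _ + X = _]exchange_big /= -big_split /=; apply: eq_bigr => k _.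
    rewrite /t /exp_seq mulrDl mulrDl; congr (_ + _); first by ring.
    rewrite !big_distrl /=; apply: eq_bigr => j _; ring.
  rewrite tE nmM; set X := nm (Q / P).
  have Xge0 : 0 <= X by exact: nm_ge0.
  have hX : X * (r - nm w)^-1 ^+ n <= 2^-1 ^+ n.
    rewrite /X nmM nmV (_ : r - nm w = 4 * nm w / c0); last by rewrite /r; ring.
    rewrite -mulrA mulrCA mulrC ler_pdivrMr //.
    apply: (@le_trans _ _ ((2 * nm w) ^+ n * (4 * nm w / c0)^-1 ^+ n)).
      by rewrite ler_wpM2r // exprn_ge0 // invr_ge0 ltW.
    apply: (@le_trans _ _ (2^-1 ^+ n * c0 ^+ n)); last by rewrite ler_wpM2l // exprn_ge0.
    rewrite -!exprMn le_eqVlt; apply/orP; left; apply/eqP; congr (_ ^+ _); field.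
    by rewrite !gt_eqF.
  have key : nm (pval t z) <= 2 * ((r - nm w)^-1 ^+ n * K).
    apply: (pval_bound rho0 _ Et zr) => k; rewrite /t nmM.
    apply: (@le_trans _ _ ((r - nm w)^-1 ^+ n * r ^+ k * nm (k`!%:R^-1 : C) * (2 * rho) ^+ k)).
      by rewrite !ler_wpM2r ?nm_ge0 // exprn_ge0 // mulr_ge0 // ltW.
    rewrite -!mulrA ler_wpM2l ?exprn_ge0 ?invr_ge0 //; first by rewrite /r; lra.
    by apply: le_trans (hK k); rewrite (exprMn k r (2 * rho)) mulrCA.
  apply: (@le_trans _ _ (X * (2 * ((r - nm w)^-1 ^+ n * K)))); first by rewrite ler_wpM2l.
  have K0 : 0 <= K by apply: le_trans (hK 0%N); rewrite mulr_ge0 ?nm_ge0.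
  apply: le_trans (hN n Nn); rewrite (_ : X * _ = 2 * K * (X * (r - nm w)^-1 ^+ n)); last by ring.
  by rewrite ler_wpM2l // mulr_ge0.
- have it := cont_op_iter n LO.
  rewrite (cont_opZ _ it (entire_lin _ (entire_cexp _) sE)).
  have [_ hl _] := it; rewrite (hl Q^-1 (cexp bn) s (entire_cexp bn) sE) sk (iterL_cexp phiE hL LO) -/P.
  apply/funext => z; rewrite sclV linV zerV sclV addr0.
  have -> : lambda ^+ n * bn = b by rewrite /bn mulrA divff ?mul1r // expf_neq0.
  move: (cexp b z) => A; field; by rewrite Q0 Pn0.
Qed.

End BigLambda.

(** * Zero-free functions of exponential type *)

Section ZeroFree.
Variable R : realType.
Local Notation C := (Cplx R).
Local Notation nm := (@nm R).
Local Notation fct := (fctC R).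

Definition cj (z : C) : C := conjc z.
Lemma cjD x y : cj (x + y) = cj x + cj y. Proof. exact: (rmorphD (@conjc R)). Qed.
Lemma cjM x y : cj (x * y) = cj x * cj y. Proof. exact: (rmorphM (@conjc R)). Qed.
Lemma cjN x : cj (- x) = - cj x. Proof. exact: (rmorphN (@conjc R)). Qed.
Lemma cjn n : cj n%:R = n%:R. Proof. exact: (rmorph_nat (@conjc R)). Qed.
Lemma cjV x : cj x^-1 = (cj x)^-1. Proof. exact: (fmorphV (@conjc R)). Qed.
Lemma cjX x n : cj (x ^+ n) = cj x ^+ n. Proof. exact: (rmorphXn (@conjc R)). Qed.
Lemma cj_sum n (F : nat -> C) : cj (\sum_(k < n) F k) = \sum_(k < n) cj (F k).
Proof. exact: (rmorph_sum (@conjc R)). Qed.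
Lemma cj_ofR x : cj (ofR x) = ofR x. Proof. by rewrite /cj /ofR /= oppr0. Qed.
Lemma nm_cj z : nm (cj z) = nm z. Proof. by case: z => a b; rewrite /nm /cj /= sqrrN. Qed.
Lemma mul_cj z : z * cj z = ofR (nm z ^+ 2).
Proof. by rewrite expr2 ofRM; exact: esym (sqr_normc z). Qed.
Lemma add_cj z : z + cj z = ofR (2 * re z).
Proof. by rewrite ofRM ofRn; exact: addcJ. Qed.

Lemma cexp_cj z : cexp 1 (cj z) = cj (cexp 1 z).
Proof.
have E1 := @Ecoef_exp_seq R 1; apply: (lim_to_uniq (pval_lim (cj z) E1)) => e e0.
have [N hN] := pval_lim z E1 e0; exists N => n Nn.
have -> : psum (exp_seq 1) n (cj z) = cj (psum (exp_seq 1) n z).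
  rewrite /psum (cj_sum n (fun k => exp_seq 1 k * z ^+ k)); apply: eq_bigr => k _.
  by rewrite /exp_seq expr1n div1r cjM cjV cjn cjX.
by rewrite -cjN -cjD nm_cj; exact: hN.
Qed.

Lemma cexp_real (x : R) : cexp 1 (ofR x) = ofR (expR x).
Proof.
apply: limn_lim_to => e e0.
have /cvgrPdist_le /(_ _ e0) [N _ hN] := @is_cvg_series_exp_coeff R x.
exists N => n /hN; rewrite distrC => h.
have -> : psum (exp_seq 1) n (ofR x) = ofR (series (exp_coeff x) n).
  rewrite exp_coeffE /series /= big_mkord (big_morph _ (@ofRD R) (@ofR0 R)).
  apply: eq_bigr => k _; rewrite /exp_seq expr1n div1r ofRM ofRV ofRn; congr (_ * _).
  by elim: (k : nat) => [|j IH]; rewrite ?expr0 // !exprS ofRM IH.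
by rewrite -ofRN -ofRD nm_ofR.
Qed.

(** From e^w times its conjugate, which is e^(2 Re w). *)
Lemma nm_cexp w : nm (cexp 1 w) = expR (re w).
Proof.
apply/eqP; rewrite -(@eqrXn2 _ 2) ?nm_ge0 ?expR_ge0 //; apply/eqP.
have := mul_cj (cexp 1 w); rewrite -cexp_cj -cexp1D add_cj cexp_real => /(congr1 (@re R)).
rewrite /re /ofR /= => <-.
by rewrite -expRM_natl.
Qed.

(** The k-th Fourier coefficient of a nonnegative function on a circle is bounded by
    its mean, and on a circle that of Re(pval H) has the k-th coefficient
    H_k r^k / 2. *)
Lemma borel_caratheodory (H : nat -> C) (K B : R) : Ecoef H -> H 0%N = 0 ->
  (forall z, re (pval H z) <= K + B * nm z) -> forall r k, 0 < r -> (0 < k)%N -> nm (H k) * r ^+ k <= 2 * (K + B * r).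
Proof.
move=> EH H0 hre r k r0 k0; apply: le_eps => e e0.
have e2 : 0 < e / 2 by rewrite divr_gt0.
have [n0 hn0] := pval_approx EH r0 e2.
pose n := maxn n0 k.+1; have kn : (k < n)%N by rewrite leq_maxr.
have [m hm] := exists_pow (n + n).
have nN : (n <= 2 ^ m.+1)%N by rewrite (leq_trans _ hm) // leq_addr.
pose p j := psum H n (pts m r j); pose c := K + B * r + e / 2.
have hp j : 0 <= c - re (p j).
  rewrite subr_ge0 /c; have pr : nm (pts m r j) = r by rewrite nm_pts // ltW.
  have h1 := hre (pts m r j); rewrite pr in h1.
  have := hn0 n (pts m r j) (leq_maxl _ _); rewrite pr lexx => /(_ isT) h2.
  have := le_trans (nm_ge_re _) h2; rewrite reB ler_norml -/(p j) => /andP[h3 _].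
  lra.
(* The k-th Fourier coefficients of P, of its conjugate and of a constant are
   H_k r^k, 0 and 0; hence H_k r^k is minus that of 2 (c - Re P) >= 0. *)
have A1 : avg m (fun j => p j * chr R m k j) = H k * ofR r ^+ k.
  by rewrite (@avg_psum R m H n k r (leq_trans kn nN) nN) kn mul1r.
have A2 : avg m (fun j => cj (p j) * chr R m k j) = 0.
  rewrite (_ : (fun _ => _) = fun j => \sum_(l < n) cj (H l) * ofR r ^+ l * ((uroot R m ^+ j) ^+ 0 * chr R m (l + k) j)); last first.
    apply/funext => j; rewrite /p /psum (cj_sum n (fun l => H l * pts m r j ^+ l)) big_distrl; apply: eq_bigr => l _ /=.
    have lN : (l + k <= 2 ^ m.+1)%N.
      apply: leq_trans hm; apply: leq_add; exact: ltnW.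
    rewrite expr0 mul1r !chrE //; last by rewrite ltnW // (leq_trans kn).
    rewrite cjM cjX /pts cjM cj_ofR exprMn cjX exprD invfM.
    have u1 : cj (uroot R m) = (uroot R m)^-1.
      have := mul_cj (uroot R m); rewrite uroot_nm expr1n => h.
      apply: (mulfI (_ : uroot R m != 0)).
        by apply/eqP => h0; have := uroot_nm R m; rewrite h0 nm0 => /esym/eqP; rewrite oner_eq0.
      rewrite h divff //.
      by apply/eqP => h0; have := uroot_nm R m; rewrite h0 nm0 => /esym/eqP; rewrite oner_eq0.
    rewrite u1 !exprVn; ring.
  rewrite (avg_sum m n (fun l j => cj (H l) * ofR r ^+ l * ((uroot R m ^+ j) ^+ 0 * chr R m (l + k) j))).
  rewrite big1 // => l _.
  rewrite avgZ avg_chr ?expn_gt0 //; first by rewrite addn_eq0 (gtn_eqF k0) andbF mulr0.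
  apply: leq_trans hm; rewrite -addnS; apply: leq_add => //; exact: ltnW.
have A3 : avg m (fun j => ofR (2 * c) * chr R m k j) = 0.
  rewrite avgZ (_ : chr R m k = fun j => (uroot R m ^+ j) ^+ 0 * chr R m k j).
    rewrite avg_chr ?expn_gt0 ?(gtn_eqF k0) ?mulr0 //; exact: leq_trans nN.
  by apply/funext => j; rewrite expr0 mul1r.
have A4 : avg m (fun j => ofR (2 * (c - re (p j))) * chr R m k j) = - (H k * ofR r ^+ k).
  rewrite (_ : (fun _ => _) = fun j => ofR (2 * c) * chr R m k j - (p j * chr R m k j + cj (p j) * chr R m k j)).
    by rewrite avgB avgD A1 A2 A3 addr0 sub0r.
  by apply/funext => j; rewrite -mulrDl add_cj -mulrBl -ofRN -ofRD; congr (ofR _ * _); ring.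
have A5 : avg m p = 0.
  have := @avg_psum R m H n 0 r (_ : 0 < 2 ^ m.+1)%N nN; rewrite expn_gt0 => /(_ isT).
  rewrite H0 mulr0 mul0r => <-; congr avg; apply/funext => j.
  by rewrite chrE // expr0 invr1 mulr1.
have N0 : 0 < (2 ^ m.+1)%:R :> R by rewrite ltr0n expn_gt0.
have : nm (H k * ofR r ^+ k) <= 2 * c.
  rewrite -nmN -A4 /avg nmM nmV nmn mulrC ler_pdivrMr //.
  apply: le_trans (nm_sum _ _ _) _.
  rewrite (eq_bigr (fun j : 'I_(2 ^ m.+1) => 2 * c - 2 * re (p j))); last first.
    by move=> j _; rewrite nmM nm_chr mulr1 nm_ofR ger0_norm ?mulrBr // -mulrBr mulr_ge0.
  rewrite sumrB sumr_const card_ord -big_distrr /=.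
  have -> : \sum_(j < 2 ^ m.+1) re (p j) = 0; last by rewrite mulr0 subr0 mulr_natr.
  have : re (\sum_(j < 2 ^ m.+1) p j) = 0.
    have := A5; rewrite /avg => /eqP; rewrite mulf_eq0 invr_eq0 pnatr_eq0 -leqn0 leqNgt expn_gt0 /= => /eqP ->.
    by [].
  by rewrite (big_morph (@re R) (@reD R) (erefl : re (0 : C) = 0)).
by rewrite nmM nmX nm_ofR gtr0_norm // /c; lra.
Qed.

(** Write phi = phi(0) e^h, where h is the primitive of phi' / phi vanishing at 0.
    The real part of h grows at most linearly, so by [borel_caratheodory] h is
    linear. *)
Lemma zero_free_exponential (phi : fct) : entire phi -> exponential_type phi -> (forall z, phi z != 0) ->
  exists beta : C, forall z, phi z = phi 0 * cexp beta z.
Proof.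
move=> phiE [A0 [B0 h0]] nz.
have [Ea phip] := entire_taylor phiE; set a := taylor_coef phi in Ea phip.
have dphi z : cdiff (phi : C -> C) z (pval (shiftd a) z).
  have := pval_cdiff z Ea; rewrite -phip; exact.
have gE : entire ((fun z => pval (shiftd a) z * (phi z)^-1) : fct).
  exact: (entire_mul (pval_entire (Ecoef_shiftd Ea)) (entire_inv phiE nz)).
have [b Eb gb] := entire_pval gE.
(* H is the Taylor series of a primitive of phi' / phi. *)
pose H k : C := if k is k'.+1 then b k' / k'.+1%:R else 0.
have EH : Ecoef H.
  move=> r r0; have [K hK] := Eb r r0; exists (Num.max 0 (K * r)) => -[|k].
    by rewrite nm0 mul0r le_max lexx.
  rewrite le_max; apply/orP; right; rewrite /H nmM nmV nmn exprSr mulrA ler_wpM2r ?(ltW r0) //.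
  apply: le_trans (hK k); rewrite ler_wpM2r ?exprn_ge0 ?(ltW r0) // ler_piMr ?nm_ge0 //.
  by rewrite invf_le1 ?ltr0n // ler1n.
have sH : shiftd H = b.
  by apply/funext => k; rewrite /shiftd /H mulrC divfK // pnatr_eq0.
pose h := pval H.
have dh z : cdiff h z (pval (shiftd a) z * (phi z)^-1).
  have := pval_cdiff z EH; rewrite sH -gb; exact.
pose F : fct := fun z => phi z * cexp 1 ((-1) * h z).
have dF z : cdiff (F : C -> C) z 0.
  have d1 : cdiff (fun w => (-1) * h w) z (0 * h z + (-1) * (pval (shiftd a) z * (phi z)^-1)).
    by apply: cdiff_mul; [exact: cdiff_cst|exact: dh].
  have d2 := @cdiff_comp R (cexp 1) (fun w => (-1) * h w) z _ _ d1 (@cexp_cdiff R 1 ((-1) * h z)).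
  have := cdiff_mul (dphi z) d2; rewrite [X in cdiff _ _ X](_ : _ = 0); first exact.
  have nzz := nz z; move: (cexp 1 (-1 * h z)) (pval (shiftd a) z) (h z) => x y t.
  by field.
have h00 : h 0 = 0 by rewrite /h (pval0 EH).
have key z : phi z = phi 0 * cexp 1 (h z).
  have := zero_derivative dF z; rewrite /F h00 mulr0 cexp_0 mulr1 mulN1r => <-.
  by rewrite -mulrA -cexp1D addNr cexp_0 mulr1.
have p0 : 0 < nm (phi 0) by rewrite nm_gt0.
pose A := Num.max 1 A0; have A1 : 1 <= A by rewrite le_max lexx.
pose K := ln (A / nm (phi 0)).
have AK : A = nm (phi 0) * expR K.
  by rewrite lnK ?posrE ?divr_gt0 //; [rewrite mulrC divfK // gt_eqF|lra].
have hre z : re (pval H z) <= K + B0 * nm z.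
  rewrite -ler_expR -nm_cexp expRD; have := h0 z; rewrite -[Normc.normc _]/(nm _) key nmM -/h => hz.
  rewrite -(ler_pM2l p0) mulrA -AK; apply: (le_trans hz).
  by rewrite ler_wpM2r ?expR_ge0 // le_max lexx orbT.
have bc := borel_caratheodory EH (erefl : H 0%N = 0) hre.
have Hk k : (2 <= k)%N -> H k = 0.
  move=> k2; apply: nm_eq0; apply/le_anti; rewrite nm_ge0 andbT; apply: le_eps => e e0; rewrite add0r.
  pose S := 2 * (`|K| + `|B0|); have S0 : 0 <= S by rewrite mulr_ge0 // addr_ge0.
  pose r := Num.max 1 (S / e); have r1 : 1 <= r by rewrite le_max lexx.
  have r0 : 0 < r by lra.
  have := bc r k r0 (ltnW k2) => h1.
  have h2 : nm (H k) * r ^+ 2 <= nm (H k) * r ^+ k by rewrite ler_wpM2l ?nm_ge0 // ler_weXn2l.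
  have h3 : 2 * (K + B0 * r) <= S * r.
    have := ler_norm K; have := ler_norm B0 => b1 k1.
    have : B0 * r <= `|B0| * r by rewrite ler_wpM2r // ltW.
    have : K <= `|K| * r by apply: (le_trans k1); rewrite ler_peMr.
    by rewrite /S; lra.
  have h4 : S <= e * r by rewrite mulrC -ler_pdivrMr // le_max lexx orbT.
  have : nm (H k) * r * r <= e * r * r.
    rewrite -mulrA -expr2; apply: (le_trans h2); apply: (le_trans h1); apply: (le_trans h3).
    by rewrite ler_wpM2r // ltW.
  by rewrite !ler_pM2r.
exists (H 1%N) => z; rewrite (key z) (cexp_swap (H 1%N) z).
have -> : h z = H 1%N * z; last by [].
rewrite /h (@pval_poly _ _ 2); last exact: Hk.
by rewrite /psum !big_ord_recl big_ord0 /= mul0r add0r addr0 expr1.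
Qed.

End ZeroFree.

(** * Zero-free phi, and the equivalence *)

Section ZeroFreeCase.
Variable R : realType.
Local Notation C := (Cplx R).
Local Notation nm := (@nm R).
Local Notation fct := (fctC R).
Variables (lambda : C) (phi : fct) (L : fct -> fct).
Hypothesis phiE : entire phi.
Hypothesis hL : forall f : fct, entire f -> L f = dilation lambda (fun_of_D phi f).
Hypothesis LO : cont_op L.
Hypothesis hD : forall f : fct, entire f -> diffop (L f) = scl lambda (L (diffop f)).

Lemma exponential_taylor beta : (forall z, phi z = phi 0 * cexp beta z) ->
  taylor_coef phi = fun k => phi 0 * exp_seq beta k.
Proof.
move=> h; have Eb := Ecoef_exp_seq beta; apply: taylor_pval; first exact: EcoefZ.
by apply/funext => z; rewrite (pvalZ _ _ Eb) -/(cexp beta z) -h.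
Qed.

(** Here L f(z) = phi(0) f(lambda z + beta), and evaluation at the fixed point z0 is
    an eigenfunctional; it is represented by the powers of z0. *)
Lemma fixed_point_not_supercyclic beta z0 : phi 0 != 0 -> (forall z, phi z = phi 0 * cexp beta z) ->
  beta + lambda * z0 = z0 -> ~ supercyclic L.
Proof.
move=> p0 hphi hz; pose d k := z0 ^+ k.
have hS k : dual_op lambda phi d k = phi 0 * d k.
  rewrite /dual_op (exponential_taylor hphi) /d -{2}hz exprDn big_distrr /=; apply: eq_bigr => j _.
  have jk : (j <= k)%N by rewrite -ltnS.
  have -> : (k ^_ (k - j))%:R = 'C(k, j)%:R * (k - j)`!%:R :> C by rewrite -natrM -bin_ffact bin_sub.
  rewrite -[X in _ = _ * X]mulr_natl exprMn /exp_seq; field; exact: fact_neq0.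
have gd : geo d.
  exists 1, (nm z0 + 1); split => // [|k]; first by rewrite ltr_wpDl ?nm_ge0.
  by rewrite mul1r nmX lerXn2r ?nnegrE ?addr_ge0 ?nm_ge0 // lerDl.
apply: (@not_supercyclic_eigen R L lambda (phi 0) d LO hD gd) => [|f fE]; first by rewrite /d expr0.
have e : dual_op lambda phi d = fun k => phi 0 * d k by apply/funext.
have gs : geo (dual_op lambda phi d).
  have [K [M [K0 M0 h]]] := gd; exists (nm (phi 0) * K), M; split => // [|k]; first by rewrite mulr_gt0 ?nm_gt0.
  by rewrite e nmM -mulrA ler_wpM2l ?nm_ge0.
have [ef pf] := entire_taylor fE.
rewrite (pairing_L hL LO gd gs fE) e /pairing -pvalZ; last exact: (geo_Ecoef gd ef).
by congr (pval _ 1); apply/funext => k; rewrite mulrA.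
Qed.

(** By Liouville's theorem, applied to phi and to its inverse, phi takes values of
    modulus greater and smaller than 1. *)
Lemma translation_hypercyclic : lambda = 1 -> (forall z, phi z != 0) -> (exists z, phi z != phi 0) -> hypercyclic L.
Proof.
move=> l1 nz [z hz].
have big (g : fct) : entire g -> g z != g 0 -> exists a0, 1 < nm (g a0).
  move=> gE hg; apply: contrapT => h; move/eqP: hg; apply; apply: (liouville gE (M := 1)) => w.
  by rewrite leNgt; apply/negP => hw; apply: h; exists w.
have P1 b : Phi lambda phi 1 b = phi b by rewrite /Phi big_ord_recl big_ord0 expr0 mul1r mulr1.
have [a0 h0] := big phi phiE hz.
have [|a1 h1] := big _ (entire_inv phiE nz).
  by apply/eqP => /invr_inj/eqP; rewrite (negbTE hz).
apply: (@root_of_unity_hypercyclic R lambda phi L phiE hL LO 1 a1 a0 (ltn0Sn 0)).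
- by rewrite l1 expr1n.
- by rewrite P1; move: h1; rewrite nmV invf_gt1 // nm_gt0.
- by rewrite P1.
Qed.

(** Unless lambda = 1 and beta <> 0, the map z |-> lambda z + beta has a fixed point. *)
Lemma zero_free_dichotomy : exponential_type phi -> (forall z, phi z != 0) -> supercyclic L -> hypercyclic L.
Proof.
move=> pe nz hs; have [beta hb] := zero_free_exponential phiE pe nz.
have [l1|l1] := eqVneq lambda 1; last first.
  exfalso; apply: (@fixed_point_not_supercyclic beta (beta / (1 - lambda)) (nz 0) hb _ hs).
  by field; rewrite subr_eq0 eq_sym.
have [b0|b0] := eqVneq beta 0.
  exfalso; apply: (@fixed_point_not_supercyclic beta 0 (nz 0) hb _ hs).
  by rewrite b0 mulr0 addr0.
apply: translation_hypercyclic => //; apply: contrapT => h.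
have hc z : cexp beta z = 1.
  apply: (mulfI (nz 0)); rewrite mulr1 -hb; apply: contrapT => h2; apply: h; exists z; exact/eqP.
have c1 := @cexp_cdiff R beta 0; have c2 := cdiff_cst (1 : C) 0.
have hf : (cexp beta : C -> C) = fun=> 1 by apply/funext => z; exact: hc.
rewrite hf in c1; have := cdiff_uniq c1 c2; rewrite mulr1 => /eqP; exact/negP.
Qed.

End ZeroFreeCase.

Theorem mainTheorem2 (R : realType) (lambda : Cplx R) (hlambda : lambda <> 0)
    (phi : fctC R) (hphi : entire phi) (hphi_exp : exponential_type phi)
    (L : fctC R -> fctC R)
    (hL : forall f : fctC R, entire f -> L f = dilation lambda (fun_of_D phi f))
    (hL_eigen : ext_eigenoperator_D lambda L) :
  (supercyclic L /\ ~ hypercyclic L) <-> (`|lambda| < 1 /\ phi 0 = 0).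
Proof.
have [hop hne hDL] := hL_eigen; have LO := is_operator_cont_op hop.
have hD (f : fctC R) : entire f -> diffop (L f) = scl lambda (L (diffop f)).
  by move=> fE; rewrite -sclE; exact: hDL.
have [Ea phip] := entire_taylor hphi.
set a := taylor_coef phi in Ea phip.
have a0E : a 0%N = phi 0 by rewrite phip pval0.
have lam0 : lambda != 0 by apply/eqP.
have lamE : (`|lambda| < 1) = (nm lambda < 1) by rewrite normE (ofR_lt _ 1).
have exm : exists i, a i != 0.
  apply: contrapT => h; have az i : a i = 0.
    by apply: contrapT => /eqP h2; apply: h; exists i.
  have [f fE Lf] := hne; apply: Lf; rewrite (hL f fE); apply/funext => z.
  rewrite /dilation /fun_of_D; apply: limn_lim_to.
  apply: lim_to_ext (lim_to_cst 0) => n; rewrite series_psum big1 // => k _.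
  by rewrite -/a az mul0r.
pose m := ex_minn exm.
have [am am_lt] : a m != 0 /\ forall i, (i < m)%N -> a i = 0.
  rewrite /m; case: ex_minnP => k hk hmin; split => // i ik.
  by apply/eqP; apply: contraTT ik => /hmin; rewrite -leqNgt.
have m0 : phi 0 = 0 -> (0 < m)%N.
  by move=> h; rewrite lt0n; apply/eqP => m0; move: am; rewrite m0 a0E h eqxx.
split.
  move=> [hs hh]; rewrite lamE; have [l1|l1] := ltP (nm lambda) 1.
    split => //; apply: contrapT => /eqP p0.
    apply: (small_nonzero_not_supercyclic hphi hphi_exp hL LO l1 _ hD hs).
    by rewrite -/a a0E.
  exfalso; apply: hh.
  have [p0|p0] := eqVneq (phi 0) 0.
    exact: (big_zero_hypercyclic lam0 hphi hL LO am_lt am l1 (m0 p0)).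
  have [[w pw]|hnz] := pselect (exists w, phi w = 0); last first.
    apply: (zero_free_dichotomy hphi hL LO hD hphi_exp _ hs) => z.
    by apply/eqP => pz; apply: hnz; exists z.
  have [[q [q0 hq]]|hroot] := pselect (exists q, (0 < q)%N /\ lambda ^+ q = 1).
    exact: (root_of_unity_zero_hypercyclic hphi hL LO q0 hq p0 pw).
  apply: (generic_zero_hypercyclic lam0 hphi hL LO l1 _ p0 pw) => q q0.
  by apply/eqP => hq; apply: hroot; exists q.
rewrite lamE => -[l1 p0]; split.
  exact: (small_supercyclic lam0 hL LO am_lt am (m0 p0)).
apply: (small_not_hypercyclic hphi hphi_exp hL LO l1).
by rewrite -/a a0E.
Qed.
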